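(* Let $$\mathcal{X}_i=\{x\in\mathbf{R}^{\nu_i}:\exists t\in\mathcal{T}^i: x^TT_{ki}x\le t_k,\ 1\le k\le K_i\},\ i\le I,\qquad \mathcal{Z}_j=\{z\in\mathbf{R}^{\mu_j}:\exists r\in\mathcal{R}^j: z^TR_{\ell j}z\le r_\ell,\ 1\le\ell\le L_j\},\ j\le J,$$ be basic ellitopes, let $P_i\in\mathbf{R}^{n\times\nu_i}$, $Q_j\in\mathbf{R}^{m\times\mu_j}$ be such that the sets $$\mathcal{X}=\mathrm{Conv}\Big\{\bigcup_{i=1}^IP_i\mathcal{X}_i\Big\}\subset\mathbf{R}^n,\qquad \mathcal{B}_*=\mathrm{Conv}\Big\{\bigcup_{j=1}^JQ_j\mathcal{Z}_j\Big\}\subset\mathbf{R}^m$$ have nonempty interiors, and let $\mathcal{B}=\{u\in\mathbf{R}^m:\max_{y\in\mathcal{B}_*}u^Ty\le1\}$ be the polar of $\mathcal{B}_*$. Given $A_{\mathrm{nom}},A_1,\dots,A_S\in\mathbf{R}^{m\times n}$, let $$\mathcal{U}=\Big\{A_{\mathrm{nom}}+\sum_{s=1}^S\epsilon_sA_s:\|\epsilon\|_\infty\le1\Big\},\qquad \mathcal{U}_{ij}=\Big\{Q_j^TA_{\mathrm{nom}}P_i+\sum_{s=1}^S\epsilon_sQ_j^TA_sP_i:\|\epsilon\|_\infty\le1\Big\},$$ and let $\kappa$ be the maximum of the ranks of $A_s$, $1\le s\le S$. For $i\le I$, $j\le J$ let $$\mathrm{Opt}_{ij}[\mathcal{U}]=\min_{\lambda,\upsilon,\{G^s,H^s\},\overline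 G,\overline H}\left\{\phi_{\mathcal{T}^i}(\lambda)+\phi_{\mathcal{R}^j}(\upsilon):\ \begin{array}{l}\lambda\ge0,\ \upsilon\ge0,\\ \sum_{s=1}^SG^s+\overline G\preceq\sum_{\ell=1}^{L_j}\upsilon_\ell R_{\ell j},\quad \sum_{s=1}^SH^s+\overline H\preceq\sum_{k=1}^{K_i}\lambda_kT_{ki},\\ \begin{bmatrix}G^s&\tfrac12Q_j^TA_sP_i\\ \tfrac12[Q_j^TA_sP_i]^T&H^s\end{bmatrix}\succeq0,\ s\le S,\\ \begin{bmatrix}\overline G&\tfrac12Q_j^TA_{\mathrm{nom}}P_i\\ \tfrac12[Q_j^TA_{\mathrm{nom}}P_i]^T&\overline H\end{bmatrix}\succeq0\end{array}\right\},$$ where $\lambda\in\mathbf{R}^{K_i}$, $\upsilon\in\mathbf{R}^{L_j}$, the $G^s,\overline G$ are symmetric $\mu_j\times\mu_j$ and the $H^s,\overline H$ are symmetric $\nu_i\times\nu_i$ matrices, and let $\mathrm{Opt}[\mathcal{U}]=\max_{i\le I,\,j\le J}\mathrm{Opt}_{ij}[\mathcal{U}]$. Then: (1) $\mathrm{Opt}[\mathcal{U}]$ is a convex function of $(A_{\mathrm{nom}},A_1,\dots,A_S)$ and is an upper bound on $\|\mathcal{U}\|_{\mathcal{B},\mathcal{X}}$. (2) For all $i\le I$, $j\le J$, $$\|\mathcal{U}_{ij}\|_{\mathcal{Z}_j^*,\mathcal{X}_i}\le\mathrm{Opt}_{ij}[\mathcal{U}]\le\big[\varsigma(K_i,L_j)+\varkappa(K_i)\varkappa(L_j)\vartheta(2\kappa)\big]\,\|\mathcal{U}_{ij}\|_{\mathcal{Z}_j^*,\mathcal{X}_i}.$$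 (3) $$\|\mathcal{U}\|_{\mathcal{B},\mathcal{X}}=\max_{i\le I,\,j\le J}\|\mathcal{U}_{ij}\|_{\mathcal{Z}_j^*,\mathcal{X}_i}\le\mathrm{Opt}[\mathcal{U}]\le\Big[\max_{i\le I,\,j\le J}\big[\varsigma(K_i,L_j)+\varkappa(K_i)\varkappa(L_j)\vartheta(2\kappa)\big]\Big]\,\|\mathcal{U}\|_{\mathcal{B},\mathcal{X}}.$$
   Context: A basic ellitope is a set $\{w\in\mathbf{R}^p:\exists t\in\mathcal{T}: w^TT_kw\le t_k,\ 1\le k\le K\}$, where $K\ge1$, the $T_k$ are symmetric $p\times p$ matrices with $T_k\succeq0$ and $\sum_kT_k\succ0$, and $\mathcal{T}\subset\mathbf{R}^K_+$ is a convex compact set with nonempty interior which is monotone: $0\le t\le t'$ (entrywise) and $t'\in\mathcal{T}$ imply $t\in\mathcal{T}$. The data $(T_{ki})_k,\mathcal{T}^i$ and $(R_{\ell j})_\ell,\mathcal{R}^j$ satisfy these requirements. $\phi_{\mathcal{T}}(\lambda)=\max_{t\in\mathcal{T}}\lambda^Tt$ is the support function of a compact set $\mathcal{T}$. For a symmetric (w.r.t. the origin) convex compact set $\mathcal{V}$ with nonempty interior, $\|\cdot\|_{\mathcal{V}}$ is the norm with unit ball $\mathcal{V}$; $\mathcal{Z}_j^*$ is the polar of $\mathcal{Z}_j$. For a matrix $A$, $\|A\|_{\mathcal{B},\mathcal{X}}=\max\{\|Ax\|_{\mathcal{B}}:\|x\|_{\mathcal{X}}\le1\}$, and for a compact set $\mathcal{U}$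 of matrices, $\|\mathcal{U}\|_{\mathcal{B},\mathcal{X}}=\max_{A\in\mathcal{U}}\|A\|_{\mathcal{B},\mathcal{X}}$ (and similarly for the pair $\mathcal{Z}_j^*,\mathcal{X}_i$). For positive integers $K,L,J$: $\varsigma(K,L)=3\sqrt{\ln(4K)\ln(4L)}$ if $\max[K,L]>1$ and $\varsigma(1,1)=1$; $\varkappa(1)=1$ and $\varkappa(J)=\tfrac52\sqrt{\ln(2J)}$ for $J>1$. For positive integers $k$: $$\vartheta(k)=\left[\min_{\alpha\in\mathbf{R}^k,\ \|\alpha\|_1=1}(2\pi)^{-k/2}\int_{\mathbf{R}^k}|\alpha_1u_1^2+\dots+\alpha_ku_k^2|\,e^{-u^Tu/2}\,du\right]^{-1},$$ and $\vartheta(0)=0$ (relevant only when all $A_s=0$). *)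

(* Defs.v *)
From HB Require Import structures.
From mathcomp Require Import all_boot all_order all_algebra.
From mathcomp Require Import all_classical all_reals all_analysis.

Set Implicit Arguments.
Unset Strict Implicit.
Unset Printing Implicit Defensive.

Import Order.TTheory GRing.Theory Num.Theory.
Import numFieldNormedType.Exports.

Local Open Scope classical_set_scope.
Local Open Scope ring_scope.

Definition tuple_cons (T : Type) k (p : T * k.-tuple T) : k.+1.-tuple T :=
  [tuple of p.1 :: p.2].

Lemma measurable_tuple_cons d (T : measurableType d) k :
  measurable_fun [set: T * k.-tuple T] (@tuple_cons T k).
Proof.
exact: (measurable_cons (@measurable_fst _ _ _ _) (@measurable_snd _ _ _ _)).
Qed.

Definition measure_cons d (T : measurableType d) (R : realType) k
    (m1 : {sigma_finite_measure set T -> \bar R})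
    (m2 : {sigma_finite_measure set (k.-tuple T) -> \bar R}) :
    set (k.+1.-tuple T) -> \bar R :=
  pushforward (m1 \x m2)%E (@tuple_cons T k).

Section measure_cons_instances.
Context d (T : measurableType d) (R : realType) (k : nat).
Variables (m1 : {sigma_finite_measure set T -> \bar R})
  (m2 : {sigma_finite_measure set (k.-tuple T) -> \bar R}).

Let mf := @measurable_tuple_cons d T k.

Let measure_cons0 : measure_cons m1 m2 set0 = 0%E.
Proof. by rewrite /measure_cons /pushforward preimage_set0 measure0. Qed.

Let measure_cons_ge0 A : (0 <= measure_cons m1 m2 A)%E.
Proof. exact: measure_ge0. Qed.

Let measure_cons_sigma_additive : semi_sigma_additive (measure_cons m1 m2).
Proof.
move=> F mF tF mUF; rewrite /measure_cons /pushforward preimage_bigcup.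
apply: measure_semi_sigma_additive.
- by move=> n; rewrite -[X in measurable X]setTI; exact: mf.
- apply/trivIsetP => /= i j _ _ ij; rewrite -preimage_setI.
  by move/trivIsetP : tF => /(_ _ _ _ _ ij) ->//; rewrite preimage_set0.
- by rewrite -preimage_bigcup -[X in measurable X]setTI; exact: mf.
Qed.

HB.instance Definition _ := isMeasure.Build _ _ _ (measure_cons m1 m2)
  measure_cons0 measure_cons_ge0 measure_cons_sigma_additive.

Let measure_cons_sigma_finite : sigma_finite setT (measure_cons m1 m2).
Proof.
have /sigma_finiteP[F [TF ndF Foo]] := sigma_finiteT m1.
have /sigma_finiteP[G [TG ndG Goo]] := sigma_finiteT m2.
exists (fun i => [set t : k.+1.-tuple T |
    (F i `*` G i) (thead t, [tuple of behead t])]).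
  apply/esym; rewrite -subTset => t _.
  have [i _ Fi] : (\bigcup_i F i) (thead t) by rewrite -TF.
  have [j _ Gj] : (\bigcup_i G i) [tuple of behead t] by rewrite -TG.
  exists (maxn i j) => //; split => /=.
  - by move: (thead t) Fi; exact/subsetPset/ndF/leq_maxl.
  - by move: [tuple of behead t] Gj; exact/subsetPset/ndG/leq_maxr.
move=> i; have [mF Fioo] := Foo i; have [mG Gioo] := Goo i; split.
  have mg : measurable_fun [set: k.+1.-tuple T]
      (fun t => (thead t, [tuple of behead t])).
    apply: measurable_fun_pair; last exact: measurable_behead.
    exact: measurable_tnth.
  by rewrite -[X in measurable X]setTI; apply: mg => //; exact: measurableX.
rewrite /measure_cons /pushforward.
rewrite (_ : @tuple_cons T k @^-1` _ = F i `*` G i).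
  by rewrite product_measure1E// lte_mul_pinfty// ge0_fin_numE.
have bK x t : [tuple of behead (@tuple_cons T k (x, t))] = t.
  exact: val_inj.
by apply/funext => -[x t]; rewrite /preimage/mkset bK theadE.
Qed.

HB.instance Definition _ := Measure_isSigmaFinite.Build _ _ _
  (measure_cons m1 m2) measure_cons_sigma_finite.

End measure_cons_instances.

(** Lebesgue measure on [R^k], as the [k]-fold product of the one on [R]. *)
Fixpoint lebesgue_tuple (R : realType) (k : nat) :
    {sigma_finite_measure set (k.-tuple (measurableTypeR R)) -> \bar R} :=
  match k with
  | 0 => \d_ [tuple]
  | k'.+1 => measure_cons (@lebesgue_measure R) (lebesgue_tuple R k')
  end.

(** A [max] or [min] of a set of reals is written [sup] or [inf] below.  The
  library's [sup] and [inf] return 0 on empty or unbounded sets; with basic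
  ellitopes, and with convex hulls of their images having nonempty interior,
  all the sets concerned are nonempty and bounded on the relevant side. *)

Section ellitopes.
Context (R : realType).

Definition dotv p (x y : 'cV[R]_p) : R := (x^T *m y) 0 0.

Definition quad p (M : 'M[R]_p) (x : 'cV[R]_p) : R := (x^T *m M *m x) 0 0.

Definition psdmx p (M : 'M[R]_p) : Prop := M^T = M /\ forall x, 0 <= quad M x.

Definition pdmx p (M : 'M[R]_p) : Prop :=
  M^T = M /\ forall x, x != 0 -> 0 < quad M x.

Definition loewner_le p (M N : 'M[R]_p) : Prop := psdmx (N - M).

Definition ellitope p K (T : 'I_K -> 'M[R]_p) (calT : set 'cV[R]_K) :
    set 'cV[R]_p :=
  [set w | exists2 t, calT t & forall k, quad (T k) w <= t k 0].

Definition monotone_set K (calT : set 'cV[R]_K) : Prop :=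
  forall t t' : 'cV[R]_K,
    (forall k, 0 <= t k 0 <= t' k 0) -> calT t' -> calT t.

Definition basic_ellitope_data p K
    (T : 'I_K -> 'M[R]_p) (calT : set 'cV[R]_K) : Prop :=
  [/\ (0 < K)%N,
      forall k, psdmx (T k),
      pdmx (\sum_k T k) &
      [/\ forall t, calT t -> forall k, 0 <= t k 0,
          convex_set calT,
          compact calT,
          calT° !=set0 &
          monotone_set calT]].

Definition support_fun K (calT : set 'cV[R]_K) (lam : 'cV[R]_K) : R :=
  sup [set dotv lam t | t in calT].

Definition conv_hull p (A : set 'cV[R]_p) : set 'cV[R]_p :=
  smallest (@convex_set R 'cV[R]_p) A.

Definition conv_images p I (nu : 'I_I -> nat) (P : forall i, 'M[R]_(p, nu i))
    (W : forall i, set 'cV[R]_(nu i)) : set 'cV[R]_p :=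
  conv_hull (\bigcup_i [set P i *m w | w in W i]).

Definition polar p (V : set 'cV[R]_p) : set 'cV[R]_p :=
  [set u | forall y, V y -> dotv u y <= 1].

(** The norm with unit ball [V], i.e. the Minkowski functional of [V]. *)
Definition ball_norm p (V : set 'cV[R]_p) (x : 'cV[R]_p) : R :=
  inf [set r | 0 <= r /\ exists2 v, V v & x = r *: v].

Definition opnorm m n (B : set 'cV[R]_m) (X : set 'cV[R]_n)
    (A : 'M[R]_(m, n)) : R :=
  sup [set ball_norm B (A *m x) | x in [set x | ball_norm X x <= 1]].

Definition opnorm_set m n (B : set 'cV[R]_m) (X : set 'cV[R]_n)
    (U : set 'M[R]_(m, n)) : R :=
  sup [set opnorm B X A | A in U].

(** The library norm [`|eps|] of a matrix is its entrywise max-norm. *)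
Definition uncertainty_set m n S (Anom : 'M[R]_(m, n))
    (A : 'I_S -> 'M[R]_(m, n)) : set 'M[R]_(m, n) :=
  [set Anom + \sum_s eps s 0 *: A s | eps in [set eps : 'cV[R]_S | `|eps| <= 1]].

Definition max_pair I J (f : 'I_I -> 'I_J -> R) : R :=
  sup [set f i j | i in setT & j in setT].

End ellitopes.

Section relaxation.
Context (R : realType).

Definition half_block q p (G : 'M[R]_q) (B : 'M[R]_(q, p)) (H : 'M[R]_p) :
    'M[R]_(q + p) :=
  block_mx G (2^-1 *: B) (2^-1 *: B^T) H.

Record feasible_pt p q K L S (T : 'I_K -> 'M[R]_p) (Rm : 'I_L -> 'M[R]_q)
    (Bnom : 'M[R]_(q, p)) (B : 'I_S -> 'M[R]_(q, p))
    (lam : 'cV[R]_K) (ups : 'cV[R]_L)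
    (G : 'I_S -> 'M[R]_q) (H : 'I_S -> 'M[R]_p)
    (Gbar : 'M[R]_q) (Hbar : 'M[R]_p) : Prop := FeasiblePt {
  feasible_lam : forall k, 0 <= lam k 0;
  feasible_ups : forall l, 0 <= ups l 0;
  feasible_symG : Gbar^T = Gbar /\ forall s, (G s)^T = G s;
  feasible_symH : Hbar^T = Hbar /\ forall s, (H s)^T = H s;
  feasible_G : loewner_le (\sum_s G s + Gbar) (\sum_l ups l 0 *: Rm l);
  feasible_H : loewner_le (\sum_s H s + Hbar) (\sum_k lam k 0 *: T k);
  feasible_block : forall s, psdmx (half_block (G s) (B s) (H s));
  feasible_nom : psdmx (half_block Gbar Bnom Hbar) }.

Definition Opt_pair p q K L S
    (T : 'I_K -> 'M[R]_p) (calT : set 'cV[R]_K)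
    (Rm : 'I_L -> 'M[R]_q) (calR : set 'cV[R]_L)
    (Bnom : 'M[R]_(q, p)) (B : 'I_S -> 'M[R]_(q, p)) : R :=
  inf [set v | exists lam ups G H Gbar Hbar,
    feasible_pt T Rm Bnom B lam ups G H Gbar Hbar /\
    v = support_fun calT lam + support_fun calR ups].

End relaxation.

Section constants.
Context (R : realType).

Definition varsigma (K L : nat) : R :=
  if (1 < maxn K L)%N
  then 3 * Num.sqrt (ln (4 * K%:R) * ln (4 * L%:R)) else 1.

Definition varkappa (J : nat) : R :=
  if (1 < J)%N then 5 / 2 * Num.sqrt (ln (2 * J%:R)) else 1.

Definition gauss_mean_abs k (alpha : 'I_k -> R) : R :=
  (2 * pi) `^ (- (k%:R / 2)) *
  \int[lebesgue_tuple R k]_u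
    (`|\sum_i alpha i * tnth u i ^+ 2| * expR (- (\sum_i tnth u i ^+ 2) / 2)).

Definition vartheta (k : nat) : R :=
  if k == 0%N then 0 else
  (inf [set gauss_mean_abs alpha
       | alpha in [set alpha : 'I_k -> R | \sum_i `|alpha i| = 1]])^-1.

End constants.

(* Main.v *)
(** Proof idea.  By conic duality the relaxation [Opt_ij] is, up to a factor
  [1 - tau], at most the sum of the nuclear norms of [C^T Bnom D] and of the
  [C^T B_s D] for some invertible [C], [D] such that [(tr (C C^T R_l))_l] lies
  below a point of [calR] and [(tr (D D^T T_k))_k] below a point of [calT].  These
  nuclear norms are compared with means of bilinear forms at Gaussian vectors [z],
  [x] with covariances at most [C C^T] and [D D^T].  For the nominal matrix, [z] and
  [x] are driven by the same Gaussian vector through the singular vectors, and the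
  mean of [z^T Bnom x] is the nuclear norm.  For the perturbations, [z] and [x] are
  independent; diagonalizing the bilinear form into [2 kappa] squares and using
  rotation invariance, the mean of [|z^T B_s x|] is at least the nuclear norm
  divided by [vartheta (2 kappa)], while [sum_s |z^T B_s x|] is the largest value of
  [sum_s eps_s z^T B_s x].  In both cases the form is at most the norm of the
  uncertain matrix times the gauges of [z] and [x], whose mean squares are at most
  [3 ln (4 L)] and [3 ln (4 K)] (or 1 for a single quadratic form) by exponential
  moments of Gaussian quadratic forms. *)

Require Import Defs.
From HB Require Import structures.
From mathcomp Require Import all_boot all_order all_algebra.
From mathcomp Require Import all_classical all_reals all_analysis.
From mathcomp Require Import measurable_realfun.
From mathcomp Require Import ring lra.

Set Implicit Arguments.
Unset Strict Implicit.
Unset Printing Implicit Defensive.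

Import Order.TTheory GRing.Theory Num.Theory.
Import numFieldNormedType.Exports.

Local Open Scope classical_set_scope.
Local Open Scope ring_scope.

(** * Linear change of variables for the Lebesgue measure *)

Section lebesgue_affine.
Context {R : realType}.
Notation mu := (@lebesgue_measure R).
Notation RM := (measurableTypeR R).

Lemma measurable_affine (a b : R) :
  measurable_fun [set: RM] (fun x : RM => (a * x + b : RM)%R).
Proof. by apply: measurable_funD => //; apply: measurable_funM. Qed.

(* [pushforward] is a measure for measurable maps only, and inference does not
   find the proof: the instance is given explicitly. *)
Definition affine_measure (a b : R) : {measure set RM -> \bar R} :=
  mscale (NngNum (normr_ge0 a))
    (measure_function_pushforward__canonical__measure_function_Measure
      mu (measurable_affine a b)).

Lemma lebesgue_measure_affine (a b : R) : a != 0 -> forall A : set RM,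
  measurable A ->
  mu A = (`|a|%:E * pushforward mu (fun x : RM => (a * x + b : RM)%R) A)%E.
Proof.
move=> a0 A mA.
pose m1 := affine_measure a b.
have -> : (`|a|%:E * pushforward mu (fun x : RM => (a * x + b : RM)%R) A)%E = m1 A.
  by [].
apply: lebesgue_measure_unique => // _ [[c d]] /= _ <-.
rewrite /m1/= /mscale/= /pushforward.
have [agt|alt|] := ltgtP 0 a; last by move=> a0'; rewrite a0' eqxx in a0.
- have -> : (fun x : R => a * x + b) @^-1` `]c, d]%classic =
     `](c - b) / a, (d - b) / a]%classic.
    apply/seteqP; split => x /=; rewrite !in_itv/= ltr_pdivrMr// ler_pdivlMr//;
      by rewrite ltrBlDr lerBrDr mulrC.
  rewrite !lebesgue_measure_itv/= !lte_fin ltr_pM2r ?invr_gt0// ltrD2r.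
  case: ifP => _; last by rewrite mule0.
  rewrite gtr0_norm// -!EFinB -EFinM; congr EFin; field; exact: lt0r_neq0.
- have -> : (fun x : R => a * x + b) @^-1` `]c, d]%classic =
     `[(d - b) / a, (c - b) / a[%classic.
    apply/seteqP; split => x /=; rewrite !in_itv/= ltr_ndivlMr// ler_ndivrMr//;
      by rewrite ltrBlDr lerBrDr mulrC andbC.
  rewrite !lebesgue_measure_itv/= !lte_fin ltr_nM2r ?invr_lt0// ltrD2r.
  case: ifP => _; last by rewrite mule0.
  rewrite ltr0_norm// -!EFinB -EFinM; congr EFin; field; exact: ltr0_neq0.
Qed.

Lemma integral_affine (a b : R) (f : RM -> \bar R) : a != 0 ->
  measurable_fun setT f -> (forall x, 0 <= f x)%E ->
  (`|a|%:E * \int[mu]_x f (a * x + b)%R)%E = (\int[mu]_x f x)%E.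
Proof.
move=> a0 mf f0.
pose m1 := affine_measure a b.
have -> : (\int[mu]_x f x = \int[m1]_x f x)%E.
  by apply: eq_measure_integral => A mA _; exact: lebesgue_measure_affine.
rewrite [RHS](@ge0_integral_mscale _ _ _ _ setT measurableT) //; congr (_ * _)%E.
rewrite [RHS]ge0_integral_pushforward//.
exact: measurable_affine.
Qed.

End lebesgue_affine.

Section lebesgue_tuple.
Context {R : realType}.
Notation mu := (@lebesgue_measure R).
Notation RM := (measurableTypeR R).
Implicit Types n k : nat.

Definition col_of_tuple n (u : n.-tuple RM) : 'cV[R]_n := \col_i tnth u i.
Definition tuple_of_col n (v : 'cV[R]_n) : n.-tuple RM := [tuple v i 0 | i < n].

Lemma tuple_of_colK n : cancel (@tuple_of_col n) (@col_of_tuple n).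
Proof. by move=> v; apply/colP => i; rewrite mxE tnth_mktuple. Qed.

Definition col_measurable n (f : 'cV[R]_n -> \bar R) : Prop :=
  measurable_fun [set: n.-tuple RM] (f \o @col_of_tuple n).

Lemma measurable_col_comp d (X : measurableType d) n (f : 'cV[R]_n -> \bar R)
    (h : X -> 'cV[R]_n) :
  (forall i, measurable_fun setT (fun x => h x i 0 : RM)) -> col_measurable f ->
  measurable_fun setT (f \o h).
Proof.
move=> mh mf.
have -> : f \o h = (f \o @col_of_tuple n) \o (@tuple_of_col n \o h).
  by apply/funext => x /=; rewrite tuple_of_colK.
apply: measurableT_comp => //; apply/measurable_fun_tnthP => i.
apply: (eq_measurable_fun (fun x => h x i 0)); last exact: mh.
by move=> x _ /=; rewrite tnth_mktuple.
Qed.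

Lemma measurable_col_coord n (i : 'I_n) :
  measurable_fun setT (fun u : n.-tuple RM => col_of_tuple u i 0 : RM).
Proof.
apply: (eq_measurable_fun (fun u : n.-tuple RM => tnth u i)).
  by move=> x _ /=; rewrite mxE.
exact: measurable_tnth.
Qed.

Lemma col_measurable_affine n k (f : 'cV[R]_n -> \bar R) (A : 'M[R]_(n, k)) b :
  col_measurable f -> col_measurable (fun v => f (A *m v + b)).
Proof.
move=> mf.
apply: (@measurable_col_comp _ _ n f (fun u => A *m col_of_tuple u + b)) => // i.
apply: (eq_measurable_fun (fun u : k.-tuple RM =>
    \sum_j A i j * col_of_tuple u j 0 + b i 0)).
  by move=> x _; rewrite !mxE.
apply: measurable_funD => //; apply: measurable_sum => j.
by apply: measurable_funM => //; exact: measurable_col_coord.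
Qed.

Definition lebesgue_col n (f : 'cV[R]_n -> \bar R) : \bar R :=
  (\int[lebesgue_tuple R n]_u f (col_of_tuple u))%E.

Lemma col_of_tuple_cons n (x : RM) (u : n.-tuple RM) :
  col_of_tuple (tuple_cons (x, u)) = col_mx (x%:M : 'M[R]_1) (col_of_tuple u).
Proof.
apply/colP => i; rewrite !mxE; case: splitP => j.
  by rewrite ord1 => ij; rewrite (_ : i = ord0) ?mxE ?tnth0//; exact/val_inj.
move=> ij; have -> : i = lift ord0 j by exact/val_inj.
by rewrite tnthS mxE.
Qed.

Lemma col_measurable_cons n (f : 'cV[R]_(1 + n) -> \bar R) : col_measurable f ->
  measurable_fun setT
    (fun p : RM * n.-tuple RM => f (col_mx (p.1%:M : 'M[R]_1) (col_of_tuple p.2))).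
Proof.
move=> mf.
apply: (@measurable_col_comp _ _ (1 + n) f
  (fun p : RM * n.-tuple RM => col_mx (p.1%:M : 'M[R]_1) (col_of_tuple p.2))) => // i.
case: (splitP i) => j ij.
  apply: (eq_measurable_fun (fun p : RM * n.-tuple RM => p.1)); last first.
    exact: measurable_fst.
  have -> : i = lshift n j by exact/val_inj.
  by move=> p _; rewrite col_mxEu ord1 mxE.
have -> : i = rshift 1 j by exact/val_inj.
apply: (eq_measurable_fun (fun p : RM * n.-tuple RM => tnth p.2 j)).
  by move=> p _; rewrite col_mxEd mxE.
apply: (measurableT_comp (measurable_tnth _)); exact: measurable_snd.
Qed.

Lemma lebesgue_col_cons n (f : 'cV[R]_(1 + n) -> \bar R) :
  col_measurable f -> (forall v, 0 <= f v)%E ->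
  lebesgue_col f = (\int[mu]_x lebesgue_col (fun v => f (col_mx x%:M v)))%E.
Proof.
move=> mf f0; have mf' := col_measurable_cons mf.
rewrite [LHS](@ge0_integral_pushforward _ _ _ _ R _ (@measurable_tuple_cons _ RM n)
  (mu \x lebesgue_tuple R n)%E setT (f \o @col_of_tuple n.+1))//; last first.
  by move=> y _; exact: f0.
transitivity (\int[mu \x lebesgue_tuple R n]_p
    f (col_mx (p.1%:M : 'M[R]_1) (col_of_tuple p.2)))%E.
  by apply: eq_integral => -[x u] _ /=; rewrite col_of_tuple_cons.
by rewrite fubini_tonelli1.
Qed.

Lemma lebesgue_col_consC n (f : 'cV[R]_(1 + n) -> \bar R) :
  col_measurable f -> (forall v, 0 <= f v)%E ->
  lebesgue_col f = lebesgue_col (fun v => \int[mu]_x f (col_mx x%:M v))%E.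
Proof.
move=> mf f0; have mf' := col_measurable_cons mf.
rewrite lebesgue_col_cons// /lebesgue_col.
exact: (@fubini_tonelli _ _ _ _ _ _ _ (fun p : RM * n.-tuple RM =>
  f (col_mx (p.1%:M : 'M[R]_1) (col_of_tuple p.2)))).
Qed.

Lemma col_measurable_consl n (f : 'cV[R]_(1 + n) -> \bar R) (x : R) :
  col_measurable f -> col_measurable (fun v => f (col_mx x%:M v)).
Proof.
by move=> mf; apply: (measurable_comp _ _ (col_measurable_cons mf)
  (@measurable_pair1 _ _ _ _ x)) => //.
Qed.

Lemma col_measurable_consr n (f : 'cV[R]_(1 + n) -> \bar R) (v : 'cV[R]_n) :
  col_measurable f -> measurable_fun setT (fun x : RM => f (col_mx x%:M v)).
Proof.
move=> mf; rewrite -(tuple_of_colK v).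
by apply: (measurable_comp _ _ (col_measurable_cons mf)
  (@measurable_pair2 _ _ _ _ (tuple_of_col v))) => //.
Qed.

Lemma measurable_lebesgue_col_cons n (f : 'cV[R]_(1 + n) -> \bar R) :
  col_measurable f -> (forall v, 0 <= f v)%E ->
  measurable_fun setT (fun x : RM => lebesgue_col (fun v => f (col_mx x%:M v))).
Proof.
move=> mf f0; exact: (measurable_fun_fubini_tonelli_F (fun p : RM * n.-tuple RM =>
  f (col_mx (p.1%:M : 'M[R]_1) (col_of_tuple p.2))) (col_measurable_cons mf)).
Qed.

Lemma col_measurable_integral n (f : 'cV[R]_(1 + n) -> \bar R) :
  col_measurable f -> (forall v, 0 <= f v)%E ->
  col_measurable (fun v => \int[mu]_x f (col_mx x%:M v))%E.
Proof.
move=> mf f0; exact: (measurable_fun_fubini_tonelli_G (fun p : RM * n.-tuple RM =>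
  f (col_mx (p.1%:M : 'M[R]_1) (col_of_tuple p.2))) (col_measurable_cons mf)).
Qed.

Lemma lebesgue_col_ge0 n (f : 'cV[R]_n -> \bar R) : (forall v, 0 <= f v)%E ->
  (0 <= lebesgue_col f)%E.
Proof. by move=> f0; apply: integral_ge0 => u _; exact: f0. Qed.

Lemma eq_lebesgue_col n (f g : 'cV[R]_n -> \bar R) : f =1 g ->
  lebesgue_col f = lebesgue_col g.
Proof. by move=> fg; apply: eq_integral => u _; exact: fg. Qed.

Lemma lebesgue_colZl n (c : R) (f : 'cV[R]_n -> \bar R) : 0 <= c ->
  col_measurable f -> (forall v, 0 <= f v)%E ->
  lebesgue_col (fun v => c%:E * f v)%E = (c%:E * lebesgue_col f)%E.
Proof. by move=> c0 mf f0; rewrite /lebesgue_col ge0_integralZl. Qed.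

Lemma lebesgue_colD n (f g : 'cV[R]_n -> \bar R) :
  col_measurable f -> (forall v, 0 <= f v)%E ->
  col_measurable g -> (forall v, 0 <= g v)%E ->
  lebesgue_col (fun v => f v + g v)%E = (lebesgue_col f + lebesgue_col g)%E.
Proof. by move=> mf f0 mg g0; rewrite /lebesgue_col ge0_integralD. Qed.

Lemma le_lebesgue_col n (f g : 'cV[R]_n -> \bar R) :
  col_measurable f -> (forall v, 0 <= f v)%E -> col_measurable g ->
  (forall v, f v <= g v)%E -> (lebesgue_col f <= lebesgue_col g)%E.
Proof. by move=> mf f0 mg fg; apply: ge0_le_integral. Qed.

Lemma lebesgue_col0 (f : 'cV[R]_0 -> \bar R) : lebesgue_col f = f 0.
Proof.
rewrite /lebesgue_col; have -> : (fun u => f (col_of_tuple u)) = cst (f 0).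
  by apply/funext => u /=; congr f; apply/colP => -[].
rewrite integral_cst//= diracT mule1//.
Qed.

End lebesgue_tuple.

Section change_of_variables.
Context {R : realType}.
Notation mu := (@lebesgue_measure R).
Notation RM := (measurableTypeR R).
Implicit Types n k : nat.

Definition lebesgue_scaling n (A : 'M[R]_n) : Prop :=
  forall f : 'cV[R]_n -> \bar R, col_measurable f -> (forall v, 0 <= f v)%E ->
  (`|\det A|%:E * lebesgue_col (fun v => f (A *m v)%R))%E = lebesgue_col f.

Lemma col_measurable_mul n k (f : 'cV[R]_n -> \bar R) (A : 'M[R]_(n, k)) :
  col_measurable f -> col_measurable (fun v => f (A *m v)).
Proof.
move=> /(@col_measurable_affine _ _ _ _ A 0).
by under eq_fun do rewrite addr0.
Qed.

Lemma lebesgue_scalingM n (A B : 'M[R]_n) :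
  lebesgue_scaling A -> lebesgue_scaling B -> lebesgue_scaling (A *m B).
Proof.
move=> hA hB f mf f0.
rewrite det_mulmx normrM EFinM -muleA.
under eq_lebesgue_col do rewrite -mulmxA.
rewrite (hB (fun v => f (A *m v)))//; first exact: hA.
exact: col_measurable_mul.
Qed.

Lemma lebesgue_col_translate n (b : 'cV[R]_n) (f : 'cV[R]_n -> \bar R) :
  col_measurable f -> (forall v, 0 <= f v)%E ->
  lebesgue_col (fun v => f (v + b)) = lebesgue_col f.
Proof.
elim: n => [|n IH] in b f *; move=> mf f0.
  by apply: eq_lebesgue_col => v; congr f; apply/colP => -[].
have [b0 [b1 ->]] : exists b0 b1, b = col_mx (b0%:M : 'M[R]_1) (b1 : 'cV_n).
  exists ((usubmx (b : 'cV_(1 + n))) 0 0), (dsubmx (b : 'cV_(1 + n))).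
  by rewrite -mx11_scalar vsubmxK.
have mf' : col_measurable (fun v : 'cV[R]_n.+1 => f (v + col_mx (b0%:M : 'M[R]_1) b1)).
  have := @col_measurable_affine _ _ _ f 1%:M (col_mx (b0%:M : 'M[R]_1) b1) mf.
  by under eq_fun do rewrite mul1mx.
apply: (etrans (lebesgue_col_cons mf' (fun=> f0 _))).
apply: (etrans _ (esym (lebesgue_col_cons mf f0))).
transitivity (\int[mu]_x lebesgue_col (fun v => f (col_mx (x + b0)%R%:M v)))%E.
  apply: eq_integral => x _.
  rewrite -[RHS](IH b1)//; last exact: col_measurable_consl.
  apply: eq_lebesgue_col => v; congr f.
  by apply: etrans (@add_col_mx _ 1 n _ _ _ _ _) _; rewrite raddfD.
have := integral_affine b0 (oner_neq0 R) (measurable_lebesgue_col_cons mf f0).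
rewrite normr1 mul1e => <-.
  by apply: eq_integral => x _; rewrite mul1r.
by move=> x; exact: lebesgue_col_ge0.
Qed.

Lemma lebesgue_scaling_lblock n (a : R) (w : 'cV[R]_n) : a != 0 ->
  @lebesgue_scaling (1 + n) (block_mx a%:M 0 w 1%:M).
Proof.
move=> a0 f mf f0.
rewrite det_lblock det1 mulr1 det_scalar1.
have mf' := @col_measurable_mul _ _ f (block_mx a%:M 0 w 1%:M) mf.
rewrite (lebesgue_col_cons mf')// (lebesgue_col_cons mf)//.
rewrite -(integral_affine 0 a0 (measurable_lebesgue_col_cons mf f0)); last first.
  by move=> x; exact: lebesgue_col_ge0.
congr (_ * _)%E; apply: eq_integral => x _.
apply: (etrans _ (@lebesgue_col_translate _ (w *m x%:M) _
  (@col_measurable_consl _ _ f _ mf) (fun=> f0 _))).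
apply: eq_lebesgue_col => v.
by rewrite mul_block_col mul0mx mul1mx !addr0 -scalar_mxM addrC.
Qed.

Lemma lebesgue_scaling_ublock n (w : 'rV[R]_n) (B : 'M[R]_n) :
  lebesgue_scaling B -> @lebesgue_scaling (1 + n) (block_mx 1%:M w 0 B).
Proof.
move=> hB f mf f0.
rewrite det_ublock det1 mul1r.
have mf' := @col_measurable_mul _ _ f (block_mx 1%:M w 0 B) mf.
rewrite (lebesgue_col_consC mf')// (lebesgue_col_consC mf)//.
rewrite -[RHS]hB; last 2 first.
- exact: col_measurable_integral.
- by move=> v; exact: integral_ge0.
congr (_ * _)%E; apply: eq_lebesgue_col => v.
rewrite -(integral_affine ((w *m v) 0 0) (oner_neq0 R)
  (@col_measurable_consr _ _ f (B *m v) mf))//.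
rewrite normr1 mul1e; apply: eq_integral => x _.
by rewrite mul_block_col mul0mx mul1mx add0r mul1r raddfD/= -mx11_scalar.
Qed.

(* Block elimination on the first pivot; a zero pivot is first made nonzero by
   adding to the first row the combination of the others given by the first
   column itself. *)
Theorem lebesgue_scaling_unit n (A : 'M[R]_n) : A \in unitmx -> lebesgue_scaling A.
Proof.
elim: n A => [|n IH] A uA.
  move=> f mf f0; rewrite det_mx00 normr1 mul1e.
  by apply: eq_lebesgue_col => v; congr f; apply/colP => -[].
have pivot (M : 'M[R]_(1 + n)) : M \in unitmx -> ulsubmx M 0 0 != 0 -> lebesgue_scaling M.
  rewrite -{1 3}(submxK M); set a := ulsubmx M; set w := ursubmx M.
  set v := dlsubmx M; set B := drsubmx M => uM a0.
  rewrite (_ : block_mx a w v B = block_mx (a 0 0)%:M 0 v 1%:M *m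
     block_mx 1%:M ((a 0 0)^-1 *: w) 0 (B - (a 0 0)^-1 *: (v *m w))) in uM *.
    apply: lebesgue_scalingM; first exact: lebesgue_scaling_lblock.
    apply/lebesgue_scaling_ublock/IH.
    move: uM; rewrite unitmx_mul => /andP[_].
    by rewrite !unitmxE det_ublock det1 mul1r.
  rewrite mulmx_block !mulmx1 !mul1mx !mulmx0 !mul0mx !addr0.
  rewrite mul_scalar_mx scalerA divff// scale1r -mx11_scalar.
  by rewrite -scalemxAr addrC subrK.
have [|A00] := boolP (ulsubmx (A : 'M[R]_(1 + n)) 0 0 == 0); last exact: pivot.
set v := dlsubmx (A : 'M[R]_(1 + n)) => A00.
pose E (s : R) : 'M[R]_(1 + n) := block_mx 1%:M (s *: v^T) 0 1%:M.
have uE s : E s \in unitmx by rewrite unitmxE det_ublock !det1 mulr1 unitr1.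
have EE : E (-1) *m E 1 = 1%:M.
  rewrite /E (@mulmx_block _ 1 n 1 n 1 n) !mulmx1 !mul1mx !mulmx0 !mul0mx !addr0 !add0r.
  by rewrite scale1r scaleN1r subrr -scalar_mx_block.
have -> : A = E (-1) *m (E 1 *m A) by rewrite mulmxA EE mul1mx.
apply: lebesgue_scalingM.
  by apply: lebesgue_scaling_ublock; apply: IH; exact: unitmx1.
apply: pivot; first by rewrite unitmx_mul uE.
have dA : \det (A : 'M[R]_(1 + n)) != 0 by rewrite -unitfE -unitmxE.
apply: contra_neq dA => EA.
suff v0 : v = 0.
  rewrite -(submxK (A : 'M[R]_(1 + n))) -/v v0 det_ublock.
  by rewrite [ulsubmx _]mx11_scalar det_scalar1 (eqP A00) mul0r.
move: EA; rewrite -(submxK (A : 'M[R]_(1 + n))) -/v /E (@mulmx_block _ 1 n 1 n 1 n).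
rewrite block_mxKul mul1mx scale1r mxE (eqP A00) add0r mxE.
move=> /eqP; rewrite psumr_eq0 => [/allP h|i _]; last by rewrite mxE -expr2 sqr_ge0.
apply/colP => i; have := h i; rewrite mem_index_enum => /(_ isT).
by rewrite mxE mulf_eq0 orbb => /eqP ->; rewrite mxE.
Qed.

Lemma measurable_col_split k n (f : 'cV[R]_(k + n) -> \bar R) :
  col_measurable f -> measurable_fun setT
    (fun p : k.-tuple RM * n.-tuple RM => f (col_mx (col_of_tuple p.1) (col_of_tuple p.2))).
Proof.
apply: measurable_col_comp => i; case: (splitP i) => j ij.
  apply: (eq_measurable_fun (fun p : k.-tuple RM * n.-tuple RM => tnth p.1 j)).
    by move=> p _; rewrite (_ : i = lshift n j) ?col_mxEu ?mxE//; exact/val_inj.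
  apply: (measurableT_comp (measurable_tnth _)); exact: measurable_fst.
apply: (eq_measurable_fun (fun p : k.-tuple RM * n.-tuple RM => tnth p.2 j)).
  by move=> p _; rewrite (_ : i = rshift k j) ?col_mxEd ?mxE//; exact/val_inj.
apply: (measurableT_comp (measurable_tnth _)); exact: measurable_snd.
Qed.

Lemma lebesgue_col_split k n (f : 'cV[R]_(k + n) -> \bar R) :
  col_measurable f -> (forall v, 0 <= f v)%E ->
  lebesgue_col f = lebesgue_col (fun y => lebesgue_col (fun w => f (col_mx y w))).
Proof.
elim: k f => [|k IH] f mf f0.
  rewrite lebesgue_col0; apply: eq_lebesgue_col => v; congr f.
  apply/colP => i; rewrite -[LHS](@col_mxEd _ 0 n 1 0 v i 0).
  by congr (col_mx _ _ _ _); exact/val_inj.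
rewrite (@lebesgue_col_cons _ (k + n))//.
have colA (x : R) (y : 'cV[R]_k) (w : 'cV[R]_n) :
    col_mx x%:M (col_mx y w) = col_mx (col_mx (x%:M : 'M[R]_1) y) w
      :> 'cV[R]_(1 + k + n).
  by rewrite col_mxA castmx_id.
have mf1 : col_measurable (fun y => lebesgue_col (fun w : 'cV[R]_n =>
     f (col_mx (y : 'cV[R]_k.+1) w))).
  apply: (measurable_fun_fubini_tonelli_F (fun p : k.+1.-tuple RM * n.-tuple RM =>
    f (col_mx (col_of_tuple p.1) (col_of_tuple p.2)))) => //.
  exact: measurable_col_split.
rewrite [RHS](@lebesgue_col_cons _ k)//; last by move=> v; exact: lebesgue_col_ge0.
apply: eq_integral => x _.
apply: (etrans (IH _ (@col_measurable_consl _ (k + n) f x mf) (fun=> f0 _))).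
by apply: eq_lebesgue_col => y; apply: eq_lebesgue_col => w; rewrite colA.
Qed.
End change_of_variables.

(** * Gaussian means *)

Section gaussian.
Context {R : realType}.
Notation mu := (@lebesgue_measure R).
Notation RM := (measurableTypeR R).
Implicit Types n k : nat.

Definition sqnorm n (v : 'cV[R]_n) : R := \sum_i v i 0 ^+ 2.

Lemma sqnorm_ge0 n (v : 'cV[R]_n) : 0 <= sqnorm v.
Proof. by apply: sumr_ge0 => i _; exact: sqr_ge0. Qed.

Lemma sqnormE n (v : 'cV[R]_n) : sqnorm v = (v^T *m v) 0 0.
Proof. by rewrite mxE; apply: eq_bigr => i _; rewrite mxE. Qed.

Lemma sqnorm_col_mx k n (y : 'cV[R]_k) (w : 'cV[R]_n) :
  sqnorm (col_mx y w) = sqnorm y + sqnorm w.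
Proof.
rewrite /sqnorm big_split_ord /=.
by congr (_ + _); apply: eq_bigr => i _; rewrite ?col_mxEu ?col_mxEd.
Qed.

Definition gauss_density n (v : 'cV[R]_n) : R :=
  (2 * pi) `^ (- (n%:R / 2)) * expR (- sqnorm v / 2).

Lemma gauss_density_ge0 n (v : 'cV[R]_n) : 0 <= gauss_density v.
Proof. by rewrite mulr_ge0// ?powR_ge0// expR_ge0. Qed.

Lemma gauss_density_col_mx k n (y : 'cV[R]_k) (w : 'cV[R]_n) :
  gauss_density (col_mx y w) = gauss_density y * gauss_density w.
Proof.
rewrite /gauss_density sqnorm_col_mx mulrACA -expRD -powRD; last first.
  by apply/implyP => _; rewrite mulf_neq0// gt_eqF// pi_gt0.
by congr (_ `^ _ * expR _); [rewrite natrD; field|field].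
Qed.

Definition rcol_measurable n (f : 'cV[R]_n -> R) : Prop :=
  measurable_fun [set: n.-tuple RM] (f \o @col_of_tuple R n).

Lemma rcol_measurableP n (f : 'cV[R]_n -> R) :
  rcol_measurable f <-> col_measurable (fun v => (f v)%:E).
Proof. exact: (iff_sym (measurable_EFinP _ _)). Qed.

Lemma rcol_measurable_coord n (i : 'I_n) : rcol_measurable (fun v => v i 0).
Proof. exact: measurable_col_coord. Qed.

Lemma rcol_measurable_cst n (c : R) : @rcol_measurable n (fun=> c).
Proof. exact: measurable_cst. Qed.

Lemma rcol_measurableD n (f g : 'cV[R]_n -> R) :
  rcol_measurable f -> rcol_measurable g -> rcol_measurable (fun v => f v + g v).
Proof. by move=> mf mg; exact: measurable_funD. Qed.

Lemma rcol_measurableM n (f g : 'cV[R]_n -> R) :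
  rcol_measurable f -> rcol_measurable g -> rcol_measurable (fun v => f v * g v).
Proof. by move=> mf mg; exact: measurable_funM. Qed.

Lemma rcol_measurableX n (f : 'cV[R]_n -> R) k :
  rcol_measurable f -> rcol_measurable (fun v => f v ^+ k).
Proof. by move=> mf; exact: measurable_funX. Qed.

Lemma rcol_measurable_sum n (I : Type) (s : seq I) (f : I -> 'cV[R]_n -> R) :
  (forall i, rcol_measurable (f i)) -> rcol_measurable (fun v => \sum_(i <- s) f i v).
Proof. by move=> mf; apply: measurable_sum. Qed.

Lemma rcol_measurable_norm n (f : 'cV[R]_n -> R) :
  rcol_measurable f -> rcol_measurable (fun v => `|f v|).
Proof. by move=> mf; exact: measurableT_comp. Qed.

Lemma rcol_measurable_exp n (f : 'cV[R]_n -> R) :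
  rcol_measurable f -> rcol_measurable (fun v => expR (f v)).
Proof. by move=> mf; exact: measurableT_comp. Qed.

Lemma rcol_measurable_mul n k (f : 'cV[R]_n -> R) (A : 'M[R]_(n, k)) :
  rcol_measurable f -> rcol_measurable (fun v => f (A *m v)).
Proof.
by move=> /rcol_measurableP mf; apply/rcol_measurableP; exact: (col_measurable_mul A mf).
Qed.

Lemma rcol_measurable_dot n (f : 'cV[R]_n) :
  rcol_measurable (fun v => (f^T *m v) 0 0).
Proof. exact: (rcol_measurable_mul _ (rcol_measurable_coord 0)). Qed.

Lemma rcol_measurable_sqnorm n : rcol_measurable (@sqnorm n).
Proof.
by apply: rcol_measurable_sum => i; apply: rcol_measurableX; exact: rcol_measurable_coord.
Qed.

Lemma rcol_measurable_density n : rcol_measurable (@gauss_density n).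
Proof.
apply: rcol_measurableM; first exact: rcol_measurable_cst.
apply: rcol_measurable_exp; apply: rcol_measurableM; last exact: rcol_measurable_cst.
by apply: measurableT_comp => //; exact: rcol_measurable_sqnorm.
Qed.

Definition gauss_mean n (f : 'cV[R]_n -> R) : \bar R :=
  lebesgue_col (fun v => (f v * gauss_density v)%:E).

Let mint n (f : 'cV[R]_n -> R) : rcol_measurable f ->
  col_measurable (fun v => (f v * gauss_density v)%:E).
Proof.
move=> mf; apply/rcol_measurableP; apply: rcol_measurableM => //.
exact: rcol_measurable_density.
Qed.

Let int_ge0 n (f : 'cV[R]_n -> R) (f0 : forall v, 0 <= f v) v :
  (0 <= (f v * gauss_density v)%:E)%E.
Proof. by rewrite lee_fin mulr_ge0// gauss_density_ge0. Qed.

Lemma gauss_mean_ge0 n (f : 'cV[R]_n -> R) :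
  (forall v, 0 <= f v) -> (0 <= gauss_mean f)%E.
Proof. by move=> f0; apply: lebesgue_col_ge0; exact: int_ge0. Qed.

Lemma eq_gauss_mean n (f g : 'cV[R]_n -> R) : f =1 g -> gauss_mean f = gauss_mean g.
Proof. by move=> fg; apply: eq_lebesgue_col => v; rewrite fg. Qed.

Lemma gauss_meanZ n (c : R) (f : 'cV[R]_n -> R) : 0 <= c ->
  rcol_measurable f -> (forall v, 0 <= f v) ->
  gauss_mean (fun v => c * f v) = (c%:E * gauss_mean f)%E.
Proof.
move=> c0 mf f0; rewrite /gauss_mean -lebesgue_colZl//; last 2 first.
- exact: mint.
- exact: int_ge0.
by apply: eq_lebesgue_col => v; rewrite -EFinM -(mulrA c).
Qed.

Lemma gauss_meanD n (f g : 'cV[R]_n -> R) :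
  rcol_measurable f -> (forall v, 0 <= f v) ->
  rcol_measurable g -> (forall v, 0 <= g v) ->
  gauss_mean (fun v => f v + g v) = (gauss_mean f + gauss_mean g)%E.
Proof.
move=> mf f0 mg g0; rewrite /gauss_mean.
rewrite -(lebesgue_colD (mint mf) (int_ge0 f0) (mint mg) (int_ge0 g0)).
by apply: eq_lebesgue_col => v; rewrite mulrDl EFinD.
Qed.

Lemma gauss_mean_sum n (I : Type) (s : seq I) (f : I -> 'cV[R]_n -> R) :
  (forall i, rcol_measurable (f i)) -> (forall i v, 0 <= f i v) ->
  gauss_mean (fun v => \sum_(i <- s) f i v) = (\sum_(i <- s) gauss_mean (f i))%E.
Proof.
move=> mf f0; elim: s => [|i s IH].
  rewrite big_nil; under eq_gauss_mean do rewrite big_nil.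
  rewrite /gauss_mean; under eq_lebesgue_col do rewrite mul0r.
  by rewrite /lebesgue_col integral0.
rewrite big_cons -IH -gauss_meanD//.
- by apply: eq_gauss_mean => v; rewrite big_cons.
- exact: rcol_measurable_sum.
- by move=> v; exact: sumr_ge0.
Qed.

Lemma le_gauss_mean n (f g : 'cV[R]_n -> R) :
  rcol_measurable f -> (forall v, 0 <= f v) -> rcol_measurable g ->
  (forall v, f v <= g v) -> (gauss_mean f <= gauss_mean g)%E.
Proof.
move=> mf f0 mg fg; apply: (le_lebesgue_col (mint mf) (int_ge0 f0) (mint mg)) => v.
by rewrite lee_fin ler_wpM2r// gauss_density_ge0.
Qed.

Lemma gauss_mean_exp_sqr (s : R) : 0 < s ->
  gauss_mean (fun v : 'cV[R]_1 => expR ((1 - s ^+ 2) / 2 * v 0 0 ^+ 2)) = (s^-1)%:E.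
Proof.
move=> s0; set f := (f in gauss_mean f).
have mf : rcol_measurable f.
  apply: rcol_measurable_exp; apply: rcol_measurableM; first exact: rcol_measurable_cst.
  by apply: rcol_measurableX; exact: rcol_measurable_coord.
rewrite /gauss_mean (@lebesgue_col_cons _ 0 _ (mint mf)); last first.
  by apply: int_ge0 => v; exact: expR_ge0.
pose c := s / Num.sqrt 2.
have s20 : (0 : R) < Num.sqrt 2 by rewrite sqrtr_gt0.
have c0 : c != 0 by rewrite gt_eqF// divr_gt0.
transitivity (\int[mu]_x (((2 * pi) `^ (- (1%:R / 2)))%:E * (gauss_fun (c * x + 0)%R)%:E))%E.
  apply: eq_integral => x _; rewrite lebesgue_col0 /f /gauss_density /gauss_fun.
  rewrite -EFinM mulrCA -expRD /sqnorm big_ord1.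
  have xE i j : col_mx (x%:M : 'M[R]_1) (0 : 'cV[R]_0) i j = x.
    rewrite mxE; case: splitP => [l|[]//] _; rewrite mxE.
    by rewrite (ord1 l) (ord1 j) eqxx.
  rewrite !xE.
  rewrite addr0 /c !exprMn exprVn sqr_sqrtr//.
  by congr ((_ * expR _)%:E); field.
rewrite ge0_integralZl//; last 3 first.
- apply/measurable_EFinP; apply: measurableT_comp; first exact: measurable_gauss_fun.
  exact: measurable_affine.
- by move=> x _; rewrite lee_fin gauss_fun_ge0.
- by rewrite lee_fin powR_ge0.
have mg : measurable_fun setT (fun x : RM => (gauss_fun x)%:E).
  by apply/measurable_EFinP; exact: measurable_gauss_fun.
have := @integral_affine R c 0 _ c0 mg (fun x => gauss_fun_ge0 _).
rewrite integralT_gauss => h.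
have -> : (\int[mu]_x (gauss_fun (c * x + 0)%R)%:E)%E = (`|c|^-1 * Num.sqrt pi)%:E.
  by rewrite EFinM -h muleA -EFinM mulVf ?mul1e// normr_eq0.
rewrite -EFinM gtr0_norm ?divr_gt0//; congr EFin.
rewrite mulr1n powRN mul1r powR12_sqrt ?mulr_ge0 ?pi_ge0// sqrtrM//.
have ? : Num.sqrt pi != 0 :> R by rewrite gt_eqF// sqrtr_gt0 pi_gt0.
rewrite /c; field; apply/and3P; split => //; exact: lt0r_neq0.
Qed.

Lemma gauss_mean_split k n (f : 'cV[R]_(k + n) -> R) :
  rcol_measurable f -> (forall v, 0 <= f v) ->
  gauss_mean f = lebesgue_col (fun y => lebesgue_col (fun w =>
    (gauss_density y)%:E * (f (col_mx y w) * gauss_density w)%:E)%E).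
Proof.
move=> mf f0; apply: (etrans (lebesgue_col_split (mint mf) (int_ge0 f0))).
apply: eq_lebesgue_col => y; apply: eq_lebesgue_col => w.
by rewrite gauss_density_col_mx -EFinM mulrCA.
Qed.

Lemma gauss_mean1 n : gauss_mean (fun _ : 'cV[R]_n => 1) = 1%E.
Proof.
have E1 : gauss_mean (fun _ : 'cV[R]_1 => 1) = 1%E.
  have := gauss_mean_exp_sqr ltr01; rewrite invr1 => <-; apply: eq_gauss_mean => v.
  by rewrite expr1n subrr mul0r mul0r expR0.
elim: n => [|n IH].
  rewrite /gauss_mean lebesgue_col0 mul1r /gauss_density mul0r oppr0 powRr0 mul1r.
  by rewrite /sqnorm big_ord0 oppr0 mul0r expR0.
rewrite (@gauss_mean_split 1 n (fun=> 1))//; last exact: rcol_measurable_cst.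
rewrite -[RHS]E1; apply: eq_lebesgue_col => y.
rewrite lebesgue_colZl//; last 3 first.
- exact: gauss_density_ge0.
- exact: mint (@rcol_measurable_cst _ _).
- exact: (@int_ge0 _ (fun=> 1)).
by rewrite [X in (_ * X)%E](IH) mule1 mul1r.
Qed.

Lemma gauss_mean_cst n (c : R) : 0 <= c -> gauss_mean (fun _ : 'cV[R]_n => c) = c%:E.
Proof.
move=> c0; rewrite -[RHS]mule1 -(gauss_mean1 n) -gauss_meanZ//.
  by apply: eq_gauss_mean => v; rewrite mulr1.
exact: rcol_measurable_cst.
Qed.

Lemma rcol_measurable_usub k n (f : 'cV[R]_k -> R) : rcol_measurable f ->
  rcol_measurable (fun v : 'cV[R]_(k + n) => f (usubmx v)).
Proof.
move=> mf; have := rcol_measurable_mul (row_mx 1%:M 0 : 'M[R]_(k, k + n)) mf.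
by under eq_fun do rewrite -[v in row_mx _ _ *m v]vsubmxK mul_row_col mul1mx mul0mx addr0.
Qed.

Lemma rcol_measurable_dsub k n (f : 'cV[R]_n -> R) : rcol_measurable f ->
  rcol_measurable (fun v : 'cV[R]_(k + n) => f (dsubmx v)).
Proof.
move=> mf; have := rcol_measurable_mul (row_mx 0 1%:M : 'M[R]_(n, k + n)) mf.
by under eq_fun do rewrite -[v in row_mx _ _ *m v]vsubmxK mul_row_col mul1mx mul0mx add0r.
Qed.

Lemma gauss_mean_usub k n (f : 'cV[R]_k -> R) :
  rcol_measurable f -> (forall v, 0 <= f v) ->
  gauss_mean (fun v : 'cV[R]_(k + n) => f (usubmx v)) = gauss_mean f.
Proof.
move=> mf f0; rewrite gauss_mean_split//; last exact: rcol_measurable_usub.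
apply: eq_lebesgue_col => y.
under eq_lebesgue_col do rewrite col_mxKu -EFinM mulrCA.
transitivity (lebesgue_col (fun w : 'cV[R]_n =>
    (f y * gauss_density y)%:E * (1 * gauss_density w)%:E)%E).
  by apply: eq_lebesgue_col => w; rewrite -EFinM; congr EFin; ring.
rewrite lebesgue_colZl//.
- by rewrite [X in (_ * X)%E](gauss_mean1 n) mule1.
- by rewrite mulr_ge0// gauss_density_ge0.
- exact: mint (@rcol_measurable_cst _ _).
- exact: (@int_ge0 _ (fun=> 1)).
Qed.

Lemma gauss_mean_dsub k n (f : 'cV[R]_n -> R) :
  rcol_measurable f -> (forall v, 0 <= f v) ->
  gauss_mean (fun v : 'cV[R]_(k + n) => f (dsubmx v)) = gauss_mean f.
Proof.
move=> mf f0; rewrite gauss_mean_split//; last exact: rcol_measurable_dsub.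
transitivity (lebesgue_col (fun y : 'cV[R]_k =>
    gauss_mean f * (1 * gauss_density y)%:E)%E).
  apply: eq_lebesgue_col => y; rewrite lebesgue_colZl//; last 3 first.
  - exact: gauss_density_ge0.
  - by under eq_fun do rewrite col_mxKd; exact: mint.
  - by move=> w; rewrite lee_fin mulr_ge0// gauss_density_ge0.
  rewrite mul1r [RHS]muleC; congr (_ * _)%E.
  by apply: eq_lebesgue_col => w; rewrite col_mxKd.
rewrite /lebesgue_col ge0_integralZl//.
- by rewrite [X in (_ * X)%E](gauss_mean1 k) mule1.
- exact: (mint (@rcol_measurable_cst _ 1)).
- by move=> u _; exact: (@int_ge0 _ (fun=> 1)).
- exact: gauss_mean_ge0.
Qed.

Lemma gauss_mean_orthogonal n (O : 'M[R]_n) (f : 'cV[R]_n -> R) :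
  O^T *m O = 1%:M -> rcol_measurable f -> (forall v, 0 <= f v) ->
  gauss_mean (fun v => f (O *m v)) = gauss_mean f.
Proof.
move=> OO mf f0.
have dO : \det O ^+ 2 = 1 by rewrite expr2 -{1}(det_tr O) -det_mulmx OO det1.
have uO : O \in unitmx by case: (mulmx1_unit OO).
rewrite [RHS]/gauss_mean -(lebesgue_scaling_unit uO); last 2 first.
- exact: mint.
- exact: int_ge0.
have -> : `|\det O| = 1.
  by apply/eqP; rewrite -(@eqrXn2 _ 2)// real_normK ?num_real// dO expr1n.
rewrite mul1e; apply: eq_lebesgue_col => v; rewrite /gauss_density.
suff -> : sqnorm (O *m v) = sqnorm v by [].
by rewrite !sqnormE trmx_mul mulmxA -(mulmxA _ _ O) OO mulmx1.
Qed.

(* The symmetric matrix [[1 - F F^T, F], [F^T, 1 - F^T F]] is orthogonal, so the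
   law of [F w] can be read off a standard Gaussian vector of larger dimension. *)
Lemma gauss_mean_isometry k n (F : 'M[R]_(k, n)) (h : 'cV[R]_k -> R) :
  F *m F^T *m F = F -> rcol_measurable h -> (forall v, 0 <= h v) ->
  (forall y w, h ((1%:M - F *m F^T) *m y + F *m w) = h (F *m w)) ->
  gauss_mean (fun w => h (F *m w)) = gauss_mean h.
Proof.
move=> FFF mh h0 hF.
pose O : 'M[R]_(k + n) := block_mx (1%:M - F *m F^T) F F^T (1%:M - F^T *m F).
have FFF' : F^T *m F *m F^T = F^T by rewrite -[RHS](congr1 trmx FFF) !trmx_mul trmxK mulmxA.
have OO : O^T *m O = 1%:M.
  have tP : (1%:M - F *m F^T)^T = 1%:M - F *m F^T.
    by rewrite linearB /= trmx1 trmx_mul trmxK.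
  have tQ : (1%:M - F^T *m F)^T = 1%:M - F^T *m F.
    by rewrite linearB /= trmx1 trmx_mul trmxK.
  have PF : (1%:M - F *m F^T) *m F = 0 by rewrite mulmxBl mul1mx FFF subrr.
  have QF : (1%:M - F^T *m F) *m F^T = 0 by rewrite mulmxBl mul1mx FFF' subrr.
  have FQ : F *m (1%:M - F^T *m F) = 0 by rewrite mulmxBr mulmx1 mulmxA FFF subrr.
  have FP : F^T *m (1%:M - F *m F^T) = 0 by rewrite mulmxBr mulmx1 mulmxA FFF' subrr.
  rewrite /O tr_block_mx tP tQ trmxK mulmx_block PF QF FP FQ !addr0.
  rewrite mulmxBr mulmx1 (mulmxA _ F) PF mul0mx subr0 subrK.
  rewrite [_ *m (1%:M - _)]mulmxBr mulmx1 (mulmxA _ F^T) QF mul0mx subr0 addrC subrK.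
  by rewrite -scalar_mx_block.
transitivity (gauss_mean (fun v : 'cV[R]_(k + n) => h (F *m dsubmx v))).
  rewrite (@gauss_mean_dsub k n (fun w => h (F *m w)))//.
  exact: rcol_measurable_mul.
rewrite -(gauss_mean_usub n mh h0).
rewrite -[RHS](gauss_mean_orthogonal OO (@rcol_measurable_usub k n _ mh) (fun=> h0 _)).
apply: eq_gauss_mean => v.
by rewrite -[in RHS](vsubmxK v) mul_block_col col_mxKu hF.
Qed.

Lemma gauss_mean_unit n (f : 'cV[R]_n) (h : R -> R) : sqnorm f = 1 ->
  rcol_measurable (fun v : 'cV[R]_1 => h (v 0 0)) -> (forall x, 0 <= h x) ->
  gauss_mean (fun w => h ((f^T *m w) 0 0)) = gauss_mean (fun v : 'cV[R]_1 => h (v 0 0)).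
Proof.
move=> f1 mh h0.
have ff : f^T *m f = 1%:M.
  by rewrite [LHS]mx11_scalar -sqnormE f1.
rewrite -(@gauss_mean_isometry 1 n f^T)// ?trmxK ?ff ?mul1mx//.
by move=> y w; rewrite subrr mul0mx add0r.
Qed.

Lemma gauss_mean_unit_exp_sqr n (f : 'cV[R]_n) (s : R) : 0 < s -> sqnorm f = 1 ->
  gauss_mean (fun w => expR ((1 - s ^+ 2) / 2 * (f^T *m w) 0 0 ^+ 2)) = (s^-1)%:E.
Proof.
move=> s0 f1; rewrite -gauss_mean_exp_sqr//.
apply: (gauss_mean_unit (h := fun x => expR ((1 - s ^+ 2) / 2 * x ^+ 2))) => //.
apply: rcol_measurable_exp; apply: rcol_measurableM; first exact: rcol_measurable_cst.
by apply: rcol_measurableX; exact: rcol_measurable_coord.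
Qed.

(* The exponential moments [E exp ((1 - s^2) x^2 / 2) = 1 / s] and
   [exp y >= 1 + y] pin down the second moment as [s -> 1] from either side. *)
Lemma gauss_mean_sqr1 : gauss_mean (fun v : 'cV[R]_1 => v 0 0 ^+ 2) = 1%E.
Proof.
set f := (f in gauss_mean f).
have mf : rcol_measurable f.
  by apply: rcol_measurableX; exact: rcol_measurable_coord.
have f0 v : 0 <= f v by exact: sqr_ge0.
have m1 c : rcol_measurable (fun _ : 'cV[R]_1 => c) by exact: rcol_measurable_cst.
have mcf c : rcol_measurable (fun v => c * f v) by exact: rcol_measurableM.
have me c : rcol_measurable (fun v => expR (c * f v)) by exact: rcol_measurable_exp.
have up (s : R) : 0 < s < 1 -> (1 + ((1 - s ^+ 2) / 2)%:E * gauss_mean f <= (s^-1)%:E)%E.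
  move=> /andP[s0 s1]; rewrite -gauss_mean_exp_sqr// -(gauss_mean1 1).
  have c0 : 0 <= (1 - s ^+ 2) / 2 by rewrite divr_ge0// subr_ge0 exprn_ile1 ?ltW.
  rewrite -gauss_meanZ// -gauss_meanD//; last by move=> v; rewrite mulr_ge0.
  apply: le_gauss_mean => //; first exact: rcol_measurableD.
  - by move=> v; rewrite addr_ge0// mulr_ge0.
  - by move=> v; exact: expR_ge1Dx.
have dn (s : R) : 1 < s -> (1 <= (s^-1)%:E + ((s ^+ 2 - 1) / 2)%:E * gauss_mean f)%E.
  move=> s1; have s0 : 0 < s by exact: lt_trans s1.
  rewrite -gauss_mean_exp_sqr// -{1}(gauss_mean1 1).
  have c0 : 0 <= (s ^+ 2 - 1) / 2 by rewrite divr_ge0// subr_ge0 exprn_ege1 ?ltW.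
  rewrite -gauss_meanZ// -gauss_meanD//; last by move=> v; rewrite mulr_ge0.
  apply: le_gauss_mean => //; first exact: rcol_measurableD.
  move=> v; rewrite -lerBlDr; apply: le_trans (expR_ge1Dx _).
  by rewrite lerD2l -mulNr -mulNr opprB.
have : (0 <= gauss_mean f)%E by exact: gauss_mean_ge0.
case: (gauss_mean f) up dn => [m| |] up dn // m0; last first.
  have := up 2^-1; rewrite invr_gt0 invf_lt1// ltr0n ltr1n => /(_ isT).
  by rewrite gt0_muley// lte_fin; lra.
have {}up (s : R) : 0 < s < 1 -> m * (s * (1 + s)) <= 2.
  move=> s01; have := up _ s01; case/andP: s01 => s0 s1.
  rewrite -EFinM -EFinD lee_fin -(ler_pM2l s0) divff ?gt_eqF// => h.
  have : (1 - s) * (m * (s * (1 + s))) <= (1 - s) * 2 by nra.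
  by rewrite ler_pM2l// subr_gt0.
have {}dn (s : R) : 1 < s -> 2 <= m * (s * (1 + s)).
  move=> s1; have := dn _ s1; have s0 : 0 < s by exact: lt_trans s1.
  rewrite -EFinM -EFinD lee_fin -(ler_pM2l s0) mulrDr divff ?gt_eqF// => h.
  have : (s - 1) * 2 <= (s - 1) * (m * (s * (1 + s))) by nra.
  by rewrite ler_pM2l// subr_gt0.
rewrite lee_fin in m0; congr EFin; apply/eqP; rewrite eq_le; apply/andP; split.
- rewrite leNgt; apply/negP => m1'.
  have d0 : 0 < (m - 1) / (3 * m) by rewrite divr_gt0//; nra.
  have d1 : (m - 1) / (3 * m) < 1 by rewrite ltr_pdivrMr; nra.
  have dm : (m - 1) / (3 * m) * (3 * m) = m - 1 by rewrite divfK//; apply: lt0r_neq0; nra.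
  have := up (1 - (m - 1) / (3 * m)).
  move: d0 d1 dm; set d := (m - 1) / (3 * m) => d0 d1 dm.
  have -> : 0 < 1 - d < 1 by lra.
  move=> /(_ isT) h.
  have : m * d ^+ 2 >= 0 by rewrite mulr_ge0// sqr_ge0.
  nra.
- rewrite leNgt; apply/negP => m1'.
  have := dn (1 + (1 - m) / 4); have -> : 1 < 1 + (1 - m) / 4 by lra.
  by move=> /(_ isT); nra.
Qed.

Lemma gauss_mean_dot_sqr n (f : 'cV[R]_n) :
  gauss_mean (fun w => (f^T *m w) 0 0 ^+ 2) = (sqnorm f)%:E.
Proof.
have [f0|f0] := eqVneq f 0.
  rewrite f0 /sqnorm big1 => [|i _]; last by rewrite mxE expr0n.
  rewrite -(gauss_mean_cst n (lexx 0)); apply: eq_gauss_mean => w.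
  by rewrite trmx0 mul0mx mxE expr0n.
have sf : 0 < sqnorm f.
  rewrite lt_neqAle sqnorm_ge0 andbT eq_sym; apply: contra_neq f0.
  move=> /eqP; rewrite psumr_eq0 => [/allP h|i _]; last exact: sqr_ge0.
  apply/colP => i; have := h i; rewrite mem_index_enum => /(_ isT).
  by rewrite sqrf_eq0 => /eqP ->; rewrite mxE.
pose g := (Num.sqrt (sqnorm f))^-1 *: f.
have gE w : (f^T *m w) 0 0 ^+ 2 = sqnorm f * (g^T *m w) 0 0 ^+ 2.
  have -> : (g^T *m w) 0 0 = (Num.sqrt (sqnorm f))^-1 * (f^T *m w) 0 0.
    by rewrite /g linearZ /= -scalemxAl [LHS]mxE.
  rewrite exprMn exprVn sqr_sqrtr ?ltW//.
  by rewrite mulrA divff ?mul1r// gt_eqF.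
have g1 : sqnorm g = 1.
  rewrite /sqnorm; under eq_bigr do rewrite mxE exprMn.
  by rewrite -mulr_sumr exprVn sqr_sqrtr ?ltW// mulVf// gt_eqF.
under eq_gauss_mean do rewrite gE.
rewrite gauss_meanZ ?sqnorm_ge0//.
- rewrite (@gauss_mean_unit n g (fun x => x ^+ 2) g1).
  + by rewrite gauss_mean_sqr1 mule1.
  + by apply: rcol_measurableX; exact: rcol_measurable_coord.
  + by move=> x; exact: sqr_ge0.
- by apply: rcol_measurableX; exact: rcol_measurable_dot.
- by move=> w; exact: sqr_ge0.
Qed.

End gaussian.

Section vartheta.
Context {R : realType}.
Notation RM := (measurableTypeR R).
Variable k : nat.
Implicit Types alpha : 'I_k -> R.

Definition diag_quad alpha (v : 'cV[R]_k) : R := \sum_i alpha i * v i 0 ^+ 2.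

Lemma rcol_measurable_diag_quad alpha : rcol_measurable (diag_quad alpha).
Proof.
apply: rcol_measurable_sum => i; apply: rcol_measurableM.
  exact: rcol_measurable_cst.
by apply: rcol_measurableX; exact: rcol_measurable_coord.
Qed.

Lemma gauss_mean_coord_sqr (i : 'I_k) :
  gauss_mean (fun v : 'cV[R]_k => v i 0 ^+ 2) = 1%E.
Proof.
have := gauss_mean_dot_sqr (delta_mx i 0 : 'cV[R]_k).
rewrite /sqnorm (bigD1 i)//= mxE !eqxx expr1n big1 ?addr0 => [<-|j ji].
  by apply: eq_gauss_mean => v; rewrite trmx_delta -rowE mxE.
by rewrite mxE (negbTE ji) expr0n.
Qed.

Lemma gauss_mean_abs_le alpha :
  (gauss_mean (fun v => `|diag_quad alpha v|%R) <= (\sum_i `|alpha i|)%R%:E)%E.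
Proof.
have mc i : rcol_measurable (fun v : 'cV[R]_k => `|alpha i| * v i 0 ^+ 2).
  apply: rcol_measurableM; first exact: rcol_measurable_cst.
  by apply: rcol_measurableX; exact: rcol_measurable_coord.
apply: (@le_trans _ _ (gauss_mean (fun v : 'cV[R]_k => \sum_i `|alpha i| * v i 0 ^+ 2)%R)).
  apply: le_gauss_mean => //.
  - by apply: rcol_measurable_norm; exact: rcol_measurable_diag_quad.
  - exact: rcol_measurable_sum.
  - move=> v; apply: le_trans (ler_norm_sum _ _ _) _.
    by apply: ler_sum => i _; rewrite normrM (ger0_norm (sqr_ge0 _)).
rewrite gauss_mean_sum//; last by move=> i v; rewrite mulr_ge0// sqr_ge0.
rewrite -sumEFin le_eqVlt; apply/orP; left; apply/eqP; apply: eq_bigr => i _.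
rewrite gauss_meanZ//; first by rewrite gauss_mean_coord_sqr mule1.
  by apply: rcol_measurableX; exact: rcol_measurable_coord.
by move=> v; exact: sqr_ge0.
Qed.

Lemma gauss_mean_absE alpha :
  gauss_mean (fun v => `|diag_quad alpha v|%R) = (gauss_mean_abs alpha)%:E.
Proof.
set c := (2 * pi : R) `^ (- (k%:R / 2)).
have c0 : 0 < c by rewrite powR_gt0// mulr_gt0// pi_gt0.
have gfin : gauss_mean (fun v => `|diag_quad alpha v|%R) \is a fin_num.
  rewrite ge0_fin_numE; last by apply: gauss_mean_ge0 => v; exact: normr_ge0.
  by rewrite (le_lt_trans (gauss_mean_abs_le alpha))// ltry.
rewrite -(fineK gfin); congr EFin; rewrite /gauss_mean_abs -/c.
rewrite /Rintegral.
have -> : (\int[lebesgue_tuple R k]_u (`|\sum_i alpha i * tnth u i ^+ 2| *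
      expR (- (\sum_i tnth u i ^+ 2) / 2))%:E =
    (c^-1)%:E * gauss_mean (fun v => `|diag_quad alpha v|%R))%E.
  rewrite /gauss_mean -lebesgue_colZl; last 3 first.
  - by rewrite invr_ge0 ltW.
  - apply/rcol_measurableP; apply: rcol_measurableM; last exact: rcol_measurable_density.
    by apply: rcol_measurable_norm; exact: rcol_measurable_diag_quad.
  - by move=> v; rewrite lee_fin mulr_ge0// gauss_density_ge0.
  apply: eq_integral => u _; rewrite -EFinM /gauss_density -/c; congr EFin.
  have -> : diag_quad alpha (col_of_tuple u) = \sum_i alpha i * tnth u i ^+ 2.
    by apply: eq_bigr => i _; rewrite mxE.
  have -> : sqnorm (col_of_tuple u) = \sum_i tnth u i ^+ 2.
    by apply: eq_bigr => i _; rewrite mxE.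
  by field; exact: lt0r_neq0.
by rewrite fineM// mulrA divff ?mul1r// gt_eqF.
Qed.

(* Stretching the coordinate [i] by [sqrt 2] only decreases the density and
   changes the quadratic form by [alpha i * v_i^2]. *)
Lemma abs_coef_le_gauss_mean_abs alpha i : `|alpha i| <= 5 * gauss_mean_abs alpha.
Proof.
pose D : 'M[R]_k := diag_mx (\row_j if j == i then Num.sqrt 2 else 1).
have s2 : Num.sqrt 2 ^+ 2 = 2 :> R by rewrite sqr_sqrtr.
have s20 : 0 < Num.sqrt 2 :> R by rewrite sqrtr_gt0.
have dD : \det D = Num.sqrt 2.
  rewrite det_diag (bigD1 i)//= mxE eqxx big1 ?mulr1// => j ji.
  by rewrite mxE (negbTE ji).
have uD : D \in unitmx by rewrite unitmxE dD unitfE gt_eqF.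
have DE v j : (D *m v) j 0 ^+ 2 = v j 0 ^+ 2 + (if j == i then v i 0 ^+ 2 else 0).
  rewrite mul_diag_mx !mxE exprMn; case: eqP => [->|_].
    by rewrite s2 mulrDl mul1r.
  by rewrite expr1n mul1r addr0.
have sD v : sqnorm (D *m v) = sqnorm v + v i 0 ^+ 2.
  rewrite /sqnorm; under eq_bigr do rewrite DE.
  by rewrite big_split/= -big_mkcond big_pred1_eq.
have YD v : diag_quad alpha (D *m v) = diag_quad alpha v + alpha i * v i 0 ^+ 2.
  rewrite /diag_quad; under eq_bigr do rewrite DE mulrDr.
  rewrite big_split/=; congr (_ + _).
  rewrite (bigD1 i)//= eqxx big1 ?addr0// => j ji.
  by rewrite (negbTE ji) mulr0.
have dle v : gauss_density (D *m v) <= gauss_density v.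
  rewrite ler_wpM2l ?powR_ge0// ler_expR sD ler_pM2r// lerN2 lerDl.
  exact: sqr_ge0.
pose Y v := `|diag_quad alpha v|.
have Y0 v : 0 <= Y v by exact: normr_ge0.
have mY : rcol_measurable Y.
  by apply: rcol_measurable_norm; exact: rcol_measurable_diag_quad.
have mX : rcol_measurable (fun v : 'cV[R]_k => v i 0 ^+ 2).
  by apply: rcol_measurableX; exact: rcol_measurable_coord.
have md := @rcol_measurable_density R k.
have mYd : col_measurable (fun v => (Y v * gauss_density v)%:E).
  by apply/rcol_measurableP; exact: rcol_measurableM.
have mXd : col_measurable (fun v : 'cV[R]_k => (v i 0 ^+ 2 * gauss_density v)%:E).
  by apply/rcol_measurableP; exact: rcol_measurableM.
have Yd0 v : (0 <= (Y v * gauss_density v)%:E)%E.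
  by rewrite lee_fin mulr_ge0 ?Y0 ?gauss_density_ge0.
have Xd0 (v : 'cV[R]_k) : (0 <= (v i 0 ^+ 2 * gauss_density v)%:E)%E.
  by rewrite lee_fin mulr_ge0// ?sqr_ge0// gauss_density_ge0.
have := lebesgue_scaling_unit uD mYd Yd0; have := lebesgue_scaling_unit uD mXd Xd0.
rewrite dD gtr0_norm// [X in _ = X](gauss_mean_coord_sqr i).
rewrite [X in _ -> _ = X -> _](gauss_mean_absE alpha).
set LX := lebesgue_col _; set LY := lebesgue_col _ => eX eY.
have mDd : rcol_measurable (fun v => gauss_density (D *m v)) by exact: rcol_measurable_mul.
have LX2 : LX = (2%:E * lebesgue_col (fun v => (v i 0 ^+ 2 * gauss_density (D *m v))%:E))%E.
  rewrite -lebesgue_colZl//; last 2 first.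
  - by apply/rcol_measurableP; exact: rcol_measurableM.
  - by move=> v; rewrite lee_fin mulr_ge0// ?sqr_ge0// gauss_density_ge0.
  apply: eq_lebesgue_col => v; rewrite DE eqxx -EFinM; congr EFin.
  ring.
set LZ := lebesgue_col _ in LX2.
have ZY : (`|alpha i|%R%:E * LZ <= LY + (gauss_mean_abs alpha)%:E)%E.
  have mYD : col_measurable (fun v => (Y (D *m v) * gauss_density (D *m v))%:E).
    apply/rcol_measurableP; apply: rcol_measurableM => //.
    exact: rcol_measurable_mul.
  have YD0 v : (0 <= (Y (D *m v) * gauss_density (D *m v))%:E)%E by exact: Yd0.
  have mZ : rcol_measurable (fun v : 'cV[R]_k => v i 0 ^+ 2 * gauss_density (D *m v)).
    exact: rcol_measurableM.
  have mZ' := (rcol_measurableP _).1 mZ.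
  have Z0 (v : 'cV[R]_k) : (0 <= (v i 0 ^+ 2 * gauss_density (D *m v))%:E)%E.
    by rewrite lee_fin mulr_ge0// ?sqr_ge0// gauss_density_ge0.
  rewrite -gauss_mean_absE /gauss_mean /LZ -(lebesgue_colZl (normr_ge0 _) mZ' Z0).
  rewrite /LY -(lebesgue_colD mYD YD0 mYd Yd0).
  apply: le_lebesgue_col.
  - by apply/rcol_measurableP; apply: rcol_measurableM; first exact: rcol_measurable_cst.
  - by move=> v; rewrite mule_ge0// lee_fin.
  - by apply/rcol_measurableP; apply: rcol_measurableD; apply/rcol_measurableP.
  move=> v; rewrite -EFinM -EFinD lee_fin mulrA.
  apply: (@le_trans _ _ ((Y (D *m v) + Y v) * gauss_density (D *m v))).
    rewrite ler_wpM2r ?gauss_density_ge0// /Y YD.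
    have -> : `|alpha i| * v i 0 ^+ 2 = `|alpha i * v i 0 ^+ 2|.
      by rewrite normrM (ger0_norm (sqr_ge0 _)).
    have := ler_normB (alpha i * v i 0 ^+ 2 + diag_quad alpha v) (diag_quad alpha v).
    by rewrite addrK [alpha i * _ + _]addrC.
  by rewrite mulrDl lerD2l ler_wpM2l// normr_ge0.
move: eX eY ZY; rewrite LX2.
have : (0 <= LZ)%E.
  by apply: lebesgue_col_ge0 => v; rewrite lee_fin mulr_ge0// ?sqr_ge0// gauss_density_ge0.
have : (0 <= LY)%E.
  by apply: lebesgue_col_ge0 => v; exact: Yd0.
case: LZ {LX2} => [z| |]//; case: LY => [y| |]// y0 z0; last 3 first.
- by rewrite -EFinM => _; rewrite gt0_muley.
- by rewrite muleA -EFinM gt0_muley ?lte_fin ?mulr_gt0.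
- by rewrite muleA -EFinM gt0_muley ?lte_fin ?mulr_gt0.
rewrite !lee_fin in y0 z0; rewrite -!EFinM -EFinD lee_fin => -[ez] [ey].
have e0 : 0 <= gauss_mean_abs alpha by rewrite -ey mulr_ge0// ltW.
move: (gauss_mean_abs alpha) e0 ey => e e0 ey h.
have s15 : Num.sqrt 2 <= 3 / 2 :> R by nra.
have zE : z = Num.sqrt 2 / 4 by nra.
have yE : y = e * (Num.sqrt 2 / 2) by nra.
move: h; rewrite zE yE => h.
have h2 : `|alpha i| * 2 <= 4 * e + 4 * (e * Num.sqrt 2) by nra.
nra.
Qed.

End vartheta.

Section vartheta_bound.
Context {R : realType} (k : nat).
Hypothesis k0 : (0 < k)%N.
Implicit Types alpha : 'I_k -> R.

Let S : set R := [set gauss_mean_abs alpha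
  | alpha in [set alpha : 'I_k -> R | \sum_i `|alpha i| = 1]].

Lemma gauss_mean_abs_lb alpha : \sum_i `|alpha i| = 1 ->
  (5 * k%:R)^-1 <= gauss_mean_abs alpha.
Proof.
move=> a1; rewrite -[_^-1]mul1r ler_pdivrMr ?mulr_gt0 ?ltr0n//.
apply: (@le_trans _ _ (\sum_i `|alpha i|)); first by rewrite a1.
rewrite (_ : _ * _ = \sum_(i < k) (5 * gauss_mean_abs alpha)).
  by apply: ler_sum => i _; exact: abs_coef_le_gauss_mean_abs.
by rewrite sumr_const card_ord -[RHS]mulr_natr; ring.
Qed.

Lemma gauss_mean_absZ (c : R) alpha : 0 <= c ->
  gauss_mean_abs (fun i => c * alpha i) = c * gauss_mean_abs alpha.
Proof.
move=> c0; apply: EFin_inj; rewrite [RHS]EFinM -!gauss_mean_absE -gauss_meanZ//.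
  apply: eq_gauss_mean => v; rewrite -[in RHS](ger0_norm c0) -normrM /diag_quad mulr_sumr.
  by under [in RHS]eq_bigr do rewrite mulrA.
by apply: rcol_measurable_norm; exact: rcol_measurable_diag_quad.
Qed.

Lemma sum_abs_le_vartheta alpha :
  ((\sum_i `|alpha i|)%R%:E <=
   (vartheta R k)%:E * gauss_mean (fun v => `|diag_quad alpha v|%R))%E.
Proof.
rewrite gauss_mean_absE -[leRHS]EFinM lee_fin /vartheta gtn_eqF// -/S.
have S0 : S !=set0.
  exists (gauss_mean_abs (fun i : 'I_k => ((i == Ordinal k0)%:R : R))).
  exists (fun i : 'I_k => ((i == Ordinal k0)%:R : R)) => //=.
  rewrite (bigD1 (Ordinal k0))//= ?eqxx normr1 big1 ?addr0// => j /negbTE ->.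
  by rewrite normr0.
have Sl : lbound S (5 * k%:R)^-1 by move=> _ [a a1 <-]; exact: gauss_mean_abs_lb.
have i0 : 0 < inf S.
  apply: (@lt_le_trans _ _ (5 * k%:R)^-1); first by rewrite invr_gt0 mulr_gt0// ltr0n.
  exact: lb_le_inf.
have [->|s0] := eqVneq (\sum_i `|alpha i|) 0.
  rewrite mulr_ge0 ?invr_ge0 ?(ltW i0)// -lee_fin -gauss_mean_absE.
  by apply: gauss_mean_ge0 => v; exact: normr_ge0.
have {}s0 : 0 < \sum_i `|alpha i| by rewrite lt_neqAle eq_sym s0 sumr_ge0.
rewrite mulrC ler_pdivlMr//; set s := \sum_i _ in s0 *.
have : inf S <= gauss_mean_abs (fun i => s^-1 * alpha i).
  apply: ge_inf; first by exists (5 * k%:R)^-1.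
  exists (fun i => s^-1 * alpha i) => //=.
  under eq_bigr do rewrite normrM.
  by rewrite -mulr_sumr -/s ger0_norm ?invr_ge0 ?ltW// mulVf// gt_eqF.
rewrite gauss_mean_absZ; last by rewrite invr_ge0 ltW.
by rewrite ler_pdivlMl// mulrC.
Qed.

Lemma vartheta_ge0 : 0 <= vartheta R k.
Proof.
rewrite /vartheta gtn_eqF// invr_ge0; apply: lb_le_inf.
  exists (gauss_mean_abs (fun i : 'I_k => ((i == Ordinal k0)%:R : R))).
  exists (fun i : 'I_k => ((i == Ordinal k0)%:R : R)) => //=.
  rewrite (bigD1 (Ordinal k0))//= ?eqxx normr1 big1 ?addr0// => j /negbTE ->.
  by rewrite normr0.
by move=> _ [a a1 <-]; apply: le_trans (gauss_mean_abs_lb a1); rewrite invr_ge0 mulr_ge0.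
Qed.

End vartheta_bound.

(** * Quadratic forms and singular values *)

Section linear_algebra.
Context {R : realType}.
Implicit Types m n p q r : nat.

Lemma dotvE p (x y : 'cV[R]_p) : dotv x y = \sum_i x i 0 * y i 0.
Proof. by rewrite /dotv mxE; apply: eq_bigr => i _; rewrite mxE. Qed.

Lemma dotvC p (x y : 'cV[R]_p) : dotv x y = dotv y x.
Proof. by rewrite !dotvE; apply: eq_bigr => i _; rewrite mulrC. Qed.

Lemma dotvDl p (x y z : 'cV[R]_p) : dotv (x + y) z = dotv x z + dotv y z.
Proof. by rewrite /dotv linearD mulmxDl mxE. Qed.

Lemma dotvDr p (x y z : 'cV[R]_p) : dotv x (y + z) = dotv x y + dotv x z.
Proof. by rewrite /dotv mulmxDr mxE. Qed.

Lemma dotvZl p (c : R) (x y : 'cV[R]_p) : dotv (c *: x) y = c * dotv x y.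
Proof. by rewrite /dotv linearZ -scalemxAl mxE. Qed.

Lemma dotvZr p (c : R) (x y : 'cV[R]_p) : dotv x (c *: y) = c * dotv x y.
Proof. by rewrite /dotv -scalemxAr mxE. Qed.

Lemma dotvNl p (x y : 'cV[R]_p) : dotv (- x) y = - dotv x y.
Proof. by rewrite -scaleN1r dotvZl mulN1r. Qed.

Lemma dotvNr p (x y : 'cV[R]_p) : dotv x (- y) = - dotv x y.
Proof. by rewrite -scaleN1r dotvZr mulN1r. Qed.

Lemma dotv0l p (x : 'cV[R]_p) : dotv 0 x = 0.
Proof. by rewrite /dotv trmx0 mul0mx mxE. Qed.

Lemma dotv0r p (x : 'cV[R]_p) : dotv x 0 = 0.
Proof. by rewrite /dotv mulmx0 mxE. Qed.

Lemma dotv_sumr p I (s : seq I) (f : I -> 'cV[R]_p) y :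
  dotv y (\sum_(i <- s) f i) = \sum_(i <- s) dotv y (f i).
Proof.
by elim: s => [|i s IH]; rewrite ?big_nil ?dotv0r// !big_cons dotvDr IH.
Qed.

Lemma dotv_mulmxl p q (A : 'M[R]_(p, q)) x y : dotv (A *m x) y = dotv x (A^T *m y).
Proof. by rewrite /dotv trmx_mul mulmxA. Qed.

Lemma dotvv p (x : 'cV[R]_p) : dotv x x = sqnorm x.
Proof. by rewrite sqnormE. Qed.

Lemma sqnorm_eq0 p (x : 'cV[R]_p) : (sqnorm x == 0) = (x == 0).
Proof.
apply/idP/eqP => [|->]; last first.
  by rewrite -dotvv dotv0l.
rewrite psumr_eq0 => [/allP h|i _]; last exact: sqr_ge0.
apply/colP => i; have := h i; rewrite mem_index_enum => /(_ isT).
by rewrite sqrf_eq0 => /eqP ->; rewrite mxE.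
Qed.

Lemma sqnormZ p (c : R) (x : 'cV[R]_p) : sqnorm (c *: x) = c ^+ 2 * sqnorm x.
Proof. by rewrite -!dotvv dotvZl dotvZr mulrA. Qed.

Lemma quadE p (M : 'M[R]_p) x : quad M x = dotv x (M *m x).
Proof. by rewrite /quad /dotv mulmxA. Qed.

Lemma quadD p (M N : 'M[R]_p) x : quad (M + N) x = quad M x + quad N x.
Proof. by rewrite !quadE mulmxDl dotvDr. Qed.

Lemma quadN p (M : 'M[R]_p) x : quad (- M) x = - quad M x.
Proof. by rewrite !quadE mulNmx dotvNr. Qed.

Lemma quadZ p (c : R) (M : 'M[R]_p) x : quad (c *: M) x = c * quad M x.
Proof. by rewrite !quadE -scalemxAl dotvZr. Qed.

Lemma quad0 p x : quad (0 : 'M[R]_p) x = 0.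
Proof. by rewrite !quadE mul0mx dotv0r. Qed.

Lemma quad_sum p I (s : seq I) (f : I -> 'M[R]_p) x :
  quad (\sum_(i <- s) f i) x = \sum_(i <- s) quad (f i) x.
Proof. by elim: s => [|i s IH]; rewrite ?big_nil ?quad0// !big_cons quadD IH. Qed.

Lemma quad_scale p (M : 'M[R]_p) (c : R) x : quad M (c *: x) = c ^+ 2 * quad M x.
Proof. by rewrite !quadE -scalemxAr dotvZl dotvZr mulrA. Qed.

Lemma quad_at0 p (M : 'M[R]_p) : quad M 0 = 0.
Proof. by rewrite quadE dotv0l. Qed.

Lemma quad_conj p q (M : 'M[R]_p) (A : 'M[R]_(p, q)) x :
  quad (A^T *m M *m A) x = quad M (A *m x).
Proof. by rewrite !quadE -!mulmxA dotv_mulmxl. Qed.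

Lemma quad_gram p r (C : 'M[R]_(p, r)) x : quad (C *m C^T) x = sqnorm (C^T *m x).
Proof. by rewrite quadE -mulmxA -dotvv dotv_mulmxl trmxK. Qed.

Lemma quad_scalar p (c : R) (x : 'cV[R]_p) : quad c%:M x = c * sqnorm x.
Proof. by rewrite quadE mul_scalar_mx dotvZr dotvv. Qed.

Lemma quad_tr p (M : 'M[R]_p) x : quad M^T x = quad M x.
Proof. by rewrite !quadE dotvC dotv_mulmxl trmxK. Qed.

Lemma quadE_tr p (M : 'M[R]_p) x : quad M x = \tr (M *m (x *m x^T)).
Proof. by rewrite /quad -trace_mx11 -mulmxA mxtrace_mulC mulmxA. Qed.

Lemma psdmx_gram p r (C : 'M[R]_(p, r)) : psdmx (C *m C^T).
Proof.
by split=> [|x]; rewrite ?trmx_mul ?trmxK// quad_gram sqnorm_ge0.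
Qed.

Lemma psdmx0 p : psdmx (0 : 'M[R]_p).
Proof. by split=> [|x]; rewrite ?trmx0// quad0. Qed.

Lemma psdmxD p (M N : 'M[R]_p) : psdmx M -> psdmx N -> psdmx (M + N).
Proof.
by move=> [sM M0] [sN N0]; split=> [|x]; rewrite ?linearD/= ?sM ?sN// quadD addr_ge0.
Qed.

Lemma psdmxZ p (c : R) (M : 'M[R]_p) : 0 <= c -> psdmx M -> psdmx (c *: M).
Proof.
by move=> c0 [sM M0]; split=> [|x]; rewrite ?linearZ/= ?sM// quadZ mulr_ge0.
Qed.

Lemma psdmx_sum p (I : Type) (s : seq I) (M : I -> 'M[R]_p) :
  (forall i, psdmx (M i)) -> psdmx (\sum_(i <- s) M i).
Proof.
move=> h; elim: s => [|i s IH]; rewrite ?big_nil ?big_cons; first exact: psdmx0.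
exact: psdmxD.
Qed.

Lemma psdmx_conj p q (M : 'M[R]_p) (A : 'M[R]_(p, q)) :
  psdmx M -> psdmx (A^T *m M *m A).
Proof.
move=> [sM M0]; split=> [|x]; last by rewrite quad_conj.
by rewrite !trmx_mul trmxK sM mulmxA.
Qed.

Lemma psd_cauchy_schwarz p (W : 'M[R]_p) x y : psdmx W ->
  dotv y (W *m x) ^+ 2 <= quad W x * quad W y.
Proof.
move=> [sW W0].
have e (a b : R) : quad W (a *: x + b *: y) =
    a ^+ 2 * quad W x + 2 * (a * b) * dotv y (W *m x) + b ^+ 2 * quad W y.
  rewrite !quadE mulmxDr -!scalemxAr !dotvDl !dotvDr !dotvZl !dotvZr.
  have -> : dotv x (W *m y) = dotv y (W *m x) by rewrite dotvC dotv_mulmxl sW.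
  ring.
have := W0 (quad W y *: x + (- dotv y (W *m x)) *: y); rewrite e.
have := W0 (dotv y (W *m x) *: x + (- quad W x) *: y); rewrite e.
have := W0 x; have := W0 y.
have := W0 (1 *: x + 1 *: y); rewrite e; have := W0 (1 *: x + (-1) *: y); rewrite e.
move: (quad W x) (quad W y) (dotv y _) => a b c h1 h2 b0 a0 h3 h4.
clear e W0 sW.
have {}h3 : 0 <= a * (a * b - c ^+ 2) by nra.
have {}h4 : 0 <= b * (a * b - c ^+ 2) by nra.
rewrite leNgt; apply/negP => h.
have [a1|a1] := ltP 0 a; first nra.
have [b1|b1] := ltP 0 b; first nra.
have a00 : a = 0 by apply/eqP; rewrite eq_le a1.
have b00 : b = 0 by apply/eqP; rewrite eq_le b1.
have c0 : c = 0 by rewrite a00 b00 in h1 h2; lra.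
by rewrite a00 c0 expr0n mul0r ltxx in h.
Qed.

Lemma cauchy_schwarz p (x y : 'cV[R]_p) : dotv y x ^+ 2 <= sqnorm x * sqnorm y.
Proof.
have h1 : psdmx (1%:M : 'M[R]_p).
  by split=> [|z]; rewrite ?trmx1// quad_scalar mul1r sqnorm_ge0.
by have := psd_cauchy_schwarz x y h1; rewrite !quad_scalar !mul1r mul1mx.
Qed.

Lemma rank_kernel_lt m n (M M' : 'M[R]_(m, n)) (v : 'cV[R]_n) :
  (M' <= M)%MS -> M' *m v = 0 -> M *m v != 0 -> (\rank M' < \rank M)%N.
Proof.
move=> sM M'v Mv; apply: rank_ltmx; rewrite ltmxE sM /=.
by apply: contraNN Mv => /submxP[D ->]; rewrite -mulmxA M'v mulmx0.
Qed.

Lemma sym_quad0 p (W : 'M[R]_p) : W^T = W -> (forall x, quad W x = 0) -> W = 0.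
Proof.
move=> sW W0; apply/matrixP => i j; rewrite [RHS]mxE.
pose e k : 'cV[R]_p := delta_mx k 0.
have WE k l : dotv (e k) (W *m e l) = W k l.
  by rewrite /dotv /e trmx_delta -colE -rowE !mxE.
have := W0 (e i + e j); rewrite quadE mulmxDr !dotvDl !dotvDr -!quadE !W0 !WE.
by rewrite -{2}sW mxE; lra.
Qed.

Lemma psd_rank_factor r p (W : 'M[R]_p) : psdmx W -> (\rank W <= r)%N ->
  exists C : 'M[R]_(p, r), W = C *m C^T.
Proof.
elim: r W => [|r IH] W psW.
  rewrite leqn0 mxrank_eq0 => /eqP ->.
  by exists 0; rewrite mul0mx.
move=> rW; have [W0|] := pselect (forall x, quad W x = 0).
  by exists 0; rewrite mul0mx; apply: sym_quad0 => //; case: psW.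
move=> /existsNP[x /eqP Wx0]; have [sW W0] := psW.
set a := quad W x in Wx0.
have a0 : 0 < a by rewrite lt_neqAle eq_sym Wx0 W0.
have b0 : 0 < Num.sqrt a by rewrite sqrtr_gt0.
have b2 : Num.sqrt a ^+ 2 = a by rewrite sqr_sqrtr// ltW.
pose w := (Num.sqrt a)^-1 *: (W *m x).
have wT : w^T = (Num.sqrt a)^-1 *: (x^T *m W).
  by rewrite /w linearZ/= trmx_mul sW.
have W'x : (W - w *m w^T) *m x = 0.
  have wx : w^T *m x = ((Num.sqrt a)^-1 * a)%:M.
    by rewrite wT -scalemxAl [x^T *m W *m x]mx11_scalar scale_scalar_mx.
  rewrite mulmxBl -mulmxA wx mul_mx_scalar /w scalerA mulrAC -expr2 exprVn b2.
  by rewrite mulVf ?gt_eqF// scale1r subrr.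
have psW' : psdmx (W - w *m w^T).
  split=> [|y]; first by rewrite linearB/= trmx_mul trmxK sW.
  rewrite quadD quadN quad_gram /sqnorm big_ord1.
  have -> : (w^T *m y) 0 0 = (Num.sqrt a)^-1 * dotv y (W *m x).
    by rewrite dotvC -[LHS]/(dotv w y) dotvZl.
  rewrite exprMn exprVn b2 subr_ge0 ler_pdivrMl// /a.
  exact: psd_cauchy_schwarz.
have rW' : (\rank (W - w *m w^T)%R <= r)%N.
  rewrite -ltnS; apply: leq_trans _ rW; apply: (rank_kernel_lt (M := W) (v := x)) => //.
    rewrite wT -scalemxAr mulmxA -{1}(mul1mx W) scalemxAl -mulmxBl.
    exact: submxMl.
  by apply: contraNneq Wx0 => Wx; rewrite /a quadE Wx dotv0r.
have [C' eC'] := IH _ psW' rW'.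
exists (row_mx w C'); rewrite (@tr_row_mx _ p 1 r) (@mul_row_col _ p 1 r p).
by rewrite -eC' addrC subrK.
Qed.

Lemma psd_factor p (W : 'M[R]_p) : psdmx W -> exists C : 'M[R]_p, W = C *m C^T.
Proof. by move=> psW; apply: psd_rank_factor => //; exact: rank_leq_row. Qed.

Lemma pd_psd p (W : 'M[R]_p) : pdmx W -> psdmx W.
Proof.
move=> [sW W0]; split=> // x; have [->|/W0/ltW//] := eqVneq x 0.
by rewrite quad_at0.
Qed.

Lemma pd_factor p (W : 'M[R]_p) : pdmx W ->
  exists2 C : 'M[R]_p, C \in unitmx & W = C *m C^T.
Proof.
move=> pdW; have [C eC] := psd_factor (pd_psd pdW); exists C => //.
rewrite -row_free_unit -kermx_eq0.
apply/eqP/row_matrixP => i; rewrite row0; apply/eqP.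
set u := row i _; have uC : u *m C = 0 by rewrite -row_mul mulmx_ker row0.
move: pdW => [_ /(_ u^T)]; rewrite trmx_eq0 eC quad_gram -trmx_mul uC trmx0.
by case: eqVneq => // _ /(_ isT); rewrite -dotvv dotv0l ltxx.
Qed.

Lemma mxtrace_psd_ge0 p (W M : 'M[R]_p) : psdmx W -> psdmx M -> 0 <= \tr (W *m M).
Proof.
move=> /psd_factor[C ->] [_ M0].
rewrite -mulmxA mxtrace_mulC -mulmxA mulmxA; apply: sumr_ge0 => i _.
have := M0 (col i C); rewrite /quad tr_col -row_mul -row_mul.
by rewrite colE mulmxA -colE !mxE.
Qed.

Lemma sqnorm_mulmx_le p q (A : 'M[R]_(p, q)) x :
  sqnorm (A *m x) <= (\sum_i \sum_j A i j ^+ 2) * sqnorm x.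
Proof.
rewrite {1}/sqnorm mulr_suml; apply: ler_sum => i _.
have E : dotv (row i A)^T x = (A *m x) i 0 by rewrite /dotv trmxK -row_mul [LHS]mxE.
have S : sqnorm (row i A)^T = \sum_j A i j ^+ 2.
  by apply: eq_bigr => j _; rewrite !mxE.
by have := cauchy_schwarz x (row i A)^T; rewrite E S mulrC.
Qed.

Lemma pd_lower_bound p (W : 'M[R]_p) : pdmx W ->
  exists2 d : R, 0 < d & forall x, d * sqnorm x <= quad W x.
Proof.
move=> /pd_factor[C uC ->]; have uCT : C^T \in unitmx by rewrite unitmx_tr.
set c := \sum_i \sum_j (invmx C^T) i j ^+ 2.
have c0 : 0 <= c by apply: sumr_ge0 => i _; apply: sumr_ge0 => j _; exact: sqr_ge0.
exists (c + 1)^-1 => [|x]; first by rewrite invr_gt0 ltr_wpDl.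
rewrite ler_pdivrMl ?ltr_wpDl// quad_gram.
rewrite -{1}(mulKmx uCT x); apply: le_trans (sqnorm_mulmx_le _ _) _.
by rewrite ler_wpM2r ?sqnorm_ge0// lerDl.
Qed.

End linear_algebra.

Section singular_values.
Context {R : realType}.
Implicit Types m n p q r : nat.

Lemma continuous_sum (T : topologicalType) (I : Type) (s : seq I) (f : I -> T -> R) :
  (forall i, continuous (f i)) -> continuous (fun x => \sum_(i <- s) f i x).
Proof.
move=> cf; elim: s => [|i s IH] x.
  under eq_fun do rewrite big_nil; exact: cvg_cst.
under eq_fun do rewrite big_cons.
by apply: continuousD; [exact: cf|exact: IH].
Qed.

Lemma continuous_sqnorm_mul p q (M : 'M[R]_(p, q)) :
  continuous (fun y : 'rV[R]_q => sqnorm (M *m y^T)).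
Proof.
apply: continuous_sum => i.
have c : continuous (fun y : 'rV[R]_q => (M *m y^T) i 0).
  have -> : (fun y : 'rV[R]_q => (M *m y^T) i 0) = (fun y => \sum_j M i j * y 0 j).
    by apply/funext => y; rewrite mxE; apply: eq_bigr => j _; rewrite mxE.
  apply: continuous_sum => j y; apply: continuousM; first exact: cst_continuous.
  exact: coord_continuous.
by move=> y; exact: (continuousM (c y) (c y)).
Qed.

Lemma compact_sphere q : compact [set y : 'rV[R]_q | sqnorm y^T = 1].
Proof.
apply: bounded_closed_compact.
  exists 1; split; first exact: num_real.
  move=> e e1 y /= y1; apply: le_trans (ltW e1).
  rewrite [leLHS]mx_normrE; apply/bigmax_leP; split=> // -[i j] _ /=.
  rewrite -(@ler_pXn2r _ 2)// ?nnegrE// real_normK ?num_real// expr1n -y1.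
  rewrite /sqnorm (bigD1 j)//= !mxE (ord1 i) lerDl.
  by apply: sumr_ge0 => k _; exact: sqr_ge0.
rewrite (_ : mkset _ = (fun y : 'rV[R]_q => sqnorm (1%:M *m y^T)) @^-1` [set 1]).
  apply: closed_comp; last exact: closed_eq.
  by move=> y _; exact: continuous_sqnorm_mul.
by apply/seteqP; split => y /=; rewrite mul1mx.
Qed.

Lemma top_singular_pair p q (M : 'M[R]_(p, q)) : M != 0 ->
  exists s (u : 'cV[R]_p) (v : 'cV[R]_q),
  [/\ 0 < s, sqnorm u = 1, sqnorm v = 1, M *m v = s *: u & M^T *m u = s *: v].
Proof.
move=> M0.
have [i [j Mij]] : exists i j, M i j != 0.
  apply/not_existsP => h; move/eqP: M0; apply; apply/matrixP => i j; rewrite mxE.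
  by apply/eqP; have /forallNP/(_ j)/negP := h i; rewrite negbK.
have e1 : sqnorm (delta_mx j 0 : 'cV[R]_q) = 1.
  by rewrite -dotvv /dotv trmx_delta mul_delta_mx mxE !eqxx.
have sM0 : 0 < sqnorm (M *m delta_mx j 0).
  rewrite lt_neqAle sqnorm_ge0 andbT eq_sym sqnorm_eq0.
  by apply: contraNneq Mij => /matrixP/(_ i 0); rewrite -colE !mxE => ->.
have [||v] := @compact_EVT_max _ _ (fun y : 'rV[R]_q => sqnorm (M *m y^T)) _ _
  (@compact_sphere q).
- by exists (delta_mx 0 j); rewrite /= trmx_delta.
- by apply: continuous_subspaceT => y; exact: continuous_sqnorm_mul.
rewrite inE /= => v1 vmax.
set a := sqnorm (M *m v^T) in vmax.
have le_a z : sqnorm (M *m z) <= a * sqnorm z.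
  have [->|z0] := eqVneq z 0.
    by rewrite mulmx0 -!dotvv !dotv0l mulr0.
  have z0' : 0 < sqnorm z by rewrite lt_neqAle eq_sym sqnorm_eq0 z0 sqnorm_ge0.
  pose c := (Num.sqrt (sqnorm z))^-1.
  have c2 : c ^+ 2 = (sqnorm z)^-1 by rewrite exprVn sqr_sqrtr// ltW.
  have h1 : sqnorm (c *: z) = 1 by rewrite sqnormZ c2 mulVf// gt_eqF.
  have := vmax (c *: z)^T; rewrite inE /= trmxK h1 => /(_ erefl).
  by rewrite -scalemxAr sqnormZ c2 ler_pdivrMl// mulrC.
have a0 : 0 < a.
  by apply: lt_le_trans sM0 _; rewrite -[leRHS]mulr1 -e1; exact: le_a.
set s := Num.sqrt a; have s0 : 0 < s by rewrite sqrtr_gt0.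
have s2 : s ^+ 2 = a by rewrite sqr_sqrtr// ltW.
pose u := s^-1 *: (M *m v^T).
have Mv : M *m v^T = s *: u by rewrite /u scalerA divff ?scale1r// gt_eqF.
have u1 : sqnorm u = 1.
  by rewrite /u sqnormZ exprVn s2 mulVf// gt_eqF.
exists s, u, v^T; split=> //.
set w := M^T *m u.
have wv : dotv w v^T = s.
  by rewrite /w dotv_mulmxl trmxK Mv dotvZr dotvv u1 mulr1.
have ww : sqnorm w <= a.
  have h : sqnorm w ^+ 2 <= a * sqnorm w.
    rewrite -[in leLHS]dotvv {1}/w dotv_mulmxl trmxK.
    by apply: le_trans (cauchy_schwarz _ _) _; rewrite u1 mulr1; exact: le_a.
  have := sqnorm_ge0 w; nra.
apply/eqP; rewrite -subr_eq0 -sqnorm_eq0 eq_le sqnorm_ge0 andbT.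
rewrite -dotvv dotvDl !dotvDr !dotvNl !dotvNr !dotvZl !dotvZr !dotvv.
rewrite [dotv v^T w]dotvC wv v1; nra.
Qed.

Definition nz_indicator r (s : 'rV[R]_r) : 'rV[R]_r := map_mx (fun x => (x != 0)%:R) s.

(* Singular values may vanish, and then so do the corresponding columns of [U]
   and [V]; this allows any number [r >= rank M] of columns. *)
Definition is_svd p q r (M : 'M[R]_(p, q)) (s : 'rV[R]_r) (U : 'M[R]_(p, r))
    (V : 'M[R]_(q, r)) : Prop :=
  [/\ forall i, 0 <= s 0 i,
      M = U *m diag_mx s *m V^T,
      U^T *m U = diag_mx (nz_indicator s) /\ V^T *m V = diag_mx (nz_indicator s) &
      U *m diag_mx (nz_indicator s) = U /\ V *m diag_mx (nz_indicator s) = V].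

Lemma nz_indicator_mul r (s : 'rV[R]_r) :
  diag_mx (nz_indicator s) *m diag_mx s = diag_mx s.
Proof.
apply/matrixP => i j; rewrite mul_diag_mx !mxE.
by case: (eqVneq (s 0 i) 0) => [->|_]; rewrite /= ?mul0rn ?mul0r ?mul1r.
Qed.

Lemma svd_orth p q r (M : 'M[R]_(p, q)) (s : 'rV[R]_r) U V (u : 'cV[R]_p) :
  is_svd M s U V -> M^T *m u = 0 -> u^T *m U = 0.
Proof.
move=> [s0 eM [_ VV] [UD _]] Mu.
have h : u^T *m U *m diag_mx s = 0.
  have : u^T *m M *m V = 0 by rewrite -[u^T *m M]trmxK trmx_mul trmxK Mu trmx0 mul0mx.
  rewrite {1}eM -!mulmxA VV diag_mxC nz_indicator_mul !mulmxA//.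
rewrite -UD mulmxA; move: (u^T *m U) h => w h; apply/matrixP => i j.
have /matrixP/(_ i j) := h; rewrite !mul_mx_diag !mxE => /eqP.
by rewrite mulf_eq0 => /orP[/eqP ->|/eqP ->]; rewrite ?mul0r// eqxx mulr0.
Qed.

Lemma is_svd_tr p q r (M : 'M[R]_(p, q)) (s : 'rV[R]_r) U V :
  is_svd M s U V -> is_svd M^T s V U.
Proof.
move=> [s0 -> [UU VV] [UD VD]]; split=> //.
by rewrite !trmx_mul tr_diag_mx trmxK mulmxA.
Qed.

Theorem svd_exists r p q (M : 'M[R]_(p, q)) : (\rank M <= r)%N ->
  exists s U V, @is_svd p q r M s U V.
Proof.
have nz0 n : nz_indicator (0 : 'rV[R]_n) = 0.
  by apply/matrixP => i j; rewrite !mxE eqxx.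
have svd0 n : @is_svd p q n 0 0 0 0.
  split; first by move=> i; rewrite mxE.
  - by rewrite !mul0mx.
  - by rewrite !mulmx0 nz0 raddf0.
  - by rewrite !mul0mx.
elim: r M => [|r IH] M.
  by rewrite leqn0 mxrank_eq0 => /eqP ->; exists 0, 0, 0.
move=> rM; have [->|M0] := eqVneq M 0; first by exists 0, 0, 0.
have [s [u [v [s0 u1 v1 Mv Mu]]]] := top_singular_pair M0.
have uu : u^T *m u = 1%:M by rewrite [LHS]mx11_scalar -sqnormE u1.
have vv : v^T *m v = 1%:M by rewrite [LHS]mx11_scalar -sqnormE v1.
have uM : u^T *m M = s *: v^T.
  by rewrite -[u^T *m M]trmxK trmx_mul trmxK Mu linearZ.
pose M' := M - s *: (u *m v^T).
have M'v : M' *m v = 0.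
  by rewrite mulmxBl Mv -scalemxAl -mulmxA vv mulmx1 subrr.
have M'u : M'^T *m u = 0.
  by rewrite linearB/= linearZ/= trmx_mul trmxK mulmxBl Mu -scalemxAl -mulmxA uu mulmx1 subrr.
have rM' : (\rank M' <= r)%N.
  rewrite -ltnS; apply: leq_trans _ rM; apply: (rank_kernel_lt (M := M) (v := v)) => //.
    rewrite /M' scalemxAr -uM mulmxA -{1}(mul1mx M) -mulmxBl; exact: submxMl.
  rewrite Mv scaler_eq0 (gt_eqF s0)/= -sqnorm_eq0 u1; exact: oner_neq0.
have [s' [U [V svdM']]] := IH _ rM'.
have uU := svd_orth svdM' M'u.
have vV : v^T *m V = 0.
  by apply: (svd_orth (is_svd_tr svdM')); rewrite trmxK.
have Uu : U^T *m u = 0 by rewrite -[LHS]trmxK trmx_mul trmxK uU trmx0.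
have Vv : V^T *m v = 0 by rewrite -[LHS]trmxK trmx_mul trmxK vV trmx0.
have [s'0 eM [UU VV] [UD VD]] := svdM'.
have nzs : nz_indicator (row_mx (s%:M : 'M[R]_1) s') = row_mx 1%:M (nz_indicator s').
  rewrite /nz_indicator map_row_mx; congr row_mx; apply/matrixP => i j.
  by rewrite !ord1 !mxE eqxx !mulr1n gt_eqF.
have d1 (c : R) : diag_mx (c%:M : 'M[R]_1) = c%:M.
  by apply/matrixP => i j; rewrite !ord1 !mxE eqxx.
exists (row_mx (s%:M : 'M[R]_1) s' : 'rV[R]_(1 + r)), (row_mx u U : 'M[R]_(p, 1 + r)),
  (row_mx v V : 'M[R]_(q, 1 + r)).
have key : @is_svd p q (1 + r) M (row_mx s%:M s') (row_mx u U) (row_mx v V); last exact: key.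
split.
- move=> i; case: (splitP i) => k ik.
    have -> : i = lshift r k by exact/val_inj.
    by rewrite row_mxEl ord1 mxE ltW.
  have -> : i = rshift 1 k by exact/val_inj.
  by rewrite row_mxEr.
- rewrite diag_mx_row d1 tr_row_mx mul_row_block !mulmx0 addr0 add0r mul_row_col -eM.
  by rewrite mul_mx_scalar -scalemxAl addrC subrK.
- rewrite nzs diag_mx_row d1 !tr_row_mx !mul_col_row uu vv UU VV uU vV Uu Vv; split; reflexivity.
- by rewrite nzs diag_mx_row d1 !mul_row_block !mulmx0 !mulmx1 !addr0 !add0r UD VD.
Qed.

End singular_values.

(** * Convex duality *)

Section sublinear_functionals.
Context {R : realType}.

Definition sublinear (V : lmodType R) (p : V -> R) : Prop :=
  (forall x y, p (x + y) <= p x + p y) /\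
  (forall c x, 0 <= c -> p (c *: x) = c * p x).

Lemma sublinear0 (V : lmodType R) (p : V -> R) : sublinear p -> p 0 = 0.
Proof. by move=> [_ pZ]; rewrite -(scale0r 0) pZ// mul0r. Qed.

Lemma sublinearN (V : lmodType R) (p : V -> R) x : sublinear p -> - p x <= p (- x).
Proof.
move=> slp; have [pD _] := slp.
by have := pD x (- x); rewrite subrr sublinear0//; lra.
Qed.

Lemma sublinear_sum (V : lmodType R) (p : V -> R) I (s : seq I) (f : I -> V) :
  sublinear p -> p (\sum_(i <- s) f i) <= \sum_(i <- s) p (f i).
Proof.
move=> slp; elim: s => [|i s IH]; first by rewrite !big_nil sublinear0.
by rewrite !big_cons; apply: le_trans (slp.1 _ _) _; rewrite lerD2l.
Qed.

Lemma sublinear_inf (V : lmodType R) (Phi : V -> set R) :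
  (forall x, Phi x !=set0) ->
  (forall x y v w, Phi x v -> Phi y w -> Phi (x + y) (v + w)) ->
  (forall c x v, 0 <= c -> Phi x v -> Phi (c *: x) (c * v)) ->
  (forall v, Phi 0 v -> 0 <= v) ->
  sublinear (fun x => inf (Phi x)) /\ (forall x v, Phi x v -> inf (Phi x) <= v).
Proof.
move=> Phi_neq0 PhiD PhiZ Phi0.
have lb x : has_lbound (Phi x).
  have [w Phiw] := Phi_neq0 (- x); exists (- w) => v Phiv.
  by rewrite -subr_ge0 opprK; apply: Phi0; rewrite -(subrr x); exact: PhiD.
have inf_le x v : Phi x v -> inf (Phi x) <= v by move=> ?; exact: ge_inf.
have Phi00 : Phi 0 0.
  by have [v /(PhiZ 0 _ _ (lexx 0))] := Phi_neq0 0; rewrite scale0r mul0r.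
have infZ c x : 0 < c -> inf (Phi (c *: x)) <= c * inf (Phi x).
  move=> c0; rewrite -ler_pdivrMl//; apply: lb_le_inf => // v Phiv.
  by rewrite ler_pdivrMl//; apply: inf_le; apply: PhiZ => //; exact: ltW.
split=> //; split=> [x y|c x].
  rewrite -lerBlDr; apply: lb_le_inf => // v Phiv.
  rewrite lerBlDl -lerBlDr; apply: lb_le_inf => // w Phiw.
  by rewrite lerBlDl; apply: inf_le; exact: PhiD.
rewrite le_eqVlt => /orP[/eqP <-|c0].
  rewrite scale0r mul0r; apply/eqP; rewrite eq_le inf_le//=.
  exact: lb_le_inf.
apply/eqP; rewrite eq_le infZ//= -ler_pdivlMl//.
by rewrite -{1}(scalerK (lt0r_neq0 c0) x); apply: infZ; rewrite invr_gt0.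
Qed.

Lemma sublinear_shrink (V : lmodType R) (p : V -> R) (C : set V) (b : R) :
  sublinear p -> C !=set0 ->
  (forall x y t, C x -> C y -> 0 <= t <= 1 -> C (t *: x + (1 - t) *: y)) ->
  (forall x, C x -> b <= p x) ->
  exists q, [/\ sublinear q, forall x, q x <= p x & forall x, C x -> q (- x) <= - b].
Proof.
move=> slp [c0 Cc0] convC bp; have [pD pZ] := slp.
pose Phi x := [set v | exists s c, [/\ 0 <= s, C c & p (x + s *: c) - s * b <= v]].
have [||||slq qle] := @sublinear_inf V Phi.
- move=> x; exists (p (x + 0 *: c0) - 0 * b), 0, c0; split => //.
- move=> x y v w [s [c [s0 Cc h]]] [t [d [t0 Cd k]]].
  have [st0|st0] := eqVneq (s + t) 0.
    have s00 : s = 0 by apply/eqP; rewrite eq_le s0 andbT -st0 lerDl.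
    have t00 : t = 0 by rewrite s00 add0r in st0.
    move: h k; rewrite s00 t00 !scale0r !mul0r !subr0 !addr0 => h k.
    exists 0, c; rewrite scale0r addr0 mul0r subr0; split=> //.
    by apply: le_trans (pD _ _) _; exact: lerD.
  have st : 0 < s + t by rewrite lt_neqAle eq_sym st0 addr_ge0.
  exists (s + t), ((s / (s + t)) *: c + (1 - s / (s + t)) *: d); split.
  + exact: addr_ge0.
  + apply: convC => //; rewrite divr_ge0 ?addr_ge0//=.
    by rewrite ler_pdivrMr// mul1r lerDl.
  + have -> : x + y + (s + t) *: (s / (s + t) *: c + (1 - s / (s + t)) *: d)
        = (x + s *: c) + (y + t *: d).
      rewrite scalerDr !scalerA [_ * (s / _)]mulrC divfK// mulrBr mulr1.
      by rewrite [_ * (s / _)]mulrC divfK// [s + t]addrC addrK addrACA.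
    apply: le_trans (lerD h k); rewrite mulrDl opprD [leRHS]addrACA lerD2r.
    exact: pD.
- move=> a x v a0 [s [c [s0 Cc h]]]; exists (a * s), c; split => //.
    exact: mulr_ge0.
  by rewrite -scalerA -scalerDr pZ// -mulrA -mulrBr ler_wpM2l.
- move=> v [s [c [s0 Cc]]]; rewrite add0r pZ// -mulrBr; apply: le_trans.
  by rewrite mulr_ge0// subr_ge0 bp.
exists (fun x => inf (Phi x)); split=> // x.
  apply: qle; exists 0, c0; split=> //.
  by rewrite scale0r addr0 mul0r subr0.
move=> Cx; apply: qle; exists 1, x; split=> //.
by rewrite scale1r addNr (sublinear0 slp) mul1r add0r.
Qed.

Lemma sublinear_odd_on (V : lmodType R) (p : V -> R) (s : seq V) : sublinear p ->
  exists q, [/\ sublinear q, forall x, q x <= p x & forall x, x \in s -> q (- x) = - q x].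
Proof.
move=> slp; elim: s => [|x s [q [slq qp qs]]]; first by exists p.
have [|y z t /= -> -> _|y /= ->|q' [slq' q'q q'x]] :=
  @sublinear_shrink V q [set x] (q x) slq.
- by exists x.
- by rewrite -scalerDl addrC subrK scale1r.
- by [].
exists q'; split=> // [y|y]; first exact: le_trans (q'q y) (qp y).
rewrite inE => ys; apply/eqP; rewrite eq_le sublinearN// andbT.
have /orP[/eqP ->|/qs qy] := ys.
  by apply: le_trans (q'x x erefl) _; rewrite lerN2.
by apply: le_trans (q'q _) _; rewrite qy lerN2.
Qed.

(* Shrink [p] along [C] first, then along the matrix units, on which it becomes
   odd and hence linear. *)
Theorem mazur_orlicz N (p : 'M[R]_N -> R) (C : set 'M[R]_N) (b : R) :
  sublinear p -> C !=set0 ->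
  (forall x y t, C x -> C y -> 0 <= t <= 1 -> C (t *: x + (1 - t) *: y)) ->
  (forall x, C x -> b <= p x) ->
  exists W : 'M[R]_N, (forall Y, \tr (W^T *m Y) <= p Y) /\
    (forall Y, C Y -> b <= \tr (W^T *m Y)).
Proof.
move=> slp C0 convC bp.
have [q0 [slq0 q0p q0C]] := sublinear_shrink slp C0 convC bp.
have [q [slq qq0 qd]] :=
  sublinear_odd_on (codom (fun ij : 'I_N * 'I_N => delta_mx ij.1 ij.2 : 'M[R]_N)) slq0.
have {}qd i j : q (- delta_mx i j) = - q (delta_mx i j).
  exact: qd (codom_f (fun ij : 'I_N * 'I_N => delta_mx ij.1 ij.2 : 'M[R]_N) (i, j)).
have [qD qZ] := slq.
pose L (Y : 'M[R]_N) := \sum_i \sum_j Y i j * q (delta_mx i j).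
have qL Y : q Y <= L Y.
  rewrite {1}(matrix_sum_delta Y); apply: le_trans (sublinear_sum _ _ slq) _.
  apply: ler_sum => i _; apply: le_trans (sublinear_sum _ _ slq) _.
  apply: ler_sum => j _; have [h|h] := leP 0 (Y i j); first by rewrite qZ.
  rewrite -[Y i j]opprK scaleNr -scalerN qZ; last by rewrite oppr_ge0 ltW.
  by rewrite qd mulrNN opprK.
have LN Y : L (- Y) = - L Y.
  rewrite /L -sumrN; apply: eq_bigr => i _; rewrite -sumrN; apply: eq_bigr => j _.
  by rewrite mxE mulNr.
have Lq Y : L Y <= q Y.
  by rewrite -lerN2 -LN; apply: le_trans (qL _); rewrite sublinearN.
pose W : 'M[R]_N := \matrix_(i, j) q (delta_mx i j).
have WL Y : \tr (W^T *m Y) = L Y.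
  rewrite /mxtrace /L exchange_big/=; apply: eq_bigr => j _; rewrite mxE.
  by apply: eq_bigr => i _; rewrite !mxE mulrC.
exists W; split=> Y; rewrite WL.
  by apply: le_trans (Lq _) _; apply: le_trans (qq0 _) (q0p _).
move=> CY; rewrite -lerN2 -LN; apply: le_trans (Lq _) _.
exact: le_trans (qq0 _) (q0C _ CY).
Qed.

End sublinear_functionals.

Section basic_ellitopes.
Context {R : realType}.

Lemma convex_setP (V : lmodType R) (A : set (convex_lmodType V)) :
  convex_set A <->
  (forall (x y : V) (t : R), A x -> A y -> 0 <= t <= 1 -> A (t *: x + (1 - t) *: y)).
Proof.
split=> [cA x y t Ax Ay /andP[t0 t1]|cA x y t]; last first.
  rewrite !inE => Ax Ay; apply: cA => //; exact/andP.
by have := cA x y (@Itv01 R t t0 t1) (mem_set Ax) (mem_set Ay); rewrite inE.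
Qed.

Lemma continuous_dotv K (b : 'cV[R]_K) : continuous (fun t : 'cV[R]_K => dotv b t).
Proof.
have -> : (fun t : 'cV[R]_K => dotv b t) = (fun t => \sum_i b i 0 * t i 0).
  by apply/funext => t; rewrite dotvE.
apply: continuous_sum => i t; apply: continuousM; first exact: cst_continuous.
exact: coord_continuous.
Qed.

Lemma continuous_sqnorm K : continuous (@sqnorm R K).
Proof.
apply: continuous_sum => i t; have c := @coord_continuous R K 1 i 0 t.
exact: (continuousM c c).
Qed.

Lemma compact_convex_separation K (C : set 'cV[R]_K) (b : 'cV[R]_K) :
  C !=set0 -> compact C -> convex_set C -> ~ C b ->
  exists lam c, (forall t, C t -> dotv lam t <= c) /\ c < dotv lam b.
Proof.
move=> C0 compC /convex_setP convC Cb.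
have cf : continuous (fun t : 'cV[R]_K => sqnorm t - 2 * dotv b t).
  move=> t; apply: continuousB; first exact: continuous_sqnorm.
  by apply: continuousM; [exact: cst_continuous|exact: continuous_dotv].
have [u + umin] := compact_EVT_min C0 compC (continuous_subspaceT cf).
rewrite inE => Cu; pose l := b - u.
have l0 : 0 < sqnorm l.
  rewrite lt_neqAle sqnorm_ge0 andbT eq_sym sqnorm_eq0 subr_eq0.
  by apply/negP => /eqP bu; apply: Cb; rewrite bu.
have lE t : dotv l t = dotv b t - dotv u t by rewrite dotvDl dotvNl.
exists l, (dotv l u); split; last first.
  by rewrite -subr_gt0 -dotvNr -dotvDr dotvv.
move=> t Ct; rewrite -subr_le0 -dotvNr -dotvDr.
set d := t - u; set x := dotv l d; set n := sqnorm d.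
rewrite leNgt; apply/negP => x0.
have n0 : 0 <= n by exact: sqnorm_ge0.
have key a : 0 <= a <= 1 -> 2 * a * x <= a ^+ 2 * n.
  move=> a01; have := umin (a *: t + (1 - a) *: u).
  rewrite inE => /(_ (convC _ _ _ Ct Cu a01)).
  have -> : a *: t + (1 - a) *: u = u + a *: d.
    by rewrite /d scalerBr scalerBl scale1r addrC addrA addrAC.
  rewrite -!dotvv !dotvDl !dotvDr !dotvZl !dotvZr -/d dotvv.
  rewrite [dotv d u]dotvC [dotv d d]dotvv -/n /x lE.
  move: (sqnorm u) (dotv u d) (dotv b u) (dotv b d) => ? ? ? ?; nra.
have xn : 0 < x + n by rewrite ltr_pwDl.
have a01 : 0 <= x / (x + n) <= 1.
  by rewrite divr_ge0 ?(ltW x0) ?(ltW xn)//= ler_pdivrMr// mul1r lerDl.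
have := key _ a01.
have a0 : 0 < x / (x + n) by rewrite divr_gt0.
have an : x / (x + n) * (x + n) = x by rewrite divfK// gt_eqF.
move: (x / (x + n)) a0 an => a a0 an h.
have : 2 * x <= a * n by rewrite -(ler_pM2l a0); move: h; rewrite expr2; lra.
by nra.
Qed.

End basic_ellitopes.

Section basic_ellitope_theory.
Context {R : realType}.
Variables (p K : nat) (T : 'I_K -> 'M[R]_p) (calT : set 'cV[R]_K).
Hypothesis hT : basic_ellitope_data T calT.

Lemma basic_psd k : psdmx (T k). Proof. by case: hT. Qed.
Lemma basic_ge0 (t : 'cV[R]_K) k : calT t -> 0 <= t k 0.
Proof. by case: hT => _ _ _ [h _ _ _ _] /h. Qed.

Lemma basic_interior : exists2 t, calT t & forall k, 0 < t k 0.
Proof.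
case: hT => _ _ _ [ge0 _ _ [t ti] _].
have /nbhs_ballP[e /= e0 be] := ti.
exists (t + const_mx (e / 2)); last first.
  move=> k; rewrite !mxE; apply: ltr_wpDl; last by rewrite divr_gt0.
  by apply: ge0; apply: be; exact: ballxx.
apply: be; rewrite mx_norm_ball /ball_ /= opprD addrA subrr sub0r normrN.
apply: (@le_lt_trans _ _ (e / 2)); last by rewrite ltr_pdivrMr// mulr_natr mulr2n ltrDl.
rewrite [leLHS]mx_normrE; apply/bigmax_leP; split=> [|i _]; first by rewrite divr_ge0// ltW.
by rewrite !mxE ger0_norm// divr_ge0// ltW.
Qed.

Lemma basic0 : calT 0.
Proof.
have [t tT t0] := basic_interior; case: hT => _ _ _ [_ _ _ _ mono].
by apply: (mono 0 t) => // k; rewrite mxE lexx ltW.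
Qed.

Lemma basic_has_sup lam : has_sup [set dotv lam t | t in calT].
Proof.
apply: compact_has_sup; first by exists (dotv lam 0), 0 => //; exact: basic0.
apply: continuous_compact; last by case: hT => _ _ _ [].
by apply: continuous_subspaceT => t; exact: continuous_dotv.
Qed.

Lemma support_ub lam t : calT t -> dotv lam t <= support_fun calT lam.
Proof. by move=> Tt; apply: sup_ubound; [exact: (basic_has_sup lam).2|exists t]. Qed.

Lemma support_le lam c : (forall t, calT t -> dotv lam t <= c) ->
  support_fun calT lam <= c.
Proof.
move=> h; apply: ge_sup; first exact: (basic_has_sup lam).1.
by move=> _ [t Tt <-]; exact: h.
Qed.

Lemma support_ge0 lam : 0 <= support_fun calT lam.
Proof. by rewrite -(dotv0r lam); apply: support_ub; exact: basic0. Qed.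

Lemma support0 : support_fun calT 0 = 0.
Proof.
apply/eqP; rewrite eq_le support_ge0 andbT; apply: support_le => t _.
by rewrite dotv0l.
Qed.

Lemma supportD lam lam' :
  support_fun calT (lam + lam') <= support_fun calT lam + support_fun calT lam'.
Proof.
by apply: support_le => t Tt; rewrite dotvDl lerD// support_ub.
Qed.

Lemma supportZ c lam : 0 <= c ->
  support_fun calT (c *: lam) <= c * support_fun calT lam.
Proof.
by move=> c0; apply: support_le => t Tt; rewrite dotvZl ler_wpM2l// support_ub.
Qed.

(* By monotonicity, a functional separating [b] from [calT] may be replaced by
   its positive part. *)
Lemma basic_dual_mem (b : 'cV[R]_K) : (forall k, 0 <= b k 0) ->
  (forall lam : 'cV[R]_K, (forall k, 0 <= lam k 0) -> dotv lam b <= support_fun calT lam) ->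
  calT b.
Proof.
move=> b0 hb; apply: contrapT => nb; case: hT => _ _ _ [_ convT compT _ mono].
have [lam [c [lamc cb]]] := compact_convex_separation (ex_intro _ _ basic0) compT convT nb.
pose lp : 'cV[R]_K := \col_k Num.max (lam k 0) 0.
have := hb lp; rewrite leNgt => /(_ _)/negP; apply.
  by move=> k; rewrite mxE le_max lexx orbT.
apply: (@le_lt_trans _ _ c).
  apply: support_le => t Tt.
  pose t' : 'cV[R]_K := \col_k if 0 <= lam k 0 then t k 0 else 0.
  have -> : dotv lp t = dotv lam t'.
    rewrite !dotvE; apply: eq_bigr => k _; rewrite !mxE.
    by case: leP => h; rewrite ?mul0r ?mulr0// leNgt h.
  apply: lamc; apply: (mono _ t) => // k; rewrite mxE.
  by case: ifP => _; rewrite lexx ?(basic_ge0 _ Tt).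
apply: lt_le_trans cb _; rewrite !dotvE; apply: ler_sum => k _.
by rewrite mxE ler_wpM2r// le_max lexx.
Qed.

Lemma ellitope0 : ellitope T calT 0.
Proof. by exists 0; [exact: basic0|move=> k; rewrite quad_at0 mxE]. Qed.

Lemma ellitopeN w : ellitope T calT w -> ellitope T calT (- w).
Proof.
by move=> [t Tt h]; exists t => // k; rewrite -scaleN1r quad_scale sqrrN expr1n mul1r.
Qed.

Lemma ellitope_gauge (t : 'cV[R]_K) (g : R) x : calT t -> 0 < g ->
  (forall k, quad (T k) x <= g * t k 0) -> ellitope T calT ((Num.sqrt g)^-1 *: x).
Proof.
move=> Tt g0 h; exists t => // k; rewrite quad_scale exprVn sqr_sqrtr ?(ltW g0)//.
by rewrite ler_pdivrMl.
Qed.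

Lemma ellitope_absorbing x : exists2 r, 0 < r & exists2 v, ellitope T calT v & x = r *: v.
Proof.
have [t Tt t0] := basic_interior.
pose g := 1 + \sum_k quad (T k) x / t k 0.
have q0 k : 0 <= quad (T k) x by case: (basic_psd k).
have s0 : 0 <= \sum_k quad (T k) x / t k 0.
  by apply: sumr_ge0 => k _; rewrite divr_ge0// ltW.
have g0 : 0 < g by rewrite ltr_pwDl.
have sg : 0 < Num.sqrt g by rewrite sqrtr_gt0.
exists (Num.sqrt g) => //; exists ((Num.sqrt g)^-1 *: x).
  apply: (ellitope_gauge Tt g0) => k; rewrite -ler_pdivrMr// /g (bigD1 k)//=.
  rewrite addrCA lerDl addr_ge0//; apply: sumr_ge0 => l _.
  by rewrite divr_ge0// ltW.
by rewrite scalerA divff ?scale1r// gt_eqF.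
Qed.

Lemma basic_quad_eq0 x : (forall k, quad (T k) x <= 0) -> x = 0.
Proof.
move=> h; apply/eqP; apply: contraT => x0.
case: hT => _ _ [_ /(_ x x0) h0] _; move: h0; rewrite quad_sum ltNge => /negP[].
exact: sumr_le0.
Qed.

Lemma basic_dominates (M : 'M[R]_p) : exists2 c, 0 <= c &
  forall x, quad M x <= quad (\sum_k c *: T k) x.
Proof.
case: hT => _ _ /pd_lower_bound[d d0 hd] _.
set F := \sum_i \sum_j M i j ^+ 2.
have F0 : 0 <= F by apply: sumr_ge0 => i _; apply: sumr_ge0 => j _; exact: sqr_ge0.
exists ((F + 1) / d); first by rewrite divr_ge0 ?addr_ge0// ltW.
move=> x; rewrite -scaler_sumr quadZ.
apply: (@le_trans _ _ ((F + 1) * sqnorm x)); last first.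
  by rewrite -mulrA ler_wpM2l ?addr_ge0// ler_pdivlMl.
rewrite quadE; have := cauchy_schwarz (M *m x) x; have := sqnorm_mulmx_le M x.
rewrite -/F; have := sqnorm_ge0 x; have := sqnorm_ge0 (M *m x).
move: (sqnorm (M *m x)) (sqnorm x) (dotv _ _) => a n e a0 n0 h1 h2.
have h3 : e ^+ 2 <= ((F + 1) * n) ^+ 2.
  apply: le_trans h2 _; apply: (@le_trans _ _ (F * n * n)); first by rewrite ler_wpM2r.
  have : 0 <= n ^+ 2 by exact: sqr_ge0.
  have : 0 <= F ^+ 2 * n ^+ 2 by rewrite mulr_ge0 ?sqr_ge0.
  have : 0 <= F * n ^+ 2 by rewrite mulr_ge0 ?sqr_ge0.
  rewrite !expr2; lra.
rewrite leNgt; apply/negP => h.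
have : 0 <= (F + 1) * n by rewrite mulr_ge0// addr_ge0.
nra.
Qed.

End basic_ellitope_theory.

Section half_blocks.
Context {R : realType}.
Variables (p q : nat).
Implicit Types (G : 'M[R]_q) (H : 'M[R]_p) (B : 'M[R]_(q, p)).

Lemma dotv_col_mx (z z' : 'cV[R]_q) (x x' : 'cV[R]_p) :
  dotv (col_mx z x) (col_mx z' x') = dotv z z' + dotv x x'.
Proof. by rewrite /dotv tr_col_mx mul_row_col mxE. Qed.

Lemma quad_half_block G B H z x :
  quad (half_block G B H) (col_mx z x) = quad G z + dotv z (B *m x) + quad H x.
Proof.
rewrite quadE mul_block_col dotv_col_mx !dotvDr -!scalemxAl !dotvZr.
rewrite [dotv x (B^T *m z)]dotvC dotv_mulmxl trmxK -!quadE; lra.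
Qed.

Lemma half_blockP G B H : psdmx (half_block G B H) <->
  [/\ G^T = G, H^T = H & forall z x, 0 <= quad G z + dotv z (B *m x) + quad H x].
Proof.
split=> [[s h]|[sG sH h]].
  move: s; rewrite tr_block_mx => /eq_block_mx[sG _ _ sH].
  by split=> // z x; rewrite -quad_half_block.
split=> [|x]; last by rewrite -(vsubmxK x) quad_half_block.
by rewrite tr_block_mx !linearZ/= trmxK sG sH.
Qed.

Lemma half_block_psdl G B H : psdmx (half_block G B H) -> psdmx G.
Proof.
move=> /half_blockP[sG _ h]; split=> // z; have := h z 0.
by rewrite mulmx0 dotv0r quad_at0 !addr0.
Qed.

Lemma half_block_psdr G B H : psdmx (half_block G B H) -> psdmx H.
Proof.
move=> /half_blockP[_ sH h]; split=> // x; have := h 0 x.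
by rewrite dotv0l quad_at0 !add0r.
Qed.

Lemma half_block_exists B : exists c : R, psdmx (half_block c%:M B c%:M).
Proof.
set F := \sum_i \sum_j B i j ^+ 2.
have F0 : 0 <= F by apply: sumr_ge0 => i _; apply: sumr_ge0 => j _; exact: sqr_ge0.
exists (F + 1); apply/half_blockP; split; rewrite ?tr_scalar_mx// => z x.
rewrite !quad_scalar; have := cauchy_schwarz (B *m x) z; have := sqnorm_mulmx_le B x.
rewrite -/F; have := sqnorm_ge0 x; have := sqnorm_ge0 z.
move: (sqnorm (B *m x)) (sqnorm x) (sqnorm z) (dotv _ _) => a n k e k0 n0 h1 h2.
have h3 : e ^+ 2 <= F * n * k by apply: le_trans h2 _; rewrite ler_wpM2r.
rewrite leNgt; apply/negP => h.
have Fk : 0 <= F * k by exact: mulr_ge0.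
have Fn : 0 <= F * n by exact: mulr_ge0.
have h4 : ((F + 1) * k + (F + 1) * n) ^+ 2 < e ^+ 2.
  rewrite -(sqrrN e) ltr_pXn2r ?nnegrE//; lra.
have h5 : F * n * k <= ((F + 1) * k + (F + 1) * n) ^+ 2.
  have : 0 <= F * n * k by rewrite mulr_ge0.
  have : 0 <= n * k by rewrite mulr_ge0.
  have : 0 <= F * F * n * k by rewrite !mulr_ge0.
  have : 0 <= ((F + 1) * k) ^+ 2 by exact: sqr_ge0.
  have : 0 <= ((F + 1) * n) ^+ 2 by exact: sqr_ge0.
  rewrite !expr2; lra.
lra.
Qed.

Lemma half_block_conv (t : R) G G' B B' H H' : 0 <= t <= 1 ->
  psdmx (half_block G B H) -> psdmx (half_block G' B' H') ->
  psdmx (half_block (t *: G + (1 - t) *: G') (t *: B + (1 - t) *: B')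
    (t *: H + (1 - t) *: H')).
Proof.
move=> /andP[t0 t1] psd1 psd2.
have -> : half_block (t *: G + (1 - t) *: G') (t *: B + (1 - t) *: B')
    (t *: H + (1 - t) *: H') =
    t *: half_block G B H + (1 - t) *: half_block G' B' H'.
  rewrite /half_block !scale_block_mx add_block_mx.
  by congr block_mx; apply/matrixP => i j; rewrite !mxE; ring.
by apply: psdmxD; apply: psdmxZ => //; rewrite subr_ge0.
Qed.

Lemma half_block_bound (e : R) G B H z x : `|e| <= 1 -> psdmx (half_block G B H) ->
  e * dotv z (B *m x) <= quad G z + quad H x.
Proof.
move=> e1 psd; have /half_blockP[_ _ h] := psd.
have [_ H0] := half_block_psdr psd.
have := h z (- e *: x); rewrite quad_scale -scalemxAr dotvZr sqrrN.
have : e ^+ 2 * quad H x <= quad H x.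
  rewrite -[leRHS]mul1r ler_wpM2r// -real_normK ?num_real//.
  by rewrite expr_le1.
lra.
Qed.

End half_blocks.

Section conic_duality.
Context {R : realType}.
Variables (p q K L S : nat).
Variables (T : 'I_K -> 'M[R]_p) (calT : set 'cV[R]_K).
Variables (Rm : 'I_L -> 'M[R]_q) (calR : set 'cV[R]_L).
Hypothesis hT : basic_ellitope_data T calT.
Hypothesis hR : basic_ellitope_data Rm calR.
Implicit Types (Bnom : 'M[R]_(q, p)) (B : 'I_S -> 'M[R]_(q, p)).

Lemma Opt_pair_le Bnom B lam ups G H Gbar Hbar :
  feasible_pt T Rm Bnom B lam ups G H Gbar Hbar ->
  Opt_pair T calT Rm calR Bnom B <= support_fun calT lam + support_fun calR ups.
Proof.
move=> fp; apply: ge_inf; last by exists lam, ups, G, H, Gbar, Hbar.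
exists 0 => _ [l [u [? [? [? [? [_ ->]]]]]]].
by rewrite addr_ge0 ?(support_ge0 hT) ?(support_ge0 hR).
Qed.

Definition block_feasible Bnom B (Y : 'M[R]_(q + p)) : Prop :=
  exists G H Gbar Hbar, [/\ forall s, psdmx (half_block (G s) (B s) (H s)),
    psdmx (half_block Gbar Bnom Hbar) &
    Y = block_mx (\sum_s G s + Gbar) 0 0 (\sum_s H s + Hbar)].

Lemma block_feasible_exists Bnom B : exists Y, block_feasible Bnom B Y.
Proof.
have [c hc] := half_block_exists Bnom.
have /choice[d hd] := fun s => half_block_exists (B s).
exists (block_mx (\sum_s (d s)%:M + c%:M) 0 0 (\sum_s (d s)%:M + c%:M)).
by exists (fun s => (d s)%:M), (fun s => (d s)%:M), c%:M, c%:M.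
Qed.

Let ulsubmx_comb (a b : R) (Y Y' : 'M[R]_(q + p)) :
  ulsubmx (a *: Y + b *: Y') = a *: ulsubmx Y + b *: ulsubmx Y'.
Proof. by apply/matrixP => i j; rewrite !mxE. Qed.

Let drsubmx_comb (a b : R) (Y Y' : 'M[R]_(q + p)) :
  drsubmx (a *: Y + b *: Y') = a *: drsubmx Y + b *: drsubmx Y'.
Proof. by apply/matrixP => i j; rewrite !mxE. Qed.

Let Phi (Y : 'M[R]_(q + p)) : set R := [set v | exists lam ups,
  [/\ forall k, 0 <= (lam : 'cV[R]_K) k 0, forall l, 0 <= (ups : 'cV[R]_L) l 0,
    forall x, quad (ulsubmx Y) x <= quad (\sum_l ups l 0 *: Rm l) x,
    forall x, quad (drsubmx Y) x <= quad (\sum_k lam k 0 *: T k) x &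
    support_fun calT lam + support_fun calR ups <= v]].

Let quad_combD n N (M : 'I_N -> 'M[R]_n) (a b : 'cV[R]_N) x :
  quad (\sum_k (a + b) k 0 *: M k) x =
  quad (\sum_k a k 0 *: M k) x + quad (\sum_k b k 0 *: M k) x.
Proof.
rewrite -quadD -big_split/=; congr quad; apply: eq_bigr => k _.
by rewrite mxE scalerDl.
Qed.

Let quad_combZ n N (M : 'I_N -> 'M[R]_n) (c : R) (a : 'cV[R]_N) x :
  quad (\sum_k (c *: a) k 0 *: M k) x = c * quad (\sum_k a k 0 *: M k) x.
Proof.
rewrite -quadZ scaler_sumr; congr quad; apply: eq_bigr => k _.
by rewrite mxE scalerA.
Qed.

Let Phi_total Y : exists lam ups,
  [/\ forall k, 0 <= (lam : 'cV[R]_K) k 0, forall l, 0 <= (ups : 'cV[R]_L) l 0,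
    forall x, quad (ulsubmx Y) x <= quad (\sum_l ups l 0 *: Rm l) x &
    forall x, quad (drsubmx Y) x <= quad (\sum_k lam k 0 *: T k) x].
Proof.
have [c c0 hc] := basic_dominates hR (ulsubmx Y).
have [d d0 hd] := basic_dominates hT (drsubmx Y).
exists (const_mx d), (const_mx c); split=> [k|l|x|x]; rewrite ?mxE//.
  by under eq_bigr do rewrite mxE.
by under eq_bigr do rewrite mxE.
Qed.

Let sublinear_Phi :
  sublinear (fun Y => inf (Phi Y)) /\ (forall Y v, Phi Y v -> inf (Phi Y) <= v).
Proof.
apply: sublinear_inf.
- move=> Y; have [lam [ups [l0 u0 k1 k2]]] := Phi_total Y.
  by exists (support_fun calT lam + support_fun calR ups), lam, ups.
- move=> Y Y' v v' [lam [ups [l0 u0 h1 h2 h3]]] [lam' [ups' [l0' u0' h1' h2' h3']]].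
  exists (lam + lam'), (ups + ups'); split=> [k|l|x|x|].
  + by rewrite mxE addr_ge0.
  + by rewrite mxE addr_ge0.
  + by rewrite -[Y]scale1r -[Y']scale1r ulsubmx_comb !scale1r quadD quad_combD lerD.
  + by rewrite -[Y]scale1r -[Y']scale1r drsubmx_comb !scale1r quadD quad_combD lerD.
  + apply: le_trans (lerD h3 h3').
    by rewrite [leRHS]addrACA lerD ?(supportD hT) ?(supportD hR).
- move=> c Y v c0 [lam [ups [l0 u0 h1 h2 h3]]].
  exists (c *: lam), (c *: ups); split=> [k|l|x|x|].
  + by rewrite mxE mulr_ge0.
  + by rewrite mxE mulr_ge0.
  + have := ulsubmx_comb c 0 Y 0; rewrite scale0r !addr0 => ->.
    by rewrite scale0r addr0 quadZ quad_combZ ler_wpM2l.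
  + have := drsubmx_comb c 0 Y 0; rewrite scale0r !addr0 => ->.
    by rewrite scale0r addr0 quadZ quad_combZ ler_wpM2l.
  + apply: (@le_trans _ _ (c * (support_fun calT lam + support_fun calR ups))).
      by rewrite mulrDr lerD ?(supportZ hT) ?(supportZ hR).
    by rewrite ler_wpM2l.
- move=> v [lam [ups [_ _ _ _]]]; apply: le_trans.
  by rewrite addr_ge0 ?(support_ge0 hT) ?(support_ge0 hR).
Qed.

Let block_feasible_conv Bnom B x y t : block_feasible Bnom B x ->
  block_feasible Bnom B y -> 0 <= t <= 1 ->
  block_feasible Bnom B (t *: x + (1 - t) *: y).
Proof.
move=> [G [H [Gb [Hb [h1 h2 ->]]]]] [G' [H' [Gb' [Hb' [h1' h2' ->]]]]] t01.
have eB (A : 'M[R]_(q, p)) : A = t *: A + (1 - t) *: A.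
  by rewrite -scalerDl addrC subrK scale1r.
exists (fun s => t *: G s + (1 - t) *: G' s), (fun s => t *: H s + (1 - t) *: H' s).
exists (t *: Gb + (1 - t) *: Gb'), (t *: Hb + (1 - t) *: Hb'); split.
- by move=> s; rewrite (eB (B s)); exact: half_block_conv.
- by rewrite (eB Bnom); exact: half_block_conv.
- rewrite !scale_block_mx add_block_mx !scaler0 !addr0 !big_split/= -!scaler_sumr.
  by congr block_mx; rewrite !scalerDr addrACA.
Qed.

Lemma feasible_of_blocks Bnom B lam ups G H Gbar Hbar :
  (forall k, 0 <= (lam : 'cV[R]_K) k 0) -> (forall l, 0 <= (ups : 'cV[R]_L) l 0) ->
  (forall s, psdmx (half_block (G s) (B s) (H s))) ->
  psdmx (half_block Gbar Bnom Hbar) ->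
  (forall x, quad (\sum_s G s + Gbar) x <= quad (\sum_l ups l 0 *: Rm l) x) ->
  (forall x, quad (\sum_s H s + Hbar) x <= quad (\sum_k lam k 0 *: T k) x) ->
  feasible_pt T Rm Bnom B lam ups G H Gbar Hbar.
Proof.
move=> l0 u0 h1 h2 k1 k2.
have [sGb sHb _] := (half_blockP _ _ _).1 h2.
have sG s : (G s)^T = G s by have [] := (half_blockP _ _ _).1 (h1 s).
have sH s : (H s)^T = H s by have [] := (half_blockP _ _ _).1 (h1 s).
have sumS n N (M : 'I_N -> 'M[R]_n) : (forall i, (M i)^T = M i) ->
    (\sum_i M i)^T = \sum_i M i.
  by move=> h; rewrite linear_sum/=; apply: eq_bigr.
split=> //.
- split=> [|x]; last by rewrite quadD quadN subr_ge0.
  rewrite linearB linearD/= sGb (sumS _ _ _ sG); congr (_ - _).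
  by apply: sumS => l; rewrite linearZ/=; have [-> _] := basic_psd hR l.
- split=> [|x]; last by rewrite quadD quadN subr_ge0.
  rewrite linearB linearD/= sHb (sumS _ _ _ sH); congr (_ - _).
  by apply: sumS => l; rewrite linearZ/=; have [-> _] := basic_psd hT l.
Qed.

Lemma feasible_exists Bnom B : exists lam ups G H Gbar Hbar,
  feasible_pt T Rm Bnom B lam ups G H Gbar Hbar.
Proof.
have [Y [G [H [Gb [Hb [h1 h2 eY]]]]]] := block_feasible_exists Bnom B.
have [lam [ups [l0 u0]]] := Phi_total Y.
rewrite eY block_mxKul block_mxKdr => k1 k2.
by exists lam, ups, G, H, Gb, Hb; exact: feasible_of_blocks.
Qed.

Let Opt_le_inf Bnom B Y : block_feasible Bnom B Y ->
  Opt_pair T calT Rm calR Bnom B <= inf (Phi Y).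
Proof.
move=> [G [H [Gb [Hb [h1 h2 eY]]]]].
apply: lb_le_inf.
  have [lam [ups [l0 u0 k1 k2]]] := Phi_total Y.
  by exists (support_fun calT lam + support_fun calR ups), lam, ups.
move=> v [lam [ups [l0 u0]]]; rewrite eY block_mxKul block_mxKdr => k1 k2.
apply: le_trans; apply: (@Opt_pair_le _ _ _ _ G H Gb Hb).
exact: feasible_of_blocks.
Qed.

Let mxtrace_sym n (W A : 'M[R]_n) : A^T = A ->
  \tr (2^-1 *: (W + W^T) *m A) = \tr (W^T *m A).
Proof.
move=> sA; rewrite -scalemxAl mulmxDl mxtraceZ mxtraceD.
have -> : \tr (W *m A) = \tr (W^T *m A).
  by rewrite -mxtrace_tr trmx_mul sA mxtrace_mulC.
lra.
Qed.

Let psd_sym n (W : 'M[R]_n) : (forall x, 0 <= quad W x) -> psdmx (2^-1 *: (W + W^T)).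
Proof.
move=> W0; split=> [|x]; first by rewrite linearZ/= linearD/= trmxK addrC.
by rewrite quadZ quadD quad_tr mulr_ge0// addr_ge0.
Qed.

(* [inf (Phi Y)] is the least cost of dominating the diagonal blocks of [Y];
   [W] and [V] are the symmetrized diagonal blocks of a linear minorant of it. *)
Lemma strong_duality Bnom B : exists W V,
  [/\ psdmx W, psdmx V, calR (\col_l \tr (W *m Rm l)), calT (\col_k \tr (V *m T k)) &
   forall G H Gbar Hbar, (forall s, psdmx (half_block (G s) (B s) (H s))) ->
     psdmx (half_block Gbar Bnom Hbar) ->
     Opt_pair T calT Rm calR Bnom B <=
       \tr (W *m (\sum_s G s + Gbar)) + \tr (V *m (\sum_s H s + Hbar))].
Proof.
have [slPhi infPhi] := sublinear_Phi.
have [M [Mle Mge]] := @mazur_orlicz R (q + p) _ (block_feasible Bnom B) _ slPhi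
  (block_feasible_exists Bnom B) (@block_feasible_conv Bnom B) (@Opt_le_inf Bnom B).
set W1 := ulsubmx M; set V1 := drsubmx M.
have trM A D : \tr (M^T *m block_mx A 0 0 D) = \tr (W1^T *m A) + \tr (V1^T *m D).
  by rewrite -{1}(submxK M) tr_block_mx mulmx_block !mulmx0 !addr0 !add0r mxtrace_block.
have quad_id lam ups (YA : 'M[R]_q) (YD : 'M[R]_p) :
    (forall k, 0 <= (lam : 'cV[R]_K) k 0) -> (forall l, 0 <= (ups : 'cV[R]_L) l 0) ->
    (forall x, quad YA x <= quad (\sum_l ups l 0 *: Rm l) x) ->
    (forall x, quad YD x <= quad (\sum_k lam k 0 *: T k) x) ->
    \tr (W1^T *m YA) + \tr (V1^T *m YD) <= support_fun calT lam + support_fun calR ups.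
  move=> l0 u0 h1 h2; rewrite -trM; apply: le_trans (Mle _) _; apply: infPhi.
  by exists lam, ups; split; rewrite ?block_mxKul ?block_mxKdr.
have comb0 n N (A : 'I_N -> 'M[R]_n) x : quad (\sum_k (0 : 'cV[R]_N) k 0 *: A k) x = 0.
  by rewrite quad_sum big1// => k _; rewrite mxE scale0r quad0.
have c0 n k : 0 <= (0 : 'cV[R]_n) k 0 by rewrite mxE.
have supp0 : support_fun calT 0 + support_fun calR 0 = 0.
  by rewrite (support0 hT) (support0 hR) addr0.
have psdW : psdmx (2^-1 *: (W1 + W1^T)).
  apply: psd_sym => x; rewrite -quad_tr quadE_tr.
  have := quad_id 0 0 (- (x *m x^T)) 0 (c0 _) (c0 _).
  rewrite supp0 mulmxN mulmx0 !linearN/= mxtrace0 addr0 oppr_le0; apply=> y.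
    by rewrite comb0 quadN oppr_le0 quad_gram sqnorm_ge0.
  by rewrite comb0 quad0.
have psdV : psdmx (2^-1 *: (V1 + V1^T)).
  apply: psd_sym => x; rewrite -quad_tr quadE_tr.
  have := quad_id 0 0 0 (- (x *m x^T)) (c0 _) (c0 _).
  rewrite supp0 mulmxN mulmx0 !linearN/= mxtrace0 add0r oppr_le0; apply=> y.
    by rewrite comb0 quad0.
  by rewrite comb0 quadN oppr_le0 quad_gram sqnorm_ge0.
exists (2^-1 *: (W1 + W1^T)), (2^-1 *: (V1 + V1^T)); split=> //.
- apply: (basic_dual_mem hR) => [l|ups u0].
    by rewrite mxE; apply: mxtrace_psd_ge0 => //; exact: basic_psd hR l.
  have := quad_id 0 ups (\sum_l ups l 0 *: Rm l) 0 (c0 _) u0 (fun=> lexx _).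
  rewrite mulmx0 mxtrace0 addr0 (support0 hT) add0r => h; apply: le_trans (h _); last first.
    by move=> x; rewrite comb0 quad0.
  rewrite dotvE mulmx_sumr linear_sum/=; apply: ler_sum => l _.
  rewrite mxE mxtrace_sym; last by have [] := basic_psd hR l.
  by rewrite -scalemxAr linearZ.
- apply: (basic_dual_mem hT) => [l|lam u0].
    by rewrite mxE; apply: mxtrace_psd_ge0 => //; exact: basic_psd hT l.
  have := quad_id lam 0 0 (\sum_l lam l 0 *: T l) u0 (c0 _).
  rewrite mulmx0 mxtrace0 add0r (support0 hR) addr0 => h.
  apply: le_trans (h _ _) => [|x|//]; last by rewrite comb0 quad0.
  rewrite dotvE mulmx_sumr linear_sum/=; apply: ler_sum => l _.
  rewrite mxE mxtrace_sym; last by have [] := basic_psd hT l.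
  by rewrite -scalemxAr linearZ.
- move=> G H Gb Hb h1 h2.
  have sG M' (A : 'M[R]_(q, p)) N : psdmx (half_block M' A N) -> M'^T = M' /\ N^T = N.
    by move=> /half_blockP[].
  rewrite !mxtrace_sym; first by rewrite -trM; apply: Mge; exists G, H, Gb, Hb.
  + rewrite linearD linear_sum/=; have [_ ->] := sG _ _ _ h2.
    by congr (_ + _); apply: eq_bigr => s _; have [] := sG _ _ _ (h1 s).
  + rewrite linearD linear_sum/=; have [-> _] := sG _ _ _ h2.
    by congr (_ + _); apply: eq_bigr => s _; have [] := sG _ _ _ (h1 s).
Qed.

End conic_duality.

Section nuclear_norm.
Context {R : realType}.

Lemma quad_diag_mx r (s : 'rV[R]_r) x : quad (diag_mx s) x = \sum_i s 0 i * x i 0 ^+ 2.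
Proof.
rewrite quadE dotvE; apply: eq_bigr => i _.
by rewrite mul_diag_mx mxE; ring.
Qed.

Lemma dotv_diag_mx r (s : 'rV[R]_r) x y :
  dotv x (diag_mx s *m y) = \sum_i s 0 i * (x i 0 * y i 0).
Proof.
by rewrite dotvE; apply: eq_bigr => i _; rewrite mul_diag_mx mxE; ring.
Qed.

Lemma mxtrace_svd_sum p q r (M : 'M[R]_(p, q)) (s : 'rV[R]_r) U V :
  is_svd M s U V -> \tr (U *m diag_mx s *m U^T) = \sum_i s 0 i.
Proof.
move=> [_ _ [UU _] _]; rewrite mxtrace_mulC mulmxA UU nz_indicator_mul mxtrace_diag//.
Qed.

Lemma half_block_of_svd p q r (C : 'M[R]_q) (D : 'M[R]_p) (B : 'M[R]_(q, p))
    (s : 'rV[R]_r) U V :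
  C \in unitmx -> D \in unitmx -> is_svd (C^T *m B *m D) s U V ->
  exists G H, psdmx (half_block G B H) /\
    \tr (C *m C^T *m G) + \tr (D *m D^T *m H) = \sum_i s 0 i.
Proof.
move=> uC uD svdM; have [s0 eM _ _] := svdM.
have symD n (Z : 'M[R]_(r, n)) :
    (Z^T *m diag_mx s *m Z)^T = Z^T *m diag_mx s *m Z.
  by rewrite !trmx_mul trmxK tr_diag_mx mulmxA.
have psdXY (X : 'M[R]_(r, q)) (Y : 'M[R]_(r, p)) : B = X^T *m diag_mx s *m Y ->
    psdmx (half_block (2^-1 *: (X^T *m diag_mx s *m X)) B (2^-1 *: (Y^T *m diag_mx s *m Y))).
  move=> eB; apply/half_blockP; split.
  - by rewrite linearZ/= symD.
  - by rewrite linearZ/= symD.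
  move=> z x; rewrite !quadZ !quad_conj eB -!mulmxA -dotv_mulmxl.
  rewrite !quad_diag_mx dotv_diag_mx.
  rewrite !mulr_sumr -!big_split/=; apply: sumr_ge0 => i _.
  have -> : 2^-1 * (s 0 i * (X *m z) i 0 ^+ 2) + s 0 i * ((X *m z) i 0 * (Y *m x) i 0) +
     2^-1 * (s 0 i * (Y *m x) i 0 ^+ 2) =
     2^-1 * s 0 i * ((X *m z) i 0 + (Y *m x) i 0) ^+ 2 by field.
  by rewrite mulr_ge0 ?sqr_ge0// mulr_ge0.
pose X := U^T *m invmx C; pose Y := V^T *m invmx D.
have uCT : C^T \in unitmx by rewrite unitmx_tr.
have eB : B = X^T *m diag_mx s *m Y.
  have eM' : U *m (diag_mx s *m V^T) = C^T *m B *m D by rewrite mulmxA.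
  rewrite /X /Y trmx_mul trmxK trmx_inv -!mulmxA [diag_mx s *m _]mulmxA.
  by rewrite [U *m (_ *m _)]mulmxA eM' mulmxK// mulKmx.
have trG n (E : 'M[R]_n) (Z : 'M[R]_(n, r)) : E \in unitmx ->
    \tr (E *m E^T *m ((Z^T *m invmx E)^T *m diag_mx s *m (Z^T *m invmx E)))
    = \tr (Z *m diag_mx s *m Z^T).
  move=> uE; have uET : E^T \in unitmx by rewrite unitmx_tr.
  rewrite trmx_mul trmxK trmx_inv -(mulmxA E) mxtrace_mulC !mulmxA mulmxV// mul1mx.
  by rewrite -!mulmxA mulVmx// mulmx1.
exists (2^-1 *: (X^T *m diag_mx s *m X)), (2^-1 *: (Y^T *m diag_mx s *m Y)); split.
  exact: psdXY.
rewrite -!scalemxAr !mxtraceZ /X /Y !trG// (mxtrace_svd_sum svdM).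
by rewrite (mxtrace_svd_sum (is_svd_tr svdM)); field.
Qed.

End nuclear_norm.

Section dual_bound.
Context {R : realType}.
Variables (p q K L S : nat).
Variables (T : 'I_K -> 'M[R]_p) (calT : set 'cV[R]_K).
Variables (Rm : 'I_L -> 'M[R]_q) (calR : set 'cV[R]_L).
Hypothesis hT : basic_ellitope_data T calT.
Hypothesis hR : basic_ellitope_data Rm calR.

Definition dual_factor p K (T : 'I_K -> 'M[R]_p) (calT : set 'cV[R]_K) (D : 'M[R]_p)
    (t : 'cV[R]_K) : Prop :=
  [/\ D \in unitmx, calT t, forall k, 0 < t k 0 &
      forall k, \tr (D *m D^T *m T k) <= t k 0].

(* The interior point of [calT] leaves room for mixing [V] with a small multiple
   of the identity, which makes it invertible. *)
Lemma dual_factor_perturb p' K' (T' : 'I_K' -> 'M[R]_p') (calT' : set 'cV[R]_K')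
    (V : 'M[R]_p') (tau : R) :
  basic_ellitope_data T' calT' -> psdmx V -> calT' (\col_k \tr (V *m T' k)) ->
  0 < tau < 1 ->
  exists D t, dual_factor T' calT' D t /\
    forall H, psdmx H -> (1 - tau) * \tr (V *m H) <= \tr (D *m D^T *m H).
Proof.
move=> hT' psdV Vt /andP[tau0 tau1].
have [t0 Tt0 t0_gt0] := basic_interior hT'.
have tr0 (H : 'M[R]_p') : psdmx H -> 0 <= \tr H.
  move=> psdH; rewrite -(mul1mx H); apply: mxtrace_psd_ge0 => //.
  by have := psdmx_gram (1%:M : 'M[R]_p'); rewrite trmx1 mulmx1.
have trT k : 0 <= \tr (T' k) by apply: tr0; exact: basic_psd hT' k.
pose e := (1 + \sum_k \tr (T' k) / t0 k 0)^-1.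
have sum0 : 0 <= \sum_k \tr (T' k) / t0 k 0.
  by apply: sumr_ge0 => k _; rewrite divr_ge0// ltW.
have e0 : 0 < e by rewrite invr_gt0 ltr_pwDl.
have eT k : e * \tr (T' k) <= t0 k 0.
  rewrite ler_pdivrMl ?ltr_pwDl// -ler_pdivrMr// (bigD1 k)//= addrCA lerDl.
  by rewrite addr_ge0// sumr_ge0// => l _; rewrite divr_ge0// ltW.
pose W := (1 - tau) *: V + (tau * e)%:M.
have te0 : 0 < tau * e by rewrite mulr_gt0.
have omt : 0 <= 1 - tau by rewrite subr_ge0 ltW.
have trW (H : 'M[R]_p') : \tr (W *m H) = (1 - tau) * \tr (V *m H) + tau * e * \tr H.
  by rewrite mulmxDl mxtraceD -scalemxAl mul_scalar_mx !mxtraceZ.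
have pdW : pdmx W.
  have [sV V0] := psdV; split=> [|x x0].
    by rewrite linearD/= linearZ/= sV tr_scalar_mx.
  rewrite quadD quadZ quad_scalar ltr_wpDl ?mulr_ge0//.
  by rewrite mulr_gt0// lt_neqAle eq_sym sqnorm_eq0 x0 sqnorm_ge0.
have [D uD eW] := pd_factor pdW.
exists D, (tau *: t0 + (1 - tau) *: (\col_k \tr (V *m T' k))); split; last first.
  by move=> H psdH; rewrite -eW trW lerDl mulr_ge0 ?(ltW te0)// tr0.
have tV k : 0 <= \tr (V *m T' k).
  by apply: mxtrace_psd_ge0 => //; exact: basic_psd hT' k.
split=> //.
- have [_ _ _ [_ /convex_setP convT _ _ _]] := hT'.
  by apply: convT => //; rewrite !ltW.
- by move=> k; rewrite !mxE ltr_pwDl ?mulr_gt0// mulr_ge0.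
- by move=> k; rewrite -eW trW !mxE [leLHS]addrC lerD2r -mulrA ler_wpM2l// ltW.
Qed.

Lemma Opt_pair_le_bound (Bnom : 'M[R]_(q, p)) (B : 'I_S -> 'M[R]_(q, p)) (F : R) :
  (forall C r D t, dual_factor Rm calR C r -> dual_factor T calT D t ->
    exists k0 k1 (s0 : 'rV[R]_k0) U0 V0 (s1 : 'I_S -> 'rV[R]_k1) U1 V1,
    [/\ is_svd (C^T *m Bnom *m D) s0 U0 V0,
        forall s, is_svd (C^T *m B s *m D) (s1 s) (U1 s) (V1 s) &
        \sum_i s0 0 i + \sum_s \sum_i s1 s 0 i <= F]) ->
  Opt_pair T calT Rm calR Bnom B <= F.
Proof.
move=> h; have [W [V [psdW psdV Wr Vt Oh]]] := strong_duality hT hR Bnom B.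
have key tau : 0 < tau < 1 -> (1 - tau) * Opt_pair T calT Rm calR Bnom B <= F.
  move=> tau01; have [tau0 tau1] := andP tau01.
  have [C [r [hC Ch]]] := dual_factor_perturb hR psdW Wr tau01.
  have [D [t [hD Dh]]] := dual_factor_perturb hT psdV Vt tau01.
  have [k0 [k1 [s0 [U0 [V0 [s1 [U1 [V1 [svd0 svd1 sF]]]]]]]]] := h _ _ _ _ hC hD.
  have [uC _ _ _] := hC; have [uD _ _ _] := hD.
  have [Gb [Hb [psdb trb]]] := half_block_of_svd uC uD svd0.
  have /choice[G /choice[H GH]] := fun s => half_block_of_svd uC uD (svd1 s).
  have psd1 s : psdmx (half_block (G s) (B s) (H s)) by have [] := GH s.
  apply: le_trans sF.
  have := Oh G H Gb Hb psd1 psdb; rewrite -(ler_pM2l (_ : 0 < 1 - tau)) ?subr_gt0//.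
  move=> /le_trans; apply; rewrite mulrDr.
  have psdG : psdmx (\sum_s G s + Gb).
    apply: psdmxD; last exact: half_block_psdl psdb.
    by apply: psdmx_sum => s; exact: half_block_psdl (psd1 s).
  have psdH : psdmx (\sum_s H s + Hb).
    apply: psdmxD; last exact: half_block_psdr psdb.
    by apply: psdmx_sum => s; exact: half_block_psdr (psd1 s).
  apply: le_trans (lerD (Ch _ psdG) (Dh _ psdH)) _.
  rewrite !mulmxDr !mxtraceD !mulmx_sumr !linear_sum/= -trb.
  have -> : \sum_s \sum_i s1 s 0 i =
      \sum_s (\tr (C *m C^T *m G s) + \tr (D *m D^T *m H s)).
    by apply: eq_bigr => s _; have [_ ->] := GH s.
  rewrite big_split/=; lra.
set w := Opt_pair _ _ _ _ _ _ in key *.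
rewrite leNgt; apply/negP => Fo.
have [w0|w0] := leP w 0.
  by have := key 2^-1; rewrite invr_gt0 invf_lt1// ltr1n ltr0n => /(_ isT); lra.
have := key (Num.min 2^-1 ((w - F) / (2 * w))).
rewrite lt_min gt_min !invr_gt0 ltr0n divr_gt0 ?subr_gt0 ?mulr_gt0//= invf_lt1// ltr1n.
move=> /(_ isT).
have : Num.min 2^-1 ((w - F) / (2 * w)) <= (w - F) / (2 * w) by rewrite ge_min lexx orbT.
move: (Num.min _ _) => m; rewrite ler_pdivlMr ?mulr_gt0// => h1 h2; nra.
Qed.

End dual_bound.

(** * Gaussian estimates of the dual value *)

Section gaussian_quadratic_forms.
Context {R : realType}.

Lemma expR_jensen n (w y : 'I_n -> R) : (forall i, 0 <= w i) -> \sum_i w i <= 1 ->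
  expR (\sum_i w i * y i) <= \sum_i w i * expR (y i) + (1 - \sum_i w i).
Proof.
move=> w0 w1; set m := \sum_i w i * y i.
have tangent x : expR m * (1 + (x - m)) <= expR x.
  have -> : expR x = expR m * expR (x - m) by rewrite -expRD addrC subrK.
  by rewrite ler_wpM2l ?expR_ge0// expR_ge1Dx.
have -> : expR m = \sum_i w i * (expR m * (1 + (y i - m))) +
    (1 - \sum_i w i) * (expR m * (1 + (0 - m))).
  have -> : \sum_i w i * (expR m * (1 + (y i - m))) =
      expR m * ((1 - m) * \sum_i w i + m).
    rewrite {3}/m [(1 - m) * _]mulr_sumr -big_split mulr_sumr/=.
    by apply: eq_bigr => i _; ring.
  ring.
apply: lerD; first by apply: ler_sum => i _; rewrite ler_wpM2l.
have := tangent 0; rewrite expR0 => t0.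
by rewrite -[leRHS]mulr1 ler_wpM2l// subr_ge0.
Qed.

Lemma sqnorm_mulmx_cols n r (A : 'M[R]_(n, r)) w :
  sqnorm (A^T *m w) = \sum_j ((col j A)^T *m w) 0 0 ^+ 2.
Proof.
by apply: eq_bigr => j _; rewrite tr_col -row_mul [in RHS]mxE.
Qed.

Lemma sum_sqnorm_cols n r (A : 'M[R]_(n, r)) :
  \sum_j sqnorm (col j A) = \tr (A *m A^T).
Proof.
rewrite mxtrace_mulC; apply: eq_bigr => j _; rewrite mxE; apply: eq_bigr => i _.
by rewrite !mxE.
Qed.

Lemma rcol_measurable_quad n N (Q : 'M[R]_n) (E : 'M[R]_(n, N)) :
  rcol_measurable (fun w : 'cV[R]_N => quad Q (E *m w)).
Proof.
apply: (rcol_measurable_mul E (f := quad Q)).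
have -> : quad Q = (fun x => \sum_i \sum_j Q i j * x i 0 * x j 0).
  apply/funext => x; rewrite quadE dotvE; apply: eq_bigr => i _.
  by rewrite mxE mulr_sumr; apply: eq_bigr => j _; ring.
apply: rcol_measurable_sum => i; apply: rcol_measurable_sum => j.
apply: rcol_measurableM; last exact: rcol_measurable_coord.
by apply: rcol_measurableM; [exact: rcol_measurable_cst|exact: rcol_measurable_coord].
Qed.

Lemma rcol_measurable_bilin q p N (B : 'M[R]_(q, p)) (E : 'M[R]_(q, N)) (F : 'M[R]_(p, N)) :
  rcol_measurable (fun w : 'cV[R]_N => dotv (E *m w) (B *m (F *m w))).
Proof.
have := rcol_measurable_quad (E^T *m B *m F) (1%:M : 'M[R]_N).
suff -> : (fun w : 'cV[R]_N => quad (E^T *m B *m F) (1%:M *m w)) =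
   (fun w : 'cV[R]_N => dotv (E *m w) (B *m (F *m w))) by [].
by apply/funext => w; rewrite mul1mx quadE dotv_mulmxl !mulmxA.
Qed.

Lemma gauss_mean_quad n (Q : 'M[R]_n) : psdmx Q ->
  gauss_mean (quad Q) = (\tr Q)%:E.
Proof.
move=> /psd_factor[A ->].
transitivity (gauss_mean (fun w => \sum_j ((col j A)^T *m w) 0 0 ^+ 2)).
  by apply: eq_gauss_mean => w; rewrite quad_gram sqnorm_mulmx_cols.
rewrite gauss_mean_sum; last 2 first.
- by move=> j; apply: rcol_measurableX; exact: rcol_measurable_dot.
- by move=> j w; exact: sqr_ge0.
rewrite -sum_sqnorm_cols -sumEFin; apply: eq_bigr => j _.
exact: gauss_mean_dot_sqr.
Qed.

Lemma gauss_mean_exp_quad n (Q : 'M[R]_n) : psdmx Q -> \tr Q <= 1 ->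
  (gauss_mean (fun w => expR (quad Q w / 3)%R) <= 2%:E)%E.
Proof.
move=> /psd_factor[A ->] trA.
pose a j := sqnorm (col j A).
have a0 j : 0 <= a j by exact: sqnorm_ge0.
have sa : \sum_j a j <= 1 by rewrite sum_sqnorm_cols.
pose s : R := Num.sqrt 3^-1.
have s0 : 0 < s by rewrite sqrtr_gt0 invr_gt0.
have s2 : s ^+ 2 = 3^-1 by rewrite sqr_sqrtr// invr_ge0.
have sV : s^-1 <= 2 by have s12 : 2^-1 <= s; [nra|rewrite invf_ple ?posrE].
have th : (1 - s ^+ 2) / 2 = 3^-1 by rewrite s2; field.
pose y j (w : 'cV[R]_n) := ((col j A)^T *m w) 0 0 ^+ 2 / a j.
have ay j w : ((col j A)^T *m w) 0 0 ^+ 2 = a j * y j w.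
  rewrite /y mulrCA; have [aj0|aj0] := eqVneq (a j) 0.
    have /eqP -> : col j A == 0 by rewrite -sqnorm_eq0 -/(a j) aj0.
    by rewrite trmx0 mul0mx mxE expr0n mul0r.
  by rewrite divff// mulr1.
have my j : rcol_measurable (y j).
  apply: rcol_measurableM; last exact: rcol_measurable_cst.
  by apply: rcol_measurableX; exact: rcol_measurable_dot.
have me j : rcol_measurable (fun w => expR (y j w / 3)).
  apply: rcol_measurable_exp; apply: rcol_measurableM => //.
  exact: rcol_measurable_cst.
have mae j : rcol_measurable (fun w => a j * expR (y j w / 3)).
  by apply: rcol_measurableM => //; exact: rcol_measurable_cst.
have ae0 j w : 0 <= a j * expR (y j w / 3) by rewrite mulr_ge0// expR_ge0.
have mean_ae j : gauss_mean (fun w => a j * expR (y j w / 3)) = (a j * s^-1)%:E.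
  have [aj0|aj0] := eqVneq (a j) 0.
    rewrite aj0 mul0r -(gauss_mean_cst n (lexx 0)).
    by apply: eq_gauss_mean => w; rewrite mul0r.
  have aj : 0 < a j by rewrite lt_neqAle eq_sym aj0 a0.
  have sa2 : (Num.sqrt (a j))^-1 ^+ 2 = (a j)^-1 by rewrite exprVn sqr_sqrtr.
  pose f := (Num.sqrt (a j))^-1 *: col j A.
  have f1 : sqnorm f = 1 by rewrite sqnormZ sa2 mulVf.
  rewrite gauss_meanZ//.
  rewrite EFinM -(gauss_mean_unit_exp_sqr s0 f1); congr (_ * _)%E.
  apply: eq_gauss_mean => w; rewrite th -/(dotv f w) dotvZl exprMn sa2 /y.
  by congr expR; rewrite /dotv; ring.
apply: (@le_trans _ _ (gauss_mean (fun w =>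
    \sum_j a j * expR (y j w / 3) + (1 - \sum_j a j))%R)).
  apply: le_gauss_mean.
  - apply: rcol_measurable_exp; apply: rcol_measurableM; last exact: rcol_measurable_cst.
    have := rcol_measurable_quad (A *m A^T) 1%:M.
    by under eq_fun do rewrite mul1mx.
  - by move=> w; exact: expR_ge0.
  - apply: rcol_measurableD; last exact: rcol_measurable_cst.
    exact: rcol_measurable_sum.
  - move=> w; rewrite quad_gram sqnorm_mulmx_cols.
    under eq_bigr do rewrite ay.
    rewrite mulr_suml; under eq_bigr do rewrite -mulrA.
    exact: expR_jensen.
rewrite gauss_meanD//; last 4 first.
- exact: rcol_measurable_sum.
- by move=> w; exact: sumr_ge0.
- exact: rcol_measurable_cst.
- by move=> w; rewrite subr_ge0.
rewrite gauss_mean_cst ?subr_ge0// gauss_mean_sum//.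
under eq_bigr do rewrite mean_ae.
rewrite sumEFin -mulr_suml -EFinD lee_fin.
have : (\sum_j a j) * s^-1 <= (\sum_j a j) * 2 by rewrite ler_wpM2l// sumr_ge0.
lra.
Qed.

Lemma ln4_ge1 : 1 <= ln 4 :> R.
Proof.
have h : expR 2^-1 <= 2 :> R.
  have := @expR_ge1Dx R (- 2^-1); rewrite expRN => h.
  rewrite -lef_pV2 ?posrE ?expR_gt0//; lra.
rewrite -[leLHS]expRK ler_ln ?posrE ?expR_gt0//.
rewrite (_ : 1 = 2^-1 + 2^-1 :> R); last by field.
rewrite expRD; have := expR_gt0 (2^-1 : R); nra.
Qed.

(* Bounds the mean of the maximum of [K] Gaussian quadratic forms of trace at
   most 1, see [gauss_majorant]. *)
Definition max_mean_bound (K : nat) : R := if (1 < K)%N then 3 * ln (4 * K%:R) else 1.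

End gaussian_quadratic_forms.
Arguments max_mean_bound R K : clear implicits.

Section gaussian_estimates.
Context {R : realType}.

Lemma max_mean_bound_gt0 K : 0 < max_mean_bound R K.
Proof.
rewrite /max_mean_bound; case: ifP => // K1; rewrite mulr_gt0// ln_gt0//.
have : 1 <= K%:R :> R by rewrite ler1n ltnW.
lra.
Qed.

(* A tangent line of the logarithm turns the maximum of the forms into the
   integrable majorant [3 (ln (4 K) - 1 + sum_k exp (q_k / 3) / (4 K))]. *)
Lemma gauss_majorant p K N (T : 'I_K -> 'M[R]_p) (t : 'cV[R]_K) (E : 'M[R]_(p, N)) :
  (0 < K)%N -> (forall k, psdmx (T k)) -> (forall k, 0 < t k 0) ->
  (forall k, \tr (E^T *m T k *m E) <= t k 0) ->
  exists g : 'cV[R]_N -> R, [/\ rcol_measurable g, forall w, 0 <= g w,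
    forall w k, quad (T k) (E *m w) <= g w * t k 0 &
    (gauss_mean g <= (max_mean_bound R K)%:E)%E].
Proof.
move=> K0 psdT t0 trT.
pose Q k := (t k 0)^-1 *: (E^T *m T k *m E).
have psdQ k : psdmx (Q k).
  by apply: psdmxZ; [rewrite invr_ge0 ltW|exact: psdmx_conj].
have trQ k : \tr (Q k) <= 1 by rewrite mxtraceZ ler_pdivrMl// mulr1.
have QE k w : quad (T k) (E *m w) = quad (Q k) w * t k 0.
  by rewrite quadZ quad_conj mulrAC mulVf ?mul1r// gt_eqF.
have mQ k : rcol_measurable (quad (Q k)).
  have := rcol_measurable_quad (Q k) 1%:M.
  by under eq_fun do rewrite mul1mx.
have Q0 k w : 0 <= quad (Q k) w by case: (psdQ k).
rewrite /max_mean_bound; case: ltnP => K1; last first.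
  have K1' : K = 1%N by apply/eqP; rewrite eqn_leq K1.
  subst K; exists (quad (Q 0)); split=> //.
    by move=> w k; rewrite QE (ord1 k).
  by rewrite gauss_mean_quad// lee_fin.
have K0' : 0 < K%:R :> R by rewrite ltr0n.
have K1r : 1 <= K%:R :> R by rewrite ler1n ltnW.
pose c : R := 4 * K%:R; have c0 : 0 < c by rewrite mulr_gt0.
have lnc : 1 <= ln c.
  by apply: le_trans (@ln4_ge1 R) _; rewrite ler_ln ?posrE// /c; lra.
pose g w := 3 * (ln c - 1 + c^-1 * \sum_k expR (quad (Q k) w / 3)).
have mexp k : rcol_measurable (fun w => expR (quad (Q k) w / 3)).
  apply: rcol_measurable_exp; apply: rcol_measurableM => //; exact: rcol_measurable_cst.
have msum : rcol_measurable (fun w => \sum_k expR (quad (Q k) w / 3)).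
  exact: rcol_measurable_sum.
have sum0 w : 0 <= \sum_k expR (quad (Q k) w / 3).
  by apply: sumr_ge0 => k _; exact: expR_ge0.
have mcsum : rcol_measurable (fun w => c^-1 * \sum_k expR (quad (Q k) w / 3)).
  by apply: rcol_measurableM => //; exact: rcol_measurable_cst.
have csum0 w : 0 <= c^-1 * \sum_k expR (quad (Q k) w / 3).
  by rewrite mulr_ge0// invr_ge0 ltW.
have lnc0 : 0 <= ln c - 1 by rewrite subr_ge0.
have min : rcol_measurable (fun w => ln c - 1 + c^-1 * \sum_k expR (quad (Q k) w / 3)).
  by apply: rcol_measurableD => //; exact: rcol_measurable_cst.
exists g; split.
- by apply: rcol_measurableM => //; exact: rcol_measurable_cst.
- by move=> w; rewrite mulr_ge0// addr_ge0.
- move=> w k; rewrite QE ler_wpM2r ?(ltW (t0 k))//.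
  have h1 : expR (quad (Q k) w / 3) <= \sum_l expR (quad (Q l) w / 3).
    rewrite (bigD1 k)//= lerDl; apply: sumr_ge0 => l _; exact: expR_ge0.
  have h2 : c^-1 * expR (quad (Q k) w / 3) <= c^-1 * \sum_l expR (quad (Q l) w / 3).
    by rewrite ler_wpM2l// invr_ge0 ltW.
  have h3 : c^-1 * expR (quad (Q k) w / 3) = expR (quad (Q k) w / 3 - ln c).
    by rewrite expRD expRN lnK ?posrE// mulrC.
  have := expR_ge1Dx (quad (Q k) w / 3 - ln c); rewrite -h3 /g; lra.
- rewrite gauss_meanZ//; last by move=> w; rewrite addr_ge0.
  rewrite gauss_meanD//; last exact: rcol_measurable_cst.
  rewrite gauss_mean_cst// gauss_meanZ ?invr_ge0 ?(ltW c0)// gauss_mean_sum//.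
  rewrite EFinM lee_wpmul2l ?lee_fin//.
  apply: (@le_trans _ _ ((ln c - 1)%:E + (c^-1)%:E * (\sum_(k < K) 2)%:E)%E).
    rewrite leeD2l// lee_wpmul2l ?lee_fin ?invr_ge0 ?(ltW c0)// -sumEFin.
    by apply: lee_sum => k _; exact: gauss_mean_exp_quad.
  rewrite -EFinM -EFinD lee_fin sumr_const card_ord -[2 *+ K]mulr_natr.
  have -> : c^-1 * (2 * K%:R) = 2^-1 by rewrite /c; field; exact: lt0r_neq0.
  by lra.
Qed.

Section bilinear_bound.
Variables (p q K L : nat).
Variables (T : 'I_K -> 'M[R]_p) (calT : set 'cV[R]_K).
Variables (Rm : 'I_L -> 'M[R]_q) (calR : set 'cV[R]_L).
Hypothesis hT : basic_ellitope_data T calT.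
Hypothesis hR : basic_ellitope_data Rm calR.
Variables (phi : 'cV[R]_q -> 'cV[R]_p -> R) (N0 : R).
Hypothesis phiZ : forall a b z x, 0 <= a -> 0 <= b -> phi (a *: z) (b *: x) = a * b * phi z x.
Hypothesis phi_le : forall z x, ellitope Rm calR z -> ellitope T calT x -> phi z x <= N0.

Lemma bilinear_gauge r t g1 g2 z x : calR r -> calT t -> 0 <= g1 -> 0 <= g2 ->
  (forall l, quad (Rm l) z <= g1 * r l 0) -> (forall k, quad (T k) x <= g2 * t k 0) ->
  phi z x <= N0 * (Num.sqrt g1 * Num.sqrt g2).
Proof.
move=> Rr Tt; rewrite le_eqVlt => /orP[/eqP <-|g10].
  move=> _ h _; have -> : z = 0.
    by apply: (basic_quad_eq0 hR) => l; have := h l; rewrite mul0r.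
  by have := @phiZ 0 1 0 x (lexx _) ler01; rewrite scale0r scale1r sqrtr0 !mul0r mulr0 => ->.
rewrite le_eqVlt => /orP[/eqP <-|g20].
  move=> _ h; have -> : x = 0.
    by apply: (basic_quad_eq0 hT) => l; have := h l; rewrite mul0r.
  have := @phiZ 1 0 z 0 ler01 (lexx _); rewrite scale0r scale1r sqrtr0 !mulr0 mul0r => ->.
  by [].
move=> h1 h2.
have Zz := ellitope_gauge Rr g10 h1; have Xx := ellitope_gauge Tt g20 h2.
have s1 : 0 < Num.sqrt g1 by rewrite sqrtr_gt0.
have s2 : 0 < Num.sqrt g2 by rewrite sqrtr_gt0.
have := phi_le Zz Xx; rewrite phiZ ?invr_ge0 ?(ltW s1) ?(ltW s2)//.
by rewrite -invfM ler_pdivrMl ?mulr_gt0// mulrC.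
Qed.

Lemma gauss_mean_bilinear N (E : 'M[R]_(q, N)) (F : 'M[R]_(p, N)) r t :
  calR r -> calT t -> (forall l, 0 < r l 0) -> (forall k, 0 < t k 0) ->
  (forall l, \tr (E^T *m Rm l *m E) <= r l 0) ->
  (forall k, \tr (F^T *m T k *m F) <= t k 0) ->
  (forall z x, 0 <= phi z x) ->
  rcol_measurable (fun w => phi (E *m w) (F *m w)) ->
  (gauss_mean (fun w => phi (E *m w) (F *m w)) <=
    (N0 * Num.sqrt (max_mean_bound R L * max_mean_bound R K))%:E)%E.
Proof.
move=> Rr Tt r0 t0 trE trF phi0 mphi.
have [K0 _ _ _] := hT; have [L0 _ _ _] := hR.
have N00 : 0 <= N0.
  by apply: le_trans (phi0 0 0) (phi_le (ellitope0 hR) (ellitope0 hT)).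
have [g1 [mg1 g10 h1 mean1]] := gauss_majorant L0 (basic_psd hR) r0 trE.
have [g2 [mg2 g20 h2 mean2]] := gauss_majorant K0 (basic_psd hT) t0 trF.
set M1 := max_mean_bound R L in mean1 *; set M2 := max_mean_bound R K in mean2 *.
have M10 : 0 < M1 by exact: max_mean_bound_gt0.
have M20 : 0 < M2 by exact: max_mean_bound_gt0.
pose a := N0 * Num.sqrt (M2 / M1) / 2; pose b := N0 * Num.sqrt (M1 / M2) / 2.
have a0 : 0 <= a by rewrite !mulr_ge0 ?sqrtr_ge0// invr_ge0.
have b0 : 0 <= b by rewrite !mulr_ge0 ?sqrtr_ge0// invr_ge0.
have mag1 : rcol_measurable (fun w => a * g1 w).
  by apply: rcol_measurableM => //; exact: rcol_measurable_cst.
have mbg2 : rcol_measurable (fun w => b * g2 w).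
  by apply: rcol_measurableM => //; exact: rcol_measurable_cst.
have m1 : 0 < Num.sqrt M1 by rewrite sqrtr_gt0.
have m2 : 0 < Num.sqrt M2 by rewrite sqrtr_gt0.
have sM1 : Num.sqrt M1 ^+ 2 = M1 by rewrite sqr_sqrtr// ltW.
have sM2 : Num.sqrt M2 ^+ 2 = M2 by rewrite sqr_sqrtr// ltW.
have aE : a = N0 * (Num.sqrt M2 / Num.sqrt M1) / 2 by rewrite /a sqrtrM ?ltW// sqrtrV ?ltW.
have bE : b = N0 * (Num.sqrt M1 / Num.sqrt M2) / 2 by rewrite /b sqrtrM ?ltW// sqrtrV ?ltW.
apply: (@le_trans _ _ (gauss_mean (fun w => a * g1 w + b * g2 w)%R)).
  apply: le_gauss_mean => //; first exact: rcol_measurableD.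
  move=> w; apply: le_trans (bilinear_gauge Rr Tt (g10 w) (g20 w) (h1 w) (h2 w)) _.
  have e1 : Num.sqrt (g1 w) ^+ 2 = g1 w by rewrite sqr_sqrtr.
  have e2 : Num.sqrt (g2 w) ^+ 2 = g2 w by rewrite sqr_sqrtr.
  rewrite -e1 -e2 !sqrtr_sqr !(ger0_norm (sqrtr_ge0 _)) aE bE.
  move: (Num.sqrt (g1 w)) (Num.sqrt (g2 w)) => u v.
  have -> : N0 * (Num.sqrt M2 / Num.sqrt M1) / 2 * u ^+ 2 +
     N0 * (Num.sqrt M1 / Num.sqrt M2) / 2 * v ^+ 2 =
     N0 * (u * v) + N0 * (Num.sqrt M1 * Num.sqrt M2)^-1 / 2 *
       (Num.sqrt M2 * u - Num.sqrt M1 * v) ^+ 2.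
    by field; rewrite !lt0r_neq0.
  rewrite lerDl mulr_ge0 ?sqr_ge0// !mulr_ge0// ?invr_ge0 ?mulr_ge0// ltW//.
rewrite gauss_meanD//; last 2 first.
- by move=> w; rewrite mulr_ge0.
- by move=> w; rewrite mulr_ge0.
rewrite !gauss_meanZ//.
apply: (@le_trans _ _ (a%:E * M1%:E + b%:E * M2%:E)%E).
  by apply: leeD; rewrite lee_wpmul2l// lee_fin.
rewrite -!EFinM -EFinD lee_fin aE bE sqrtrM ?(ltW M10)//.
rewrite -{2}sM1 -{3}sM2 le_eqVlt; apply/orP; left; apply/eqP.
by field; rewrite !lt0r_neq0.
Qed.

End bilinear_bound.

End gaussian_estimates.

Section svd_means.
Context {R : realType}.
Variables (p q k : nat) (M : 'M[R]_(q, p)) (s : 'rV[R]_k) (U : 'M[R]_(q, k)) (V : 'M[R]_(p, k)).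
Hypothesis svdM : is_svd M s U V.

Let nz := diag_mx (nz_indicator s).

Lemma svd_mxtrace_le (X : 'M[R]_q) : psdmx X -> \tr (U^T *m X *m U) <= \tr X.
Proof.
move=> psdX; have [_ _ [UU _] [UD _]] := svdM.
pose P := U *m U^T.
have PP : P *m P = P by rewrite /P mulmxA -(mulmxA U) UU UD.
have P1 : psdmx (1%:M - P).
  have -> : 1%:M - P = (1%:M - P) *m (1%:M - P)^T.
    rewrite linearB/= trmx1 trmx_mul trmxK -/P mulmxBr mulmx1 mulmxBl mul1mx PP.
    by rewrite subrr subr0.
  exact: psdmx_gram.
have := mxtrace_psd_ge0 psdX P1.
by rewrite mulmxBr mulmx1 linearB/= subr_ge0 /P mulmxA mxtrace_mulC mulmxA.
Qed.

Lemma svd_nominal_mean :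
  gauss_mean (fun w : 'cV[R]_k => `|dotv (U *m w) (M *m (V *m w))|) = (\sum_i s 0 i)%:E.
Proof.
have [s0 eM [UU VV] _] := svdM.
transitivity (gauss_mean (fun w : 'cV[R]_k => \sum_i s 0 i * w i 0 ^+ 2)).
  apply: eq_gauss_mean => w.
  have -> : dotv (U *m w) (M *m (V *m w)) = \sum_i s 0 i * w i 0 ^+ 2.
    rewrite dotv_mulmxl {1}eM -(mulmxA _ V^T) (mulmxA V^T) VV !mulmxA UU.
    rewrite nz_indicator_mul diag_mxC nz_indicator_mul.
    by rewrite dotv_diag_mx; apply: eq_bigr.
  by rewrite ger0_norm// sumr_ge0// => i _; rewrite mulr_ge0 ?sqr_ge0.
have mX i : rcol_measurable (fun w : 'cV[R]_k => w i 0 ^+ 2).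
  by apply: rcol_measurableX; exact: rcol_measurable_coord.
rewrite gauss_mean_sum; last 2 first.
- by move=> i; apply: rcol_measurableM => //; exact: rcol_measurable_cst.
- by move=> i w; rewrite mulr_ge0 ?sqr_ge0.
rewrite -sumEFin; apply: eq_bigr => i _.
rewrite gauss_meanZ//; last by move=> w; exact: sqr_ge0.
by rewrite gauss_mean_coord_sqr mule1.
Qed.

(* [a b = ((a + b)^2 - (a - b)^2) / 4] diagonalizes the bilinear form on the
   concatenated vector, with eigenvalues [s / 2] and [- s / 2]. *)
Lemma svd_perturbation_mean : (0 < k)%N ->
  ((\sum_i s 0 i)%:E <= (vartheta R (k + k))%:E *
    gauss_mean (fun w : 'cV[R]_(q + p) => `|dotv (usubmx w) (M *m dsubmx w)|%R))%E.
Proof.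
move=> k0; have [s0 eM [UU VV] [UD VD]] := svdM.
pose c : R := (Num.sqrt 2)^-1.
have c2 : c * c = 2^-1 by rewrite -expr2 exprVn sqr_sqrtr.
pose F : 'M[R]_(k + k, q + p) := c *: block_mx U^T V^T U^T (- V^T).
have half : 2^-1 + 2^-1 = 1 :> R by field.
have tnz : nz^T = nz by rewrite tr_diag_mx.
have DU : nz *m U^T = U^T by rewrite -tnz -trmx_mul UD.
have DV : nz *m V^T = V^T by rewrite -tnz -trmx_mul VD.
have FF : F *m F^T = block_mx nz 0 0 nz.
  rewrite /F linearZ/= -scalemxAl -scalemxAr scalerA c2 tr_block_mx !linearN/= !trmxK.
  rewrite mulmx_block !mulmxN !mulNmx opprK UU VV -/nz subrr scale_block_mx scaler0.
  by rewrite scalerDr -scalerDl half scale1r.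
have FFF : F *m F^T *m F = F.
  by rewrite FF /F -scalemxAr mulmx_block !mul0mx !addr0 !add0r mulmxN DU DV.
pose alpha (i : 'I_(k + k)) : R :=
  match fintype.split i with inl j => s 0 j / 2 | inr j => - (s 0 j / 2) end.
have alphal j : alpha (lshift k j) = s 0 j / 2 by rewrite /alpha (unsplitK (inl j)).
have alphar j : alpha (rshift k j) = - (s 0 j / 2) by rewrite /alpha (unsplitK (inr j)).
have sum_alpha : \sum_i `|alpha i| = \sum_i s 0 i.
  rewrite big_split_ord/= -big_split/=; apply: eq_bigr => j _.
  by rewrite alphal alphar normrN ger0_norm ?divr_ge0//; lra.
have quadF w : diag_quad alpha (F *m w) = dotv (usubmx w) (M *m dsubmx w).
  set w1 := usubmx w; set w2 := dsubmx w.
  have Fw : F *m w = c *: col_mx (U^T *m w1 + V^T *m w2) (U^T *m w1 - V^T *m w2).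
    by rewrite -{1}(vsubmxK w) -scalemxAl mul_block_col mulNmx.
  have -> : dotv w1 (M *m w2) = dotv (U^T *m w1) (diag_mx s *m (V^T *m w2)).
    by rewrite {1}eM -!mulmxA [RHS]dotv_mulmxl trmxK.
  rewrite dotv_diag_mx /diag_quad big_split_ord/= -big_split/=; apply: eq_bigr => j _.
  have FwL : (F *m w) (lshift k j) 0 = c * ((U^T *m w1) j 0 + (V^T *m w2) j 0).
    by rewrite Fw mxE col_mxEu mxE.
  have FwR : (F *m w) (rshift k j) 0 = c * ((U^T *m w1) j 0 - (V^T *m w2) j 0).
    by rewrite Fw mxE col_mxEd mxE; congr (_ * (_ + _)); rewrite mxE.
  rewrite alphal alphar FwL FwR !exprMn [c ^+ 2]c2.
  by field.
have mh : rcol_measurable (fun v : 'cV[R]_(k + k) => `|diag_quad alpha v|).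
  by apply: rcol_measurable_norm; exact: rcol_measurable_diag_quad.
have kk0 : (0 < k + k)%N by rewrite addn_gt0 k0.
rewrite -sum_alpha; apply: le_trans (sum_abs_le_vartheta kk0 alpha) _.
rewrite -(gauss_mean_isometry FFF mh)//.
  by under eq_gauss_mean do rewrite quadF.
move=> y w; congr `|_|; apply: eq_bigr => i _; rewrite FF.
have [->|ai] := eqVneq (alpha i) 0; first by rewrite !mul0r.
have subE (a b : 'cV[R]_k) j : (a - b) j 0 = a j 0 - b j 0 by rewrite !mxE.
have nzE (y' : 'cV[R]_k) j : s 0 j != 0 -> (nz *m y') j 0 = y' j 0.
  by move=> sj; rewrite mul_diag_mx mxE mxE sj mul1r.
rewrite mxE (_ : (_ *m y) i 0 = 0) ?add0r// mulmxBl mul1mx -(vsubmxK y) mul_block_col.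
rewrite !mul0mx addr0 add0r opp_col_mx add_col_mx.
case: (split_ordP i) ai => j ->; rewrite ?alphal ?alphar ?oppr_eq0 => aj.
- by rewrite col_mxEu subE nzE ?subrr//; apply: contraNneq aj => ->; rewrite mul0r.
- by rewrite col_mxEd subE nzE ?subrr//; apply: contraNneq aj => ->; rewrite mul0r.
Qed.

End svd_means.

Section constants.
Context {R : realType}.

Lemma max_mean_bound_le_ln K : (0 < K)%N -> max_mean_bound R K <= 3 * ln (4 * K%:R).
Proof.
move=> K0; rewrite /max_mean_bound; case: ifP => // _.
have K1 : 1 <= K%:R :> R by rewrite ler1n.
have : 1 <= ln (4 * K%:R) :> R.
  by apply: le_trans (@ln4_ge1 R) _; rewrite ler_ln ?posrE; lra.
lra.
Qed.

Lemma max_mean_bound_varsigma K L : (0 < K)%N -> (0 < L)%N ->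
  Num.sqrt (max_mean_bound R L * max_mean_bound R K) <= varsigma R K L.
Proof.
move=> K0 L0; rewrite /varsigma; case: ifP => KL; last first.
  move: KL; rewrite leq_max => /norP[/negbTE hK /negbTE hL].
  by rewrite /max_mean_bound hK hL mulr1 sqrtr1.
have lK := max_mean_bound_le_ln K0; have lL := max_mean_bound_le_ln L0.
have K1 := max_mean_bound_gt0 K (R := R); have L1 := max_mean_bound_gt0 L (R := R).
have -> : 3 * Num.sqrt (ln (4 * K%:R) * ln (4 * L%:R)) =
    Num.sqrt (3 ^+ 2 * (ln (4 * K%:R) * ln (4 * L%:R))) :> R.
  by rewrite [RHS]sqrtrM ?exprn_ge0// sqrtr_sqr ger0_norm.
rewrite ler_wsqrtr//.
apply: (@le_trans _ _ ((3 * ln (4 * L%:R)) * (3 * ln (4 * K%:R)))).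
  by apply: ler_pM => //; exact: ltW.
by rewrite le_eqVlt; apply/orP; left; apply/eqP; ring.
Qed.

Lemma varkappa_ge0 K : 0 <= varkappa R K.
Proof. by rewrite /varkappa; case: ifP => // _; rewrite mulr_ge0// sqrtr_ge0. Qed.

Lemma max_mean_bound_varkappa K : (0 < K)%N ->
  Num.sqrt (max_mean_bound R K) <= varkappa R K.
Proof.
move=> K0; rewrite /varkappa /max_mean_bound; case: ifP => K1; last by rewrite sqrtr1.
have K2 : 2 <= K%:R :> R by rewrite ler_nat.
have -> : 5 / 2 * Num.sqrt (ln (2 * K%:R)) = Num.sqrt ((5 / 2) ^+ 2 * ln (2 * K%:R)) :> R.
  by rewrite [RHS]sqrtrM ?exprn_ge0// sqrtr_sqr ger0_norm.
rewrite ler_wsqrtr//.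
have -> : 4 * K%:R = 2 * (2 * K%:R) :> R by ring.
rewrite lnM ?posrE; [|lra|lra].
have h : ln 2 <= ln (2 * K%:R) :> R by rewrite ler_ln ?posrE; lra.
have h0 : 0 <= ln 2 :> R by rewrite ln_ge0//; lra.
rewrite expr2; lra.
Qed.

End constants.

Section main_estimate.
Context {R : realType}.
Variables (p q K L S : nat).
Variables (T : 'I_K -> 'M[R]_p) (calT : set 'cV[R]_K).
Variables (Rm : 'I_L -> 'M[R]_q) (calR : set 'cV[R]_L).
Hypothesis hT : basic_ellitope_data T calT.
Hypothesis hR : basic_ellitope_data Rm calR.
Variables (Bnom : 'M[R]_(q, p)) (B : 'I_S -> 'M[R]_(q, p)) (kappa : nat) (N0 : R).
Hypothesis rankB : forall s, (\rank (B s) <= kappa)%N.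
Hypothesis nom_le : forall z x, ellitope Rm calR z -> ellitope T calT x ->
  `|dotv z (Bnom *m x)| <= N0.
Hypothesis pert_le : forall z x, ellitope Rm calR z -> ellitope T calT x ->
  \sum_s `|dotv z (B s *m x)| <= N0.

Theorem Opt_pair_le_factor : Opt_pair T calT Rm calR Bnom B <=
  (varsigma R K L + varkappa R K * varkappa R L * vartheta R (2 * kappa)) * N0.
Proof.
have [K0 _ _ _] := hT; have [L0 _ _ _] := hR.
have N00 : 0 <= N0.
  exact: le_trans (normr_ge0 _) (nom_le (ellitope0 hR) (ellitope0 hT)).
apply: Opt_pair_le_bound => // C r D t [uC Rr r0 trC] [uD Tt t0 trD].
set M := Num.sqrt (max_mean_bound R L * max_mean_bound R K).
have [k' [s0 [U0 [V0 svd0]]]] : exists k' s' U V,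
    @is_svd R q p k' (C^T *m Bnom *m D) s' U V.
  by exists (\rank (C^T *m Bnom *m D)); exact: svd_exists.
have /choice[s1 /choice[U1 /choice[V1 svd1]]] :
    forall s, exists s' U V, @is_svd R q p kappa (C^T *m B s *m D) s' U V.
  move=> s; apply: svd_exists; apply: leq_trans (mxrankM_maxl _ _) _.
  exact: leq_trans (mxrankM_maxr _ _) (rankB s).
exists k', kappa, s0, U0, V0, s1, U1, V1; split=> //.
rewrite mulrDl; apply: lerD.
  apply: (@le_trans _ _ (N0 * M)); last first.
    by rewrite mulrC ler_wpM2r// max_mean_bound_varsigma.
  rewrite -lee_fin -(svd_nominal_mean svd0).
  have := @gauss_mean_bilinear R p q K L T calT Rm calR hT hR
    (fun z x => `|dotv z (Bnom *m x)|) N0 _ nom_le _ (C *m U0) (D *m V0) r t Rr Tt r0 t0.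
  have -> : gauss_mean (fun w => `|dotv (U0 *m w) (C^T *m Bnom *m D *m (V0 *m w))|) =
      gauss_mean (fun w => `|dotv (C *m U0 *m w) (Bnom *m (D *m V0 *m w))|).
    apply: eq_gauss_mean => w; congr `|_|.
    by rewrite -!mulmxA [RHS]dotv_mulmxl.
  apply.
  - by move=> a b z x a0 b0; rewrite -scalemxAr dotvZl dotvZr mulrA !normrM (ger0_norm a0) (ger0_norm b0).
  - move=> l; rewrite trmx_mul !mulmxA -(mulmxA _ C^T) -(mulmxA _ _ C).
    apply: le_trans (svd_mxtrace_le svd0 (psdmx_conj C (basic_psd hR l))) _.
    by apply: le_trans (trC l); rewrite mxtrace_mulC mulmxA.
  - move=> l; rewrite trmx_mul !mulmxA -(mulmxA _ D^T) -(mulmxA _ _ D).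
    apply: le_trans (svd_mxtrace_le (is_svd_tr svd0) (psdmx_conj D (basic_psd hT l))) _.
    by apply: le_trans (trD l); rewrite mxtrace_mulC mulmxA.
  - by [].
  - by apply: rcol_measurable_norm; exact: rcol_measurable_bilin.
have [k0|k0] := posnP kappa.
  have -> : vartheta R (2 * kappa) = 0 by rewrite k0 muln0 /vartheta eqxx.
  rewrite mulr0 mul0r big1// => s _; apply: big1 => i _.
  by have := ltn_ord i; rewrite [X in (_ < X)%N]k0.
apply: (@le_trans _ _ (vartheta R (2 * kappa) * (N0 * M))); last first.
  have k20 : (0 < 2 * kappa)%N by rewrite muln_gt0.
  rewrite [leRHS]mulrAC mulrC ler_wpM2r ?(vartheta_ge0 k20)// mulrC ler_wpM2r//.
  rewrite /M sqrtrM ?(ltW (max_mean_bound_gt0 _))// mulrC.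
  by apply: ler_pM; rewrite ?sqrtr_ge0// max_mean_bound_varkappa.
have mean_s s : rcol_measurable (fun w : 'cV[R]_(q + p) =>
    `|dotv (row_mx C 0 *m w) (B s *m (row_mx 0 D *m w))|).
  by apply: rcol_measurable_norm; exact: rcol_measurable_bilin.
have := @gauss_mean_bilinear R p q K L T calT Rm calR hT hR
    (fun z x => \sum_s `|dotv z (B s *m x)|) N0 _ pert_le _
    (row_mx C 0) (row_mx 0 D) r t Rr Tt r0 t0.
move=> h; have {}h : (gauss_mean (fun w : 'cV[R]_(q + p) =>
     \sum_s `|dotv (row_mx C 0 *m w) (B s *m (row_mx 0 D *m w))|)%R <= (N0 * M)%:E)%E.
  apply: h.
  - move=> a b z x a0 b0; rewrite mulr_sumr; apply: eq_bigr => s _.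
    by rewrite -scalemxAr dotvZl dotvZr mulrA !normrM (ger0_norm a0) (ger0_norm b0).
  - move=> l; apply: le_trans (trC l).
    by rewrite mxtrace_mulC mulmxA tr_row_mx mul_row_col trmx0 mul0mx addr0.
  - move=> l; apply: le_trans (trD l).
    by rewrite mxtrace_mulC mulmxA tr_row_mx mul_row_col trmx0 mul0mx add0r.
  - by move=> z x; exact: sumr_ge0.
  - exact: rcol_measurable_sum.
rewrite -lee_fin EFinM; apply: le_trans (lee_wpmul2l _ h); last first.
  by rewrite lee_fin vartheta_ge0// muln_gt0.
rewrite gauss_mean_sum// -sumEFin ge0_sume_distrr; last first.
  by move=> s _; exact: gauss_mean_ge0.
apply: lee_sum => s _.
have := svd_perturbation_mean (svd1 s) k0; rewrite addnn -mul2n.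
move=> /le_trans; apply; rewrite lee_wpmul2l ?lee_fin ?vartheta_ge0// ?muln_gt0//.
rewrite le_eqVlt; apply/orP; left; apply/eqP; apply: eq_gauss_mean => w; congr `|_|.
rewrite -{3 4}(vsubmxK w) !mul_row_col !mul0mx addr0 add0r.
by rewrite -!mulmxA [RHS]dotv_mulmxl.
Qed.

End main_estimate.

(** * Norms given by polars and convex hulls *)

Section polar_norms.
Context {R : realType}.

Lemma ball_norm_le p (X : set 'cV[R]_p) x r : 0 <= r -> (exists2 v, X v & x = r *: v) ->
  ball_norm X x <= r.
Proof. by move=> r0 h; apply: ge_inf; [exists 0 => y []|split]. Qed.

Lemma le_ball_norm_polar p (Z : set 'cV[R]_p) y c : Z 0 ->
  (forall z, Z z -> dotv z y <= c) -> ball_norm (polar Z) y <= c.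
Proof.
move=> Z0 h; have c0 : 0 <= c by rewrite -(dotv0l y); exact: h.
apply/ler_addgt0Pr => e e0; have ce : 0 < c + e by rewrite ltr_wpDl.
apply: ball_norm_le; first exact: ltW.
exists ((c + e)^-1 *: y); last by rewrite scalerA divff ?scale1r// gt_eqF.
move=> z Zz; rewrite dotvZl dotvC ler_pdivrMl// mulr1.
by apply: le_trans (h z Zz) _; rewrite lerDl ltW.
Qed.

Lemma dotv_le_ball_norm_polar p (Z : set 'cV[R]_p) y c z : Z 0 ->
  (forall z', Z z' -> dotv z' y <= c) -> Z z -> dotv z y <= ball_norm (polar Z) y.
Proof.
move=> Z0 h Zz; have c0 : 0 <= c by rewrite -(dotv0l y); exact: h.
apply: lb_le_inf.
  have ce : 0 < c + 1 by rewrite ltr_wpDl.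
  exists (c + 1); split; first exact: ltW.
  exists ((c + 1)^-1 *: y); last by rewrite scalerA divff ?scale1r// gt_eqF.
  move=> z' Zz'; rewrite dotvZl dotvC ler_pdivrMl// mulr1.
  by apply: le_trans (h _ Zz') _; rewrite lerDl.
move=> r [r0 [v pv ->]]; rewrite dotvZr dotvC -[leRHS]mulr1 ler_wpM2l//.
exact: pv.
Qed.

Variables (m n : nat) (Z : set 'cV[R]_m) (X : set 'cV[R]_n) (U : set 'M[R]_(m, n)).
Hypotheses (Z0 : Z 0) (X0 : X 0) (U0 : U !=set0).
Hypothesis X_absorbing : forall x, exists2 r, 0 < r & exists2 v, X v & x = r *: v.
Hypothesis bounded : exists M, forall A x z, U A -> X x -> Z z -> dotv z (A *m x) <= M.

Let opnorm_le (A : 'M[R]_(m, n)) c x : (forall x z, X x -> Z z -> dotv z (A *m x) <= c) ->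
  ball_norm X x <= 1 -> ball_norm (polar Z) (A *m x) <= c.
Proof.
move=> h x1; have c0 : 0 <= c by have := h 0 0 X0 Z0; rewrite dotv0l.
apply: le_ball_norm_polar => // z Zz; apply/ler_addgt0Pr => e e0.
have hinf : has_inf [set r | 0 <= r /\ exists2 v, X v & x = r *: v].
  split; last by exists 0 => r [].
  by have [r r0 h'] := X_absorbing x; exists r; split=> //; exact: ltW.
have d0 : 0 < e / (c + 1) by rewrite divr_gt0// ltr_wpDl.
have [r [r0 [v Xv xE]] rlt] := inf_adherent d0 hinf.
rewrite {1}xE -scalemxAr dotvZr.
apply: (@le_trans _ _ (r * c)); first by rewrite ler_wpM2l// h.
have r1 : r <= 1 + e / (c + 1).
  by apply: le_trans (ltW rlt) _; rewrite lerD2r.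
apply: le_trans (ler_wpM2r c0 r1) _; rewrite mulrDl mul1r lerD2l mulrAC.
have c1 : 0 < c + 1 by rewrite ltr_wpDl.
by rewrite ler_pdivrMr// ler_pM2l// lerDl.
Qed.

Let ball_norm_le1 x : X x -> ball_norm X x <= 1.
Proof. by move=> Xx; apply: ball_norm_le => //; exists x; rewrite ?scale1r. Qed.

Let opnorm_ub (A : 'M[R]_(m, n)) c : (forall x z, X x -> Z z -> dotv z (A *m x) <= c) ->
  opnorm (polar Z) X A <= c.
Proof.
move=> h; apply: ge_sup; last by move=> _ [x x1 <-]; exact: opnorm_le.
by exists (ball_norm (polar Z) (A *m 0)), 0 => //; exact: ball_norm_le1.
Qed.

Lemma opnorm_set_le c : (forall A x z, U A -> X x -> Z z -> dotv z (A *m x) <= c) ->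
  opnorm_set (polar Z) X U <= c.
Proof.
move=> h; apply: ge_sup; first by have [A UA] := U0; exists (opnorm (polar Z) X A), A.
by move=> _ [A UA <-]; apply: opnorm_ub => x z; exact: h.
Qed.

Lemma le_opnorm_set A x z : U A -> X x -> Z z ->
  dotv z (A *m x) <= opnorm_set (polar Z) X U.
Proof.
move=> UA Xx Zz; have [M hM] := bounded.
apply: (@le_trans _ _ (opnorm (polar Z) X A)); last first.
  apply: sup_ubound; last by exists A.
  by exists M => _ [B UB <-]; apply: opnorm_ub => ? ?; exact: hM.
apply: (@le_trans _ _ (ball_norm (polar Z) (A *m x))).
  by apply: (@dotv_le_ball_norm_polar _ _ _ M) => // z' Zz'; exact: hM.
apply: sup_ubound; last by exists x => //; exact: ball_norm_le1.
by exists M => _ [y y1 <-]; apply: opnorm_le => // ? ?; exact: hM.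
Qed.

End polar_norms.

Section convex_hulls.
Context {R : realType}.

Lemma conv_hull_convex p (A : set 'cV[R]_p) (x y : 'cV[R]_p) t :
  conv_hull A x -> conv_hull A y -> 0 <= t <= 1 -> conv_hull A (t *: x + (1 - t) *: y).
Proof.
move=> hx hy t01 C [cC AC]; apply: ((convex_setP C).1 cC) => //.
  by apply: hx; split.
by apply: hy; split.
Qed.

Lemma conv_hull_le p (A : set 'cV[R]_p) (f : 'cV[R]_p -> R) c :
  (forall x y, f (x + y) = f x + f y) -> (forall a x, f (a *: x) = a * f x) ->
  (forall x, A x -> f x <= c) -> forall x, conv_hull A x -> f x <= c.
Proof.
move=> fD fZ h x hx; apply: (hx [set x | f x <= c]); split; last exact: h.
apply/convex_setP => y z t /= fy fz /andP[t0 t1]; rewrite fD !fZ.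
have -> : c = t * c + (1 - t) * c by ring.
by rewrite lerD// ler_wpM2l// subr_ge0.
Qed.

Variables (p I : nat) (nu : 'I_I -> nat) (P : forall i, 'M[R]_(p, nu i)).
Variable W : forall i, set 'cV[R]_(nu i).

Lemma conv_images_mem i w : W w -> conv_images P W (P i *m w).
Proof. by move=> Ww C [_]; apply; exists i => //; exists w. Qed.

Lemma conv_images_inhabited x : conv_images P W x -> exists i : 'I_I, True.
Proof.
move=> hx; apply: (hx [set _ | exists i : 'I_I, True]); split.
  by apply/convex_setP.
by move=> y [i _ _]; exists i.
Qed.

Hypothesis W0 : forall i, @W i 0.
Hypothesis WN : forall i w, @W i w -> W (- w).

Lemma conv_imagesN x : conv_images P W x -> conv_images P W (- x).
Proof.
move=> hx; apply: (hx [set x | conv_images P W (- x)]); split.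
  apply/convex_setP => y z t /= hy hz t01.
  by rewrite opprD -!scalerN; exact: conv_hull_convex.
by move=> _ [i _ [w Ww <-]] /=; rewrite -mulmxN; apply: conv_images_mem; exact: WN.
Qed.

Lemma conv_images0 x : conv_images P W x -> conv_images P W 0.
Proof.
by move=> /conv_images_inhabited[i _]; rewrite -(mulmx0 _ (P i)); exact: conv_images_mem.
Qed.

Lemma conv_images_absorbing : (conv_images P W)° !=set0 ->
  forall x, exists2 r, 0 < r & exists2 v, conv_images P W v & x = r *: v.
Proof.
move=> [x0 x0i] y; have /nbhs_ballP[e /= e0 be] := x0i.
pose d := e / (2 * (`|y| + 1)).
have y0 : 0 < 2 * (`|y| + 1) by rewrite mulr_gt0// ltr_wpDl.
have d0 : 0 < d by rewrite divr_gt0.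
have x0d : conv_images P W (x0 + d *: y).
  apply: be; rewrite mx_norm_ball /ball_ /= opprD addrA subrr sub0r normrN normrZ gtr0_norm//.
  rewrite /d mulrAC ltr_pdivrMr// ltr_pM2l//; have := normr_ge0 y; lra.
have x0N : conv_images P W (- x0) by apply: conv_imagesN; apply: be; exact: ballxx.
exists (2 / d); first by rewrite divr_gt0.
exists (2^-1 *: (x0 + d *: y) + (1 - 2^-1) *: - x0).
  by apply: conv_hull_convex => //; rewrite invr_ge0 ler0n invf_le1// ler1n.
have -> : 1 - 2^-1 = 2^-1 :> R by field.
rewrite -scalerDr addrC addKr !scalerA (_ : _ * d = 1) ?scale1r//.
by field; exact: lt0r_neq0.
Qed.

End convex_hulls.

Section uncertain_pair.
Context {R : realType}.
Variables (p q K L S : nat).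
Variables (T : 'I_K -> 'M[R]_p) (calT : set 'cV[R]_K).
Variables (Rm : 'I_L -> 'M[R]_q) (calR : set 'cV[R]_L).
Hypothesis hT : basic_ellitope_data T calT.
Hypothesis hR : basic_ellitope_data Rm calR.

Let Z := ellitope Rm calR.
Let X := ellitope T calT.

Lemma mx_norm_le1P (eps : 'cV[R]_S) : `|eps| <= 1 <-> forall s, `|eps s 0| <= 1.
Proof.
rewrite [`|eps|]mx_normrE; split=> [/bigmax_leP[_ h] s|h].
  by have := h (s, 0) isT.
by apply/bigmax_leP; split=> // -[s j] _ /=; rewrite (ord1 j).
Qed.

Lemma weak_duality (Bnom : 'M[R]_(q, p)) (B : 'I_S -> 'M[R]_(q, p)) M z x :
  uncertainty_set Bnom B M -> Z z -> X x ->
  dotv z (M *m x) <= Opt_pair T calT Rm calR Bnom B.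
Proof.
move=> [eps /= /mx_norm_le1P eps1 <-] [r Rr hz] [t Tt hx].
apply: lb_le_inf.
  have [l [u [G [H [Gb [Hb fp]]]]]] := feasible_exists hT hR Bnom B.
  by exists (support_fun calT l + support_fun calR u), l, u, G, H, Gb, Hb.
move=> _ [l [u [G [H [Gb [Hb [[l0 u0 _ _ [_ hG] [_ hH] hB hnom] ->]]]]]]].
have -> : dotv z ((Bnom + \sum_s eps s 0 *: B s) *m x) =
    dotv z (Bnom *m x) + \sum_s eps s 0 * dotv z (B s *m x).
  rewrite mulmxDl mulmx_suml dotvDr dotv_sumr; congr (_ + _).
  by apply: eq_bigr => s _; rewrite -scalemxAl dotvZr.
have h1 : dotv z (Bnom *m x) <= quad Gb z + quad Hb x.
  by have := half_block_bound z x (_ : `|1| <= 1) hnom; rewrite normr1 mul1r; apply.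
have h2 : \sum_s eps s 0 * dotv z (B s *m x) <= \sum_s (quad (G s) z + quad (H s) x).
  by apply: ler_sum => s _; exact: half_block_bound.
have {hG} := hG z; have {hH} := hH x; rewrite !quadD !quadN !quadD !quad_sum !subr_ge0.
have h3 : \sum_l quad (u l 0 *: Rm l) z <= support_fun calR u.
  apply: le_trans (support_ub hR u Rr); rewrite dotvE; apply: ler_sum => j _.
  by rewrite quadZ ler_wpM2l.
have h4 : \sum_k quad (l k 0 *: T k) x <= support_fun calT l.
  apply: le_trans (support_ub hT l Tt); rewrite dotvE; apply: ler_sum => j _.
  by rewrite quadZ ler_wpM2l.
rewrite big_split/= in h2; lra.
Qed.

Lemma uncertainty_set_neq0 m n (Bnom : 'M[R]_(m, n)) (B : 'I_S -> 'M[R]_(m, n)) :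
  uncertainty_set Bnom B !=set0.
Proof.
exists (Bnom + \sum_s (0 : 'cV[R]_S) s 0 *: B s), 0 => //=.
by rewrite normr0.
Qed.

Section pair_norm.
Variables (Bnom : 'M[R]_(q, p)) (B : 'I_S -> 'M[R]_(q, p)).
Let U := uncertainty_set Bnom B.
Let Z0 : Z 0 := ellitope0 hR.
Let X0 : X 0 := ellitope0 hT.
Let bounded : exists M, forall A x z, U A -> X x -> Z z -> dotv z (A *m x) <= M.
Proof.
by exists (Opt_pair T calT Rm calR Bnom B) => A x z UA Xx Zz; exact: weak_duality.
Qed.

Lemma pair_norm_ub A x z : U A -> X x -> Z z ->
  dotv z (A *m x) <= opnorm_set (polar Z) X U.
Proof. exact: (le_opnorm_set Z0 X0 (ellitope_absorbing hT) bounded). Qed.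

Lemma pair_norm_le c : (forall A x z, U A -> X x -> Z z -> dotv z (A *m x) <= c) ->
  opnorm_set (polar Z) X U <= c.
Proof.
exact: (opnorm_set_le Z0 X0 (uncertainty_set_neq0 _ _) (ellitope_absorbing hT)).
Qed.

Lemma pair_norm_le_Opt : opnorm_set (polar Z) X U <= Opt_pair T calT Rm calR Bnom B.
Proof. by apply: pair_norm_le => A x z *; exact: weak_duality. Qed.

Let N0 := opnorm_set (polar Z) X U.

Let bilin_ub (eps : 'I_S -> R) z x : (forall s, `|eps s| <= 1) -> Z z -> X x ->
  dotv z (Bnom *m x) + \sum_s eps s * dotv z (B s *m x) <= N0.
Proof.
move=> eps1 Zz Xx.
have -> : dotv z (Bnom *m x) + \sum_s eps s * dotv z (B s *m x) =
    dotv z ((Bnom + \sum_s (\col_s eps s : 'cV[R]_S) s 0 *: B s) *m x).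
  rewrite mulmxDl mulmx_suml dotvDr dotv_sumr; congr (_ + _).
  by apply: eq_bigr => s _; rewrite -scalemxAl dotvZr mxE.
apply: pair_norm_ub => //; exists (\col_s eps s) => //=.
by apply/mx_norm_le1P => s; rewrite mxE.
Qed.

Lemma nominal_le_norm z x : Z z -> X x -> `|dotv z (Bnom *m x)| <= N0.
Proof.
move=> Zz Xx; have e0 (s : 'I_S) : `|0 : R| <= 1 by rewrite normr0.
have sum0 z' : \sum_s (0 : R) * dotv z' (B s *m x) = 0.
  by apply: big1 => s _; rewrite mul0r.
have := bilin_ub e0 (ellitopeN Zz) Xx; have := bilin_ub e0 Zz Xx.
by rewrite !sum0 !addr0 dotvNl => h1 h2; rewrite ler_norml -lerNl h1 h2.
Qed.

Lemma perturbation_le_norm z x : Z z -> X x -> \sum_s `|dotv z (B s *m x)| <= N0.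
Proof.
move=> Zz Xx; pose e s : R := Num.sg (dotv z (B s *m x)).
have e1 s : `|e s| <= 1 by rewrite normr_sg; case: (_ != 0).
have e1N s : `|- e s| <= 1 by rewrite normrN.
have := bilin_ub e1N (ellitopeN Zz) Xx; have := bilin_ub e1 Zz Xx.
have -> : \sum_s e s * dotv z (B s *m x) = \sum_s `|dotv z (B s *m x)|.
  by apply: eq_bigr => s _; rewrite [RHS]normrEsg.
have -> : \sum_s - e s * dotv (- z) (B s *m x) = \sum_s `|dotv z (B s *m x)|.
  by apply: eq_bigr => s _; rewrite dotvNl mulrNN [RHS]normrEsg.
rewrite dotvNl; lra.
Qed.

Lemma Opt_pair_le_norm kappa : (forall s, (\rank (B s) <= kappa)%N) ->
  Opt_pair T calT Rm calR Bnom B <=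
  (varsigma R K L + varkappa R K * varkappa R L * vartheta R (2 * kappa)) * N0.
Proof.
move=> rB; exact: (Opt_pair_le_factor hT hR rB nominal_le_norm perturbation_le_norm).
Qed.

End pair_norm.

Lemma Opt_pair_convex Bnom B Bnom' B' (t : R) : 0 <= t <= 1 ->
  Opt_pair T calT Rm calR (t *: Bnom + (1 - t) *: Bnom')
    (fun s : 'I_S => t *: B s + (1 - t) *: B' s) <=
  t * Opt_pair T calT Rm calR Bnom B + (1 - t) * Opt_pair T calT Rm calR Bnom' B'.
Proof.
move=> t01; have /andP[t0 t1] := t01; have t1' : 0 <= 1 - t by rewrite subr_ge0.
have hinf Cn C : has_inf [set v | exists lam ups G H Gbar Hbar,
    feasible_pt T Rm Cn (C : 'I_S -> _) lam ups G H Gbar Hbar /\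
    v = support_fun calT lam + support_fun calR ups].
  split; last first.
    exists 0 => _ [l [u [? [? [? [? [_ ->]]]]]]].
    by rewrite addr_ge0 ?(support_ge0 hT) ?(support_ge0 hR).
  have [l [u [G [H [Gb [Hb fp]]]]]] := feasible_exists hT hR Cn C.
  by exists (support_fun calT l + support_fun calR u), l, u, G, H, Gb, Hb.
apply/ler_addgt0Pr => e e0.
have [_ [l [u [G [H [Gb [Hb [fp ->]]]]]]] lt1] := inf_adherent e0 (hinf Bnom B).
have [_ [l' [u' [G' [H' [Gb' [Hb' [fp' ->]]]]]]] lt2] := inf_adherent e0 (hinf Bnom' B').
rewrite -/(Opt_pair T calT Rm calR Bnom B) in lt1.
rewrite -/(Opt_pair T calT Rm calR Bnom' B') in lt2.
have [l0 u0 _ _ [_ hG] [_ hH] hB hnom] := fp.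
have [l0' u0' _ _ [_ hG'] [_ hH'] hB' hnom'] := fp'.
have combE n N (M : 'I_N -> 'M[R]_n) (a b : 'cV[R]_N) :
    \sum_k (t *: a + (1 - t) *: b) k 0 *: M k =
    t *: (\sum_k a k 0 *: M k) + (1 - t) *: (\sum_k b k 0 *: M k).
  rewrite !scaler_sumr -big_split/=; apply: eq_bigr => k _.
  by rewrite !mxE [LHS]scalerDl !scalerA.
have sumE n (M M' : 'I_S -> 'M[R]_n) A A' :
    \sum_s (t *: M s + (1 - t) *: M' s) + (t *: A + (1 - t) *: A') =
    t *: (\sum_s M s + A) + (1 - t) *: (\sum_s M' s + A').
  by rewrite big_split/= -!scaler_sumr !scalerDr addrACA.
apply: le_trans (@Opt_pair_le _ _ _ _ _ _ _ _ _ _ hT hR _ _ (t *: l + (1 - t) *: l')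
  (t *: u + (1 - t) *: u') (fun s => t *: G s + (1 - t) *: G' s)
  (fun s => t *: H s + (1 - t) *: H' s) (t *: Gb + (1 - t) *: Gb')
  (t *: Hb + (1 - t) *: Hb') _) _.
  apply: (feasible_of_blocks hT hR) => //.
  - by move=> k; rewrite !mxE addr_ge0// mulr_ge0.
  - by move=> k; rewrite !mxE addr_ge0// mulr_ge0.
  - by move=> s; exact: half_block_conv.
  - exact: half_block_conv.
  - move=> x; rewrite sumE combE !quadD !quadZ; apply: lerD; rewrite ler_wpM2l//.
      by have := hG x; rewrite quadD quadN subr_ge0.
    by have := hG' x; rewrite quadD quadN subr_ge0.
  - move=> x; rewrite sumE combE !quadD !quadZ; apply: lerD; rewrite ler_wpM2l//.
      by have := hH x; rewrite quadD quadN subr_ge0.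
    by have := hH' x; rewrite quadD quadN subr_ge0.
apply: (@le_trans _ _ ((t * support_fun calT l + (1 - t) * support_fun calT l') +
    (t * support_fun calR u + (1 - t) * support_fun calR u'))).
  apply: lerD.
  - by apply: le_trans (supportD hT _ _) _; apply: lerD; apply: (supportZ hT).
  - by apply: le_trans (supportD hR _ _) _; apply: lerD; apply: (supportZ hR).
have := ler_wpM2l t0 (ltW lt1); have := ler_wpM2l t1' (ltW lt2).
rewrite !mulrDr; lra.
Qed.

End uncertain_pair.

Section max_pairs.
Context {R : realType}.
Variables (I J : nat).
Implicit Types f g : 'I_I -> 'I_J -> R.

Lemma le_max_pair f i j : f i j <= max_pair f.
Proof.
apply: sup_ubound; last by exists i => //; exists j.
exists (\sum_i \sum_j `|f i j|) => _ [k _ [l _ <-]].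
rewrite (bigD1 k)//= (bigD1 l)//= -addrA; apply: le_trans (ler_norm _) _.
by rewrite lerDl addr_ge0// ?sumr_ge0// => ? _; rewrite sumr_ge0.
Qed.

Lemma max_pair_le f c : (exists i : 'I_I, True) -> (exists j : 'I_J, True) ->
  (forall i j, f i j <= c) -> max_pair f <= c.
Proof.
move=> [i _] [j _] h; apply: ge_sup; first by exists (f i j), i => //; exists j.
by move=> _ [k _ [l _ <-]].
Qed.

End max_pairs.

Theorem proposition4p2 (R : realType) (m n I J S : nat)
    (nu K : 'I_I -> nat) (mu L : 'I_J -> nat)
    (T : forall i : 'I_I, 'I_(K i) -> 'M[R]_(nu i))
    (calT : forall i : 'I_I, set 'cV[R]_(K i))
    (Rm : forall j : 'I_J, 'I_(L j) -> 'M[R]_(mu j))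
    (calR : forall j : 'I_J, set 'cV[R]_(L j))
    (P : forall i : 'I_I, 'M[R]_(n, nu i))
    (Q : forall j : 'I_J, 'M[R]_(m, mu j))
    (Anom : 'M[R]_(m, n)) (A : 'I_S -> 'M[R]_(m, n)) :
  let calX := fun i => ellitope (T i) (calT i) in
  let calZ := fun j => ellitope (Rm j) (calR j) in
  let X := conv_images P calX in
  let Bstar := conv_images Q calZ in
  let B := polar Bstar in
  let U := uncertainty_set Anom A in
  let Uij := fun i j =>
    uncertainty_set ((Q j)^T *m Anom *m P i)
      (fun s => (Q j)^T *m A s *m P i) in
  let normU := opnorm_set B X U in
  let normUij := fun i j => opnorm_set (polar (calZ j)) (calX i) (Uij i j) in
  let kappa := \max_(s < S) \rank (A s) in
  let Optij := fun (Dnom : 'M[R]_(m, n)) (D : 'I_S -> 'M[R]_(m, n)) i j =>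
    Opt_pair (T i) (calT i) (Rm j) (calR j)
      ((Q j)^T *m Dnom *m P i) (fun s => (Q j)^T *m D s *m P i) in
  let Opt := fun Dnom D => max_pair (Optij Dnom D) in
  let factor := fun i j =>
    varsigma R (K i) (L j)
      + varkappa R (K i) * varkappa R (L j) * vartheta R (2 * kappa) in
  (forall i, basic_ellitope_data (T i) (calT i)) ->
  (forall j, basic_ellitope_data (Rm j) (calR j)) ->
  X° !=set0 ->
  Bstar° !=set0 ->
  [/\ convex_function
        (E := ('M[R]_(m, n) * {ffun 'I_S -> 'M[R]_(m, n)})%type) setT
        (fun D => Opt D.1 D.2) /\
      normU <= Opt Anom A,
      forall i j,
        normUij i j <= Optij Anom A i j <= factor i j * normUij i j &
      [/\ normU = max_pair normUij,
          max_pair normUij <= Opt Anom A &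
          Opt Anom A <= max_pair factor * normU]].
Proof.
move=> calX calZ X Bstar B U Uij normU normUij kappa Optij Opt factor hT hR Xint Bint.
have calX0 i : calX i 0 by exact: ellitope0 (hT i).
have calZ0 j : calZ j 0 by exact: ellitope0 (hR j).
have [x0 /interior_subset Xx0] := Xint; have [y0 /interior_subset By0] := Bint.
have I0 := conv_images_inhabited Xx0; have J0 := conv_images_inhabited By0.
have X0 : X 0 := conv_images0 calX0 Xx0.
have B0 : Bstar 0 := conv_images0 calZ0 By0.
have Xabs := conv_images_absorbing (fun i w => @ellitopeN _ _ _ _ _ w) Xint.
have conjU i j M : U M -> Uij i j ((Q j)^T *m M *m P i).
  move=> [eps eps1 <-]; exists eps => //.
  rewrite mulmxDr mulmxDl mulmx_sumr mulmx_suml; congr (_ + _).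
  by apply: eq_bigr => s _; rewrite -scalemxAr -scalemxAl.
have conjU' i j M : Uij i j M -> exists2 M', U M' & M = (Q j)^T *m M' *m P i.
  move=> [eps eps1 <-]; exists (Anom + \sum_s eps s 0 *: A s); first by exists eps.
  rewrite mulmxDr mulmxDl mulmx_sumr mulmx_suml; congr (_ + _).
  by apply: eq_bigr => s _; rewrite -scalemxAr -scalemxAl.
have dotE i j M z w : dotv (Q j *m z) (M *m (P i *m w)) = dotv z ((Q j)^T *m M *m P i *m w).
  by rewrite dotv_mulmxl !mulmxA.
have hull_le M c : (forall i j z w, calZ j z -> calX i w ->
    dotv (Q j *m z) (M *m (P i *m w)) <= c) ->
    forall x y, X x -> Bstar y -> dotv y (M *m x) <= c.
  move=> h x y Xx By.
  apply: (@conv_hull_le _ _ _ (fun y => dotv y (M *m x)) c _ _ _ y By).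
  - by move=> *; rewrite dotvDl.
  - by move=> *; rewrite dotvZl.
  move=> _ [j _ [z Zz <-]].
  apply: (@conv_hull_le _ _ _ (fun x => dotv (Q j *m z) (M *m x)) c _ _ _ x Xx).
  - by move=> *; rewrite mulmxDr dotvDr.
  - by move=> *; rewrite -scalemxAr dotvZr.
  by move=> _ [i _ [w Xw <-]]; exact: h.
have hull_bound M x y : U M -> X x -> Bstar y -> dotv y (M *m x) <= max_pair normUij.
  move=> UM; apply: hull_le => i j z w Zz Xw; apply: le_trans (le_max_pair _ i j).
  by rewrite dotE; apply: (pair_norm_ub (hT i) (hR j)) => //; exact: conjU.
have bounded : exists c, forall M x y, U M -> X x -> Bstar y -> dotv y (M *m x) <= c.
  by exists (max_pair normUij) => M x y; exact: hull_bound.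
have normU_ub := le_opnorm_set B0 X0 Xabs bounded.
have normU_eq : normU = max_pair normUij.
  apply/eqP; rewrite eq_le; apply/andP; split.
    by apply: opnorm_set_le => //; exact: uncertainty_set_neq0.
  apply: max_pair_le => // i j; apply: (pair_norm_le (hT i) (hR j)).
  move=> _ w z /conjU'[M UM ->] Xw Zz; rewrite -dotE.
  by apply: normU_ub => //; exact: conv_images_mem.
have pair_le_Opt i j : normUij i j <= Optij Anom A i j.
  exact: (pair_norm_le_Opt (hT i) (hR j)).
have max_le_Opt : max_pair normUij <= Opt Anom A.
  by apply: max_pair_le => // i j; exact: le_trans (pair_le_Opt i j) (le_max_pair _ i j).
have Opt_le_pair i j : Optij Anom A i j <= factor i j * normUij i j.
  apply: (Opt_pair_le_norm (hT i) (hR j)) => s.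
  apply: leq_trans (mxrankM_maxl _ _) _; apply: leq_trans (mxrankM_maxr _ _) _.
  exact: (leq_bigmax s).
have normU_ge0 : 0 <= normU.
  have [M UM] := uncertainty_set_neq0 Anom A.
  by apply: le_trans (normU_ub M 0 0 UM X0 B0); rewrite dotv0l.
split; first split.
- move=> t D D' _ _; apply: max_pair_le => // i j.
  set s := t%:num; have s01 : 0 <= s <= 1 by rewrite /s ge0 le1.
  apply: (@le_trans _ _ (s * Optij D.1 D.2 i j + (1 - s) * Optij D'.1 D'.2 i j)).
    apply: le_trans (Opt_pair_convex (hT i) (hR j) _ _ _ _ s01).
    rewrite le_eqVlt; apply/orP; left; apply/eqP.
    have combE (M M' : 'M[R]_(m, n)) : (Q j)^T *m (s *: M + (1 - s) *: M') *m P i =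
        s *: ((Q j)^T *m M *m P i) + (1 - s) *: ((Q j)^T *m M' *m P i).
      by rewrite mulmxDr mulmxDl -!scalemxAr -!scalemxAl.
    rewrite /Optij -combE; congr Opt_pair; apply/funext => k.
    by rewrite -combE !ffunE.
  have /andP[s0 s1] := s01; apply: lerD; apply: ler_wpM2l => //.
  - exact: le_max_pair (Optij D.1 D.2) i j.
  - by rewrite subr_ge0.
  - exact: le_max_pair (Optij D'.1 D'.2) i j.
- by rewrite normU_eq.
- by move=> i j; rewrite pair_le_Opt Opt_le_pair.
split=> //; apply: max_pair_le => // i j; apply: le_trans (Opt_le_pair i j) _.
apply: (@le_trans _ _ (factor i j * normU)).
  have factor_ge0 : 0 <= factor i j.
    apply: addr_ge0.
      by rewrite /varsigma; case: ifP => // _; rewrite mulr_ge0// sqrtr_ge0.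
    apply: mulr_ge0; first by rewrite mulr_ge0 ?varkappa_ge0.
    have [->|k0] := posnP (2 * kappa); first by rewrite /vartheta eqxx.
    exact: vartheta_ge0.
  by rewrite ler_wpM2l// normU_eq le_max_pair.
by rewrite ler_wpM2r// le_max_pair.
Qed.
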